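(* Under the setting and notation of the context, suppose Assumption $(\mathcal A_1)$ holds and put $\bar S=\sum_{j=1}^{\bar n}\bar A_j$. Then, as $x\to+\infty$, $$\mathbb P[X^{(1)}\ge x]=\frac{C}{\bar S}(\log x)^{-\frac{1+\bar n}{2}}x^{\sum_{i=1}^{\bar n}\bar A_i\left(\log\frac{\bar S}{|\bar A_i|}+\bar\mu_i\right)}\exp\left\{-\tfrac12\bar S\log^2x\right\}\left(1+O\left((\log x)^{-1}\right)\right),$$ where $$C=\frac{1}{\sqrt{2\pi\det\bar{\mathfrak B}}}\sqrt{\frac{\bar S}{\prod_{i=1}^{\bar n}|\bar A_i|}}\exp\left\{-\tfrac12\sum_{i,m=1}^{\bar n}\bar a_{im}\left(\log\tfrac{\bar S}{|\bar A_i|}+\bar\mu_i\right)\left(\log\tfrac{\bar S}{|\bar A_m|}+\bar\mu_m\right)\right\}.$$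
   Context: Let $Y=(Y_1,\dots,Y_n)$ be a Gaussian vector with mean $\mu\in\mathbb R^n$ and covariance matrix $\mathfrak B=(b_{ij})$ with $\det\mathfrak B>0$, and $X^{(1)}=e^{Y_1}-\sum_{k=2}^ne^{Y_k}$. Let $\Delta_{1,n}=\{w\in\mathbb R^n: w_1\ge0,\ w_i\le0\ (i=2,\dots,n),\ \sum_iw_i=1\}$ and let $\bar w$ be the unique minimizer of $w^\top\mathfrak Bw$ over $\Delta_{1,n}$. Let $\bar I=\{i:\bar w_i\neq0\}$ (it contains $1$) and $\bar n=|\bar I|$; since $X^{(1)}$ is symmetric in $Y_2,\dots,Y_n$, the coordinates are labeled so that $\bar I=\{1,\dots,\bar n\}$. Set $\bar\mu=(\mu_1,\dots,\mu_{\bar n})$, $\bar{\mathfrak B}=(b_{ij})_{i,j=1}^{\bar n}$, let $\bar a_{ij}$ be the entries of $\bar{\mathfrak B}^{-1}$ and $\bar A_k=\sum_{j=1}^{\bar n}\bar a_{kj}$. Let $e^i$ be the $i$-th standard basis vector. Assumption $(\mathcal A_1)$: for every $i\in\{1,\dots,n\}\setminus\bar I$, $(e^i-\bar w)^\top\mathfrak B\bar w\neq0$. *)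

(* Defs.v *)
From HB Require Import structures.
From mathcomp Require Import all_boot all_order all_algebra.
From mathcomp Require Import all_classical all_reals all_analysis.
Set Implicit Arguments. Unset Strict Implicit. Unset Printing Implicit Defensive.
Import Order.TTheory GRing.Theory Num.Theory.
Local Open Scope classical_set_scope.
Local Open Scope ring_scope.

Definition qform {R : realType} {n : nat} (B : 'M[R]_n) (u v : 'rV[R]_n) : R :=
  (u *m B *m v^T) 0 0.

Definition lincomb {R : realType} {d} {T : measurableType d} {P : probability T R}
  {n : nat} (t : 'rV[R]_n) (Y : 'I_n -> {RV P >-> R}) : T -> R :=
  fun w => \sum_(i < n) t 0 i * Y i w.

Definition gaussian_vector {R : realType} {d} {T : measurableType d}
  (P : probability T R) (n : nat) (Y : 'I_n -> {RV P >-> R})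
  (mu : 'rV[R]_n) (B : 'M[R]_n) : Prop :=
  B^T = B /\ (forall t : 'rV[R]_n, 0 <= qform B t t) /\
  forall t : 'rV[R]_n,
    (0 < qform B t t ->
      forall A : set R, measurable A ->
        P (lincomb t Y @^-1` A) =
        normal_prob (\sum_(i < n) t 0 i * mu 0 i) (Num.sqrt (qform B t t)) A) /\
    (qform B t t = 0 ->
        P [set w | lincomb t Y w = \sum_(i < n) t 0 i * mu 0 i] = 1%E).

(* Delta_{1,n} (index 1 of the paper is ord0 here) *)
Definition simplex1 {R : realType} {n : nat} (w : 'rV[R]_n.+1) : Prop :=
  0 <= w 0 ord0 /\ (forall i : 'I_n.+1, i != ord0 -> w 0 i <= 0) /\
  \sum_(i < n.+1) w 0 i = 1.

Definition is_simplex_minimizer {R : realType} {n : nat} (B : 'M[R]_n.+1)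
  (wbar : 'rV[R]_n.+1) : Prop :=
  simplex1 wbar /\ forall w, simplex1 w -> qform B wbar wbar <= qform B w w.

Definition X1 {R : realType} {d} {T : measurableType d} {P : probability T R}
  {n : nat} (Y : 'I_n.+1 -> {RV P >-> R}) : T -> R :=
  fun w => expR (Y ord0 w) - \sum_(k < n.+1 | k != ord0) expR (Y k w).

Section bar.
Variables (R : realType) (n nbar : nat) (sigma : 'I_nbar -> 'I_n.+1).
Variables (mu : 'rV[R]_n.+1) (B : 'M[R]_n.+1).

Definition Bbar : 'M[R]_nbar := \matrix_(i, j) B (sigma i) (sigma j).
Definition abar : 'M[R]_nbar := invmx Bbar.
Definition Abar (k : 'I_nbar) : R := \sum_(j < nbar) abar k j.
Definition Sbar : R := \sum_(j < nbar) Abar j.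
Definition Lbar (i : 'I_nbar) : R := ln (Sbar / `|Abar i|) + mu 0 (sigma i).

Definition Cconst : R :=
  (Num.sqrt (pi *+ 2 * \det Bbar))^-1 *
  Num.sqrt (Sbar / \prod_(i < nbar) `|Abar i|) *
  expR (- (2^-1) * \sum_(i < nbar) \sum_(m < nbar) abar i m * Lbar i * Lbar m).

Definition main_term (x : R) : R :=
  Cconst / Sbar * powR (ln x) (- ((1 + nbar%:R) / 2)) *
  powR x (\sum_(i < nbar) Abar i * Lbar i) *
  expR (- (2^-1) * Sbar * (ln x) ^+ 2).
End bar.

(* Main.v *)
(* Put L = log x. On the event {X >= x} the vector Y, shifted coordinatewise by
   L + log |w_i| (w the minimizer), satisfies sum_i w_i exp v_i >= 1, and its
   Gaussian density becomes exp(- S L^2 / 2 + b L) times exp(- L S w.v + z v)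
   with z quadratic. The exact asymptotics of the remaining integral come from a
   change of variables that makes it a product of one-dimensional Laplace
   integrals of exp(- a (exp u - 1 - u)), up to a factor expanded to first order.
   Coordinates outside the support of w are discarded: by the optimality
   conditions and (A1) the derivative of the quadratic form at w in those
   directions is strictly smaller, so a Chernoff bound makes their contribution
   exponentially negligible in L^2. *)

Require Import Defs.
From HB Require Import structures.
From mathcomp Require Import all_boot all_order all_algebra fingroup perm.
From mathcomp Require Import all_classical all_reals all_analysis.
From mathcomp Require Import measurable_realfun.
From mathcomp Require Import ring lra.
Import Order.TTheory GRing.Theory Num.Theory.
Import numFieldNormedType.Exports.
Local Open Scope classical_set_scope.
Local Open Scope ring_scope.

Set Implicit Arguments.
Unset Strict Implicit.
Unset Printing Implicit Defensive.

(** * Lebesgue measure on tuples *)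

(** [gaussian_vector] only prescribes the laws of linear combinations, so the density of the
    coordinates on the support has to be recovered first: hence a Cramer-Wold theorem and a
    recursive evaluation of Gaussian integrals. The obstacle in the Laplace integral is the curved
    boundary of [sum_i w_i exp v_i >= 1], which couples the variables. To decouple them, the
    integral is multiplied by an auxiliary factor of known size, the integral of
    [exp (- lam * w0 * hexp r)]: the extra variable [r] makes the coordinates homogeneous, the
    constraint becomes [0 <= e] for a slack variable, and only translations are used, so no Jacobian
    occurs. The factor is divided out at the end. The error is [1 / L] rather than [1 / sqrt L]
    because cubic Taylor terms cancel between [u] and [- u], and because linear terms are not
    counted as errors but absorbed exactly by a change of parameter. The discarded coordinates are
    paid for by raising the level from [L] to [L + L^-2], which changes the main term only by a
    factor [1 + O(1 / L)]. *)

Section lebesgue_affine.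
Context {R : realType}.
Local Notation leb := (@lebesgue_measure R).
Local Open Scope ereal_scope.

Lemma ge0_integral_shift (c : R) (f : R -> \bar R) :
  measurable_fun [set: R] f -> (forall x, 0 <= f x) ->
  \int[leb]_x f (x + c)%R = \int[leb]_x f x.
Proof.
move=> mf f0.
have mp : @measurable_fun _ _ (measurableTypeR R) (measurableTypeR R) setT
    (fun x => x + c)%R.
  exact: measurable_funD.
rewrite -(@ge0_integral_pushforward _ _ _ _ _ _ mp leb setT f)//.
(* The image measure is identified by its values on the intervals []a, b]]. *)
apply: eq_measure_integral => A mA _; apply/esym/lebesgue_measure_unique => //.
move=> _ [[a b] _ <-].
change (leb `]a, b] = leb ((fun x => x + c)%R @^-1` `]a, b])).
have -> : (fun x => x + c)%R @^-1` `]a, b] = [set` `](a - c)%R, (b - c)%R]].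
  by apply/seteqP; split => x /=; rewrite !in_itv/= lerBrDr ltrBlDr.
by rewrite !lebesgue_measure_itv/= !lte_fin ltrD2r -!EFinB opprB addrA subrK.
Qed.

Lemma ge0_integral_opp (f : R -> \bar R) :
  measurable_fun [set: R] f -> (forall x, 0 <= f x) ->
  \int[leb]_x f (- x)%R = \int[leb]_x f x.
Proof.
move=> mf f0.
have mp : @measurable_fun _ _ (measurableTypeR R) (measurableTypeR R) setT
    -%R by [].
rewrite -(@ge0_integral_pushforward _ _ _ _ _ _ mp leb setT f)//.
by apply: eq_measure_integral => A mA _; exact: lebesgue_measureN.
Qed.

Lemma ge0_integral_scale (c : R) (f : R -> \bar R) : (0 < c)%R ->
  measurable_fun [set: R] f -> (forall x, 0 <= f x) ->
  c%:E * \int[leb]_x f (c * x)%R = \int[leb]_x f x.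
Proof.
move=> c0 mf f0.
have mp : @measurable_fun _ _ (measurableTypeR R) (measurableTypeR R) setT
    (fun x => c * x)%R.
  exact: measurable_funM.
rewrite -(@ge0_integral_pushforward _ _ _ _ _ _ mp leb setT f)//.
have c0' : (0 <= c)%R by exact: ltW.
apply: etrans.
  apply/esym.
  exact: (@ge0_integral_mscale _ (measurableTypeR R) _ _ setT measurableT
    (NngNum c0') f mf (fun x _ => f0 x)).
apply: eq_measure_integral => A mA _; apply/esym/lebesgue_measure_unique => //.
move=> _ [[a b] _ <-].
change (leb `]a, b] = c%:E * leb ((fun x => c * x)%R @^-1` `]a, b])).
have -> : (fun x => c * x)%R @^-1` `]a, b] = [set` `](c^-1 * a)%R, (c^-1 * b)%R]].
  by apply/seteqP; split => x /=;
    rewrite !in_itv/= ltr_pdivrMl// ler_pdivlMl.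
rewrite !lebesgue_measure_itv/= !lte_fin ltr_pM2l ?invr_gt0//.
case: ifPn; rewrite ?mule0// -!EFinB -EFinM.
by rewrite -mulrBr mulrA divff ?mul1r// gt_eqF.
Qed.

End lebesgue_affine.

Section lebn.
Context {R : realType}.
Local Notation leb := (@lebesgue_measure R).
Local Open Scope ereal_scope.

Definition consp n (p : R * n.-tuple R) : n.+1.-tuple R := [tuple of p.1 :: p.2].

Lemma measurable_consp n : measurable_fun setT (@consp n).
Proof. exact: measurable_cons. Qed.

Section succ.
Variables (n : nat) (m : {sigma_finite_measure set (n.-tuple R) -> \bar R}).

Definition lebn_succ : set (n.+1.-tuple R) -> \bar R :=
  pushforward (leb \x m) (@consp n).

Let lebn_succ0 : lebn_succ set0 = 0.
Proof. by rewrite /lebn_succ /pushforward preimage_set0 measure0. Qed.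

Let lebn_succ_ge0 A : 0 <= lebn_succ A.
Proof. by rewrite /lebn_succ /pushforward measure_ge0. Qed.

Let lebn_succ_sigma_additive : semi_sigma_additive lebn_succ.
Proof.
have := @measure_semi_sigma_additive _ _ _
  (pushforward (leb \x m) (@consp n) : {measure set _ -> \bar R}).
by apply; exact: measurable_consp.
Qed.

HB.instance Definition _ := isMeasure.Build _ _ _ lebn_succ
  lebn_succ0 lebn_succ_ge0 lebn_succ_sigma_additive.

Let lebn_succ_sigma_finite : sigma_finite setT lebn_succ.
Proof.
have /sigma_finiteP[F [TF ndF Fo]] := sigma_finiteT leb.
have /sigma_finiteP[G [TG ndG Go]] := sigma_finiteT m.
pose un (t : n.+1.-tuple R) : R * n.-tuple R := (thead t, [tuple of behead t]).
have consK : cancel (@consp n) un by case=> x t; congr pair; apply/val_inj.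
have mun : measurable_fun setT un.
  apply/measurable_fun_pairP; split; last exact: measurable_behead.
  exact: measurable_tnth.
(* Both exhaustions are nondecreasing, so a point in [F k] and [G l] lies in the rectangle of index
   [maxn k l]. *)
exists (fun k => un @^-1` (F k `*` G k)).
  apply/esym; rewrite -subTset => t _.
  have [k _ Fk] : (\bigcup_i F i) (un t).1 by rewrite -TF.
  have [l _ Gl] : (\bigcup_i G i) (un t).2 by rewrite -TG.
  exists (maxn k l) => //; split.
    by move: Fk; exact/subsetPset/ndF/leq_maxl.
  by move: Gl; exact/subsetPset/ndG/leq_maxr.
move=> k; have [mF Ff] := Fo k; have [mG Gf] := Go k; split.
  by rewrite -[X in measurable X]setTI; apply: mun => //; exact: measurableX.
rewrite /lebn_succ /pushforward -comp_preimage.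
rewrite (_ : un \o _ = id) ?preimage_id//; last by apply/funext => p /=.
by rewrite product_measure1E// lte_mul_pinfty// ge0_fin_numE.
Qed.

HB.instance Definition _ := Measure_isSigmaFinite.Build _ _ _ lebn_succ
  lebn_succ_sigma_finite.

End succ.

(** Sigma-finiteness is bundled in the type because forming the next product and applying Tonelli to
    it both use it. The point mass at the empty tuple gives the value 1 to empty products. *)
Fixpoint lebn n : {sigma_finite_measure set (n.-tuple R) -> \bar R} :=
  match n with
  | 0 => \d_([tuple] : 0.-tuple R)
  | n.+1 => lebn_succ (lebn n)
  end.

Lemma measurable_lebn d (T : measurableType d) n
    (f : T * n.-tuple R -> \bar R) :
  measurable_fun setT f -> (forall x, 0 <= f x) ->
  measurable_fun setT (fun x => \int[lebn n]_t f (x, t)).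
Proof. by move=> mf f0; exact: measurable_fun_fubini_tonelli_F. Qed.

Lemma measurable_cons_tail n (f : n.+1.-tuple R -> \bar R) (x : R) :
  measurable_fun setT f ->
  measurable_fun setT (fun t : n.-tuple R => f [tuple of x :: t]).
Proof.
move=> mf; apply: (measurableT_comp mf).
by apply: measurable_cons; [exact: measurable_cst|exact: measurable_id].
Qed.

Lemma measurable_lebn1 n (f : n.+1.-tuple R -> \bar R) :
  measurable_fun setT f -> (forall x, 0 <= f x) ->
  measurable_fun [set: R] (fun x => \int[lebn n]_t f [tuple of x :: t]).
Proof.
move=> mf f0; apply: (@measurable_lebn _ R n (f \o @consp n)) => [|p]; last exact: f0.
by apply: measurableT_comp => //; exact: measurable_consp.
Qed.

Lemma integral_lebn0 (f : 0.-tuple R -> \bar R) :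
  measurable_fun setT f -> \int[lebn 0]_t f t = f [tuple].
Proof. by move=> mf; rewrite /= integral_dirac// diracT mul1e. Qed.

Lemma integral_lebnS n (f : n.+1.-tuple R -> \bar R) :
  measurable_fun setT f -> (forall x, 0 <= f x) ->
  \int[lebn n.+1]_t f t = \int[leb]_x \int[lebn n]_t f [tuple of x :: t].
Proof.
move=> mf f0 /=; rewrite /lebn_succ ge0_integral_pushforward//; last first.
  exact: measurable_consp.
rewrite preimage_setT fubini_tonelli1//; last by move=> p; exact: f0.
by apply: measurableT_comp => //; exact: measurable_consp.
Qed.

Lemma integral_lebnS_swap n (f : n.+1.-tuple R -> \bar R) :
  measurable_fun setT f -> (forall x, 0 <= f x) ->
  \int[lebn n.+1]_t f t = \int[lebn n]_t \int[leb]_x f [tuple of x :: t].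
Proof.
move=> mf f0; rewrite integral_lebnS//.
apply: (@fubini_tonelli _ _ _ _ _ leb (lebn n) (f \o @consp n)) => [|p];
  last exact: f0.
by apply: measurableT_comp => //; exact: measurable_consp.
Qed.

Definition tadd n (s t : n.-tuple R) : n.-tuple R :=
  [tuple (tnth t i + tnth s i)%R | i < n].

Lemma measurable_tadd n (s : n.-tuple R) : measurable_fun setT (tadd s).
Proof.
apply/measurable_fun_tnthP => i.
rewrite (_ : _ \o _ = fun t => tnth t i + tnth s i)%R; last first.
  by apply/funext => t /=; rewrite tnth_mktuple.
by apply: measurable_funD => //; exact: measurable_tnth.
Qed.

Lemma tadd_cons n (a x : R) (s t : n.-tuple R) :
  tadd [tuple of a :: s] [tuple of x :: t] = [tuple of (x + a)%R :: tadd s t].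
Proof.
apply: eq_from_tnth => i; rewrite tnth_mktuple.
by case: (unliftP ord0 i) => [j|] ->; rewrite ?tnthS ?tnth0// tnth_mktuple.
Qed.

Lemma integral_lebn_shift n (s : n.-tuple R) (f : n.-tuple R -> \bar R) :
  measurable_fun setT f -> (forall x, 0 <= f x) ->
  \int[lebn n]_t f (tadd s t) = \int[lebn n]_t f t.
Proof.
elim: n s f => [|n IH] s f mf f0.
  rewrite !integral_lebn0//; last exact: (measurableT_comp mf (measurable_tadd s)).
  by congr f; exact: tuple0.
rewrite !integral_lebnS//; last exact: (measurableT_comp mf (measurable_tadd s)).
rewrite (tuple_eta s); set a := thead s; set s' := [tuple of behead s].
rewrite -(ge0_integral_shift a (f := fun x => \int[lebn n]_t f [tuple of x :: t])).
- apply: eq_integral => x _.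
  rewrite -[RHS](IH s')//; last exact: measurable_cons_tail.
  by apply: eq_integral => t _; rewrite tadd_cons.
- exact: measurable_lebn1.
- by move=> x; apply: integral_ge0 => t _.
Qed.

Lemma integral_lebn_prod n (f : 'I_n -> R -> \bar R) :
  (forall i, measurable_fun [set: R] (f i)) -> (forall i x, 0 <= f i x) ->
  \int[lebn n]_t \prod_(i < n) f i (tnth t i) = \prod_(i < n) \int[leb]_x f i x.
Proof.
have mp m (g : 'I_m -> R -> \bar R) : (forall i, measurable_fun [set: R] (g i)) ->
    measurable_fun setT (fun t : m.-tuple R => \prod_(i < m) g i (tnth t i)).
  move=> mg; elim: (index_enum _) => [|i s IHs].
    by under eq_fun do rewrite big_nil; exact: measurable_cst.
  under eq_fun do rewrite big_cons; apply: emeasurable_funM => //.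
  by apply: measurableT_comp => //; exact: measurable_tnth.
elim: n f => [|n IH] f mf f0.
  by rewrite integral_lebn0 ?big_ord0//; exact: mp.
rewrite integral_lebnS; [|exact: mp|by move=> t; apply: prode_ge0].
under eq_integral => x _ do under eq_integral => t _ do rewrite big_ord_recl tnth0.
rewrite big_ord_recl -IH// -ge0_integralZr//; last 2 first.
- exact: mf.
- by apply: integral_ge0 => t _; apply: prode_ge0.
apply: eq_integral => x _.
under eq_integral => t _ do under eq_bigr => i _ do rewrite tnthS.
rewrite ge0_integralZl//; first exact: (mp _ (fun i => f (lift ord0 i))).
by move=> t _; apply: prode_ge0.
Qed.

End lebn.

(** * The Cramer-Wold theorem *)

Section cramer_wold.
Context {R : realType}.

Lemma bernoulli_ineq (x : R) n : 0 <= x -> 1 + n%:R * x <= (1 + x) ^+ n.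
Proof.
move=> x0; elim: n => [|n IH]; first by rewrite mul0r addr0 expr0.
rewrite exprS; apply: (@le_trans _ _ ((1 + x) * (1 + n%:R * x))).
  rewrite -natr1; have : 0 <= n%:R * x * x by rewrite !mulr_ge0.
  by nra.
by rewrite ler_wpM2l// addr_ge0.
Qed.

Lemma onem_expr_ge (x : R) n : 0 <= x <= 1 -> 1 - n%:R * x <= (1 - x) ^+ n.
Proof.
move=> /andP[x0 x1]; elim: n => [|n IH]; first by rewrite mul0r subr0 expr0.
rewrite exprS; apply: (@le_trans _ _ ((1 - x) * (1 - n%:R * x))).
  rewrite -natr1; have : 0 <= n%:R * x * x by rewrite !mulr_ge0.
  by nra.
by rewrite ler_wpM2l// subr_ge0.
Qed.

(** With [r = q ^+ 2], Bernoulli's inequality for [q^-1 = 1 + c] bounds [n * q ^+ n] by [c^-1]; the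
    remaining factor [q ^+ n] is geometric. *)
Lemma cvg_natmul_expr (r : R) : 0 <= r < 1 -> n%:R * r ^+ n @[n --> \oo] --> (0 : R).
Proof.
move=> /andP[r0 r1]; have [->|rn0] := eqVneq r 0.
  apply: cvg_near_cst; apply: nearW => -[|n]; first by rewrite mul0r.
  by rewrite expr0n mulr0.
pose q := Num.sqrt r.
have q0 : 0 < q by rewrite sqrtr_gt0 lt_neqAle eq_sym rn0.
have q1 : q < 1 by rewrite -sqrtr1 ltr_sqrt.
have rq : r = q * q by rewrite -expr2 sqr_sqrtr.
pose c := q^-1 - 1.
have c0 : 0 < c by rewrite subr_gt0 invf_gt1.
have bnd n : 0 <= n%:R * r ^+ n <= c^-1 * q ^+ n.
  rewrite mulr_ge0 ?exprn_ge0//= rq exprMn mulrA ler_pM2r ?exprn_gt0//.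
  rewrite -[leRHS]mul1r ler_pdivlMr// mulrAC -ler_pdivlMr ?exprn_gt0// mul1r.
  rewrite -exprVn (_ : q^-1 = 1 + c); last by rewrite /c addrC subrK.
  by apply: le_trans (bernoulli_ineq n (ltW c0)); rewrite lerDr.
apply: (@squeeze_cvgr _ _ _ _ (fun=> 0) (fun n => c^-1 * q ^+ n)).
- by apply: nearW.
- exact: cvg_cst.
- by apply: (@cvg_geometric R c^-1 q); rewrite ger0_norm// ltW.
Qed.

(* Powers turn a polynomial in the smoothed sign [s] into the indicator of
   [s < 1/2], so indicators are limits of trigonometric polynomials. *)
Lemma cvg_onem_expr (s : R) : 0 <= s <= 1 ->
  (1 - s ^+ n) ^+ (n * 2 ^ n) @[n --> \oo] --> ((s < 2^-1)%R%:R : R).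
Proof.
move=> /andP[s0 s1].
have sn n : 0 <= s ^+ n <= 1 by rewrite exprn_ge0//= exprn_ile1.
have b01 n : 0 <= (1 - s ^+ n) ^+ (n * 2 ^ n) <= 1.
  have /andP[? ?] := sn n.
  by rewrite exprn_ge0 ?subr_ge0//= exprn_ile1// ?subr_ge0// lerBlDr lerDl.
have [s2|s2] := ltP s 2^-1.
  apply: (@squeeze_cvgr _ _ _ _ (fun n => 1 - n%:R * (2 * s) ^+ n) (fun=> 1)).
  - apply: nearW => n; have /andP[_ ->] := b01 n; rewrite andbT.
    apply: le_trans (onem_expr_ge _ (sn n)).
    by rewrite natrM natrX exprMn mulrA.
  - rewrite -[X in _ --> X]subr0; apply: cvgB; first exact: cvg_cst.
    by apply: cvg_natmul_expr; lra.
  - exact: cvg_cst.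
apply: (@squeeze_cvgr _ _ _ _ (fun=> 0) (fun n => (expR (-1)) ^+ n)).
- apply: nearW => n; have /andP[-> _] := b01 n => /=.
  have /andP[sn0 sn1] := sn n.
  apply: (@le_trans _ _ (expR (- s ^+ n) ^+ (n * 2 ^ n))).
    rewrite lerXn2r ?nnegrE ?expR_ge0 ?subr_ge0//.
    exact: expR_ge1Dx.
  rewrite -(expRM_natl (n * 2 ^ n) (- s ^+ n)) -(expRM_natl n (-1)) ler_expR.
  rewrite mulrN mulrN1 lerN2.
  rewrite natrM natrX -mulrA -exprMn ler_peMr// exprn_ege1//; lra.
- exact: cvg_cst.
- have e1 : `|expR (-1) : R| < 1 by rewrite ger0_norm ?expR_ge0// expR_lt1 ltrN10.
  have := @cvg_geometric R 1 (expR (-1)) e1.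
  by rewrite /geometric/=; under eq_fun do rewrite mul1r.
Qed.

Lemma measurable_cos : measurable_fun [set: R] (@cos R).
Proof. by apply: continuous_measurable_fun; exact: continuous_cos. Qed.

(** A single sine only detects periodic sets. Stretching the period recovers the half-line, since
    [sin (d / k.+1)] has the sign of [d] as soon as [|d| < pi * k.+1]. *)
Lemma cvg_ltr_sin (d : R) :
  (sin (d / k.+1%:R) < 0)%R%:R @[k --> \oo] --> ((d < 0)%R%:R : R).
Proof.
apply: cvg_near_cst.
have [K _ HK] : \forall k \near \oo, `|d| < pi * (k : nat).+1%:R.
  exists (Num.truncn (`|d| / pi)) => // k /= Kk.
  rewrite mulrC -ltr_pdivrMr ?pi_gt0// (lt_le_trans (truncnS_gt _))//.
  by rewrite ler_nat.
exists K => // k /= Kk; congr (_%:R); congr nat_of_bool.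
have {HK} := HK k Kk.
have k0 : 0 < k.+1%:R :> R by [].
have [d0|d0|->] := ltgtP d 0; last by rewrite mul0r sin0 ltxx.
- rewrite ltr0_norm// => dk.
  rewrite -oppr_gt0 -sinN; apply: sin_gt0_pi.
  by rewrite -mulNr divr_gt0 ?oppr_gt0//= ltr_pdivrMr.
- rewrite gtr0_norm// => dk; apply/negbTE; rewrite -leNgt ltW//.
  by apply: sin_gt0_pi; rewrite divr_gt0//= ltr_pdivrMr.
Qed.

Definition dot n (t : 'I_n -> R) (y : n.-tuple R) : R :=
  \sum_(i < n) t i * tnth y i.

Lemma measurable_dot n (t : 'I_n -> R) : measurable_fun setT (dot t).
Proof.
apply: measurable_sum => i; apply: measurable_funM => //.
exact: measurable_tnth.
Qed.

(** Real trigonometric polynomials. Cosines with a free phase generate them all: sines come from a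
    phase shift and constants from frequency 0. *)
Inductive trig n : (n.-tuple R -> R) -> Prop :=
| trig_cos a t : trig (fun y => cos (a + dot t y))
| trig_add f g : trig f -> trig g -> trig (fun y => f y + g y)
| trig_scale c f : trig f -> trig (fun y => c * f y).

Lemma trig_eq n (f g : n.-tuple R -> R) : f =1 g -> trig f -> trig g.
Proof. by move=> /funext ->. Qed.

(** Product-to-sum formula for two cosines, extended by bilinearity through the two inductions. *)
Lemma trig_mul n (f g : n.-tuple R -> R) : trig f -> trig g ->
  trig (fun y => f y * g y).
Proof.
move=> tf tg; elim: tf => [a t|f1 f2 _ IH1 _ IH2|c f1 _ IH1].
- elim: tg => [b s|g1 g2 _ IH1 _ IH2|c g1 _ IH1].
  + apply: (@trig_eq _ (fun y => 2^-1 * cos (a + b + dot (fun i => t i + s i) y)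
      + 2^-1 * cos (a - b + dot (fun i => t i - s i) y))) => [y|].
      have -> : a + b + dot (fun i => t i + s i) y = (a + dot t y) + (b + dot s y).
        rewrite addrACA; congr (_ + _); rewrite /dot -big_split/=.
        by apply: eq_bigr => i _; rewrite mulrDl.
      have -> : a - b + dot (fun i => t i - s i) y = (a + dot t y) - (b + dot s y).
        rewrite opprD addrACA; congr (_ + _); rewrite /dot -sumrN -big_split/=.
        by apply: eq_bigr => i _; rewrite mulrBl.
      by rewrite cosD cosB; field.
    by apply: trig_add; apply: trig_scale; exact: trig_cos.
  + by apply: (trig_eq _ (trig_add IH1 IH2)) => y; rewrite mulrDr.
  + by apply: (trig_eq _ (trig_scale c IH1)) => y; rewrite mulrCA.
- by apply: (trig_eq _ (trig_add IH1 IH2)) => y; rewrite mulrDl.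
- by apply: (trig_eq _ (trig_scale c IH1)) => y; rewrite mulrA.
Qed.

Lemma trig_cst n (c : R) : trig (fun _ : n.-tuple R => c).
Proof.
apply: (trig_eq _ (trig_scale c (trig_cos 0 (fun=> 0)))) => y.
by rewrite add0r /dot big1 ?cos0 ?mulr1// => i _; rewrite mul0r.
Qed.

Lemma trig_exp n (f : n.-tuple R -> R) k : trig f -> trig (fun y => f y ^+ k).
Proof.
move=> tf; elim: k => [|k IH]; first exact: (trig_eq _ (trig_cst _ 1)).
by apply: (trig_eq _ (trig_mul tf IH)) => y; rewrite exprS.
Qed.

Lemma trig_prod n (I : Type) (s : seq I) (f : I -> n.-tuple R -> R) :
  (forall i, trig (f i)) -> trig (fun y => \prod_(i <- s) f i y).
Proof.
move=> tf; elim: s => [|i s IH].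
  by apply: (trig_eq _ (trig_cst _ 1)) => y; rewrite big_nil.
by apply: (trig_eq _ (trig_mul (tf i) IH)) => y; rewrite big_cons.
Qed.

Lemma trig_sin n (a : R) (t : 'I_n -> R) : trig (fun y => sin (a + dot t y)).
Proof.
apply: (trig_eq _ (trig_cos (a - pi / 2) t)) => y.
by rewrite addrAC cosBpihalf.
Qed.

Definition orthant n (a : 'I_n -> R) : set (n.-tuple R) :=
  [set y | forall i, tnth y i < a i].

Lemma measurable_orthant n (a : 'I_n -> R) : measurable (orthant a).
Proof.
have -> : orthant a = \bigcap_(i in [set: 'I_n])
    ((fun y : n.-tuple R => tnth y i) @^-1` `]-oo, a i[).
  apply/seteqP; split => y /= oy i.
    by move=> _; rewrite /= in_itv/= oy.
  by have := oy i Logic.I; rewrite /= in_itv/=.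
apply: fin_bigcap_measurable => [|i _]; first exact: finite_finset.
rewrite -[X in measurable X]setTI.
by apply: (measurable_tnth i) => //; exact: measurable_itv.
Qed.

Section agree.
Variables (n : nat) (m1 m2 : {measure set (n.-tuple R) -> \bar R}).
Hypotheses (m1T : m1 setT = 1%E) (m2T : m2 setT = 1%E).

Definition agree (f : n.-tuple R -> R) :=
  measurable_fun setT f /\
  (\int[m1]_y (f y)%:E = \int[m2]_y (f y)%:E)%E.

(** Dominated convergence with majorant 1, integrable because both measures have mass 1. *)
Lemma agree_cvg (f_ : nat -> n.-tuple R -> R) (f : n.-tuple R -> R) :
  (forall k, agree (f_ k)) -> (forall k y, 0 <= f_ k y <= 1) ->
  (forall y, f_ k y @[k --> \oo] --> f y) -> agree f.
Proof.
move=> af f01 cf.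
have mf : measurable_fun setT f.
  apply: (@measurable_fun_cvg _ _ _ _ f_) => [k|y _]; last exact: cf.
  exact: (af k).1.
split => //.
have lim (m : {measure set (n.-tuple R) -> \bar R}) : m setT = 1%E ->
    (\int[m]_y (f_ k y)%:E)%E @[k --> \oo] --> (\int[m]_y (f y)%:E)%E.
  move=> mT; apply: (@dominated_cvg _ _ _ m setT _ _ _ (fun=> 1%E)) => //.
  - by move=> k; apply/measurable_EFinP; exact: (af k).1.
  - by move=> y _; apply: cvg_EFin; [exact: nearW|exact: cf].
  - apply: measurable_bounded_integrable => //; first by rewrite mT ltry.
    exact: bounded_cst.
  - by move=> k y _ /=; rewrite lee_fin ger0_norm; have /andP[] := f01 k y.
have := lim _ m1T; under eq_fun do rewrite (af _).2.
move=> /(cvg_lim (@ereal_hausdorff R)) <-.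
by have /(cvg_lim (@ereal_hausdorff R)) -> := lim _ m2T.
Qed.

Hypothesis m12 : forall (t : 'I_n -> R) (A : set R), measurable A ->
  m1 (dot t @^-1` A) = m2 (dot t @^-1` A).

Lemma trig_bounded (f : n.-tuple R -> R) : trig f ->
  measurable_fun setT f /\ exists M, forall y, `|f y| <= M.
Proof.
elim=> [a t|f1 f2 _ [m1f [M1 b1]] _ [m2f [M2 b2]]|c f1 _ [m1f [M1 b1]]].
- split; last by exists 1 => y; exact: cos_max.
  apply: (measurableT_comp measurable_cos).
  by apply: measurable_funD => //; exact: measurable_dot.
- split; first exact: measurable_funD.
  by exists (M1 + M2) => y; rewrite (le_trans (ler_normD _ _))// lerD.
- split; first exact: measurable_funM.
  by exists (`|c| * M1) => y; rewrite normrM ler_wpM2l.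
Qed.

Lemma trig_integrable (m : {measure set (n.-tuple R) -> \bar R}) f :
  m setT = 1%E -> trig f -> m.-integrable setT (EFin \o f).
Proof.
move=> mT /trig_bounded[mf [M bf]].
apply: measurable_bounded_integrable => //; first by rewrite mT ltry.
exists M; split; first by rewrite num_real.
by move=> x Mx y _; exact: le_trans (bf y) (ltW Mx).
Qed.

(** [cos (a + dot t y)] depends on [y] only through [dot t y], so its integral is one against the
    image measure under [dot t], where [m12] applies; sums and multiples follow by linearity. *)
Lemma trig_agree f : trig f -> agree f.
Proof.
move=> tf; split; first exact: (trig_bounded tf).1.
elim: tf => [a t|f1 f2 t1 IH1 t2 IH2|c f1 t1 IH1].
- have mt := measurable_dot t.
  have mc : measurable_fun [set: R] (fun r : R => (cos (a + r))%:E).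
    apply/measurable_EFinP; apply: (measurableT_comp measurable_cos).
    exact: measurable_funD.
  have E (m : {measure set (n.-tuple R) -> \bar R}) : m setT = 1%E ->
      (\int[m]_y (cos (a + dot t y))%:E = 
       \int[pushforward m (dot t)]_r (cos (a + r))%:E)%E.
    move=> mT; rewrite [RHS]integral_pushforward//=.
    exact: (trig_integrable mT (trig_cos a t)).
  rewrite E// E//; apply: eq_measure_integral => A mA _; exact: m12.
- under eq_integral do rewrite EFinD.
  under [RHS]eq_integral do rewrite EFinD.
  by rewrite !integralD ?IH1 ?IH2//; exact: trig_integrable.
- under eq_integral do rewrite EFinM.
  under [RHS]eq_integral do rewrite EFinM.
  by rewrite !integralZl ?IH1//; exact: trig_integrable.
Qed.

Let unit_e (i : 'I_n) (c : R) (j : 'I_n) : R := if j == i then c else 0.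

Let dot_unit i c (y : n.-tuple R) : dot (unit_e i c) y = c * tnth y i.
Proof.
rewrite /dot (bigD1 i)//= /unit_e eqxx big1 ?addr0// => j /negbTE ->.
by rewrite mul0r.
Qed.

(** Two successive limits: for fixed [k], powers of smoothed signs converge to the indicator of the
    periodic set where all the sines are negative; then the period grows with [k] and only the
    orthant remains. *)
Lemma agree_orthant (a : 'I_n -> R) : m1 (orthant a) = m2 (orthant a).
Proof.
have prod01 (I : Type) (s : seq I) (F : I -> R) :
    (forall i, 0 <= F i <= 1) -> 0 <= \prod_(i <- s) F i <= 1.
  by move=> F01; rewrite prodr_ge0 ?prodr_ile1// => i _; have /andP[] := F01 i.
have cvg_prod (F : nat -> 'I_n -> R) (G : 'I_n -> R) :
    (forall i, F k i @[k --> \oo] --> G i) ->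
    \prod_(i < n) F k i @[k --> \oo] --> \prod_(i < n) G i.
  move=> FG; elim: (index_enum _) => [|i s IH].
    by under eq_fun do rewrite big_nil; rewrite big_nil; exact: cvg_cst.
  by under eq_fun do rewrite big_cons; rewrite big_cons; exact: cvgM.
(* Rescaled to [[0, 1]], the sine is negative exactly when [s < 1/2], the threshold in
   [cvg_onem_expr]. *)
pose s k i (y : n.-tuple R) := (1 + sin ((tnth y i - a i) / k.+1%:R)) / 2.
have s01 k i y : 0 <= s k i y <= 1.
  have := sin_max ((tnth y i - a i) / k.+1%:R).
  by rewrite ler_norml /s => /andP[? ?]; apply/andP; split; lra.
have agS k : agree (fun y =>
    \prod_(i < n) (sin ((tnth y i - a i) / k.+1%:R) < 0)%R%:R).
  apply: (@agree_cvg (fun N y =>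
    \prod_(i < n) (1 - s k i y ^+ N) ^+ (N * 2 ^ N))).
  - move=> N; apply/trig_agree/trig_prod => i; apply/trig_exp.
    apply: (trig_eq _ (trig_add (trig_cst _ 1) (trig_scale (-1) (trig_exp N
      (trig_scale 2^-1 (trig_add (trig_cst _ 1)
        (trig_sin (- a i / k.+1%:R) (unit_e i (k.+1%:R^-1))))))))) => y.
    rewrite mulN1r /s dot_unit; congr (1 - _ ^+ N).
    by rewrite mulrC; congr ((1 + sin _) * _); ring.
  - move=> N y; apply: prod01 => i; have /andP[? ?] := s01 k i y.
    rewrite exprn_ge0 ?exprn_ile1 ?subr_ge0 ?exprn_ile1//.
    by rewrite lerBlDr lerDl exprn_ge0.
  - move=> y; apply: (cvg_prod (fun N i => (1 - s k i y ^+ N) ^+ (N * 2 ^ N))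
      (fun i => (sin ((tnth y i - a i) / k.+1%:R) < 0)%R%:R)) => i.
    have -> : (sin ((tnth y i - a i) / k.+1%:R) < 0) = (s k i y < 2^-1).
      by rewrite /s; apply/idP/idP => ?; lra.
    exact: cvg_onem_expr.
have [mI] : agree (fun y => \prod_(i < n) (tnth y i - a i < 0)%R%:R).
  apply: (agree_cvg agS) => [k y|y].
    by apply: prod01 => i; case: ltP; rewrite ?lexx ler01.
  apply: (cvg_prod (fun k i => (sin ((tnth y i - a i) / k.+1%:R) < 0)%R%:R)
    (fun i => (tnth y i - a i < 0)%R%:R)) => i.
  exact: cvg_ltr_sin.
have E (y : n.-tuple R) :
    \prod_(i < n) (tnth y i - a i < 0)%R%:R = \1_(orthant a) y :> R.
  rewrite indicE; have [/set_mem oy|noy] := boolP (y \in orthant a).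
    by rewrite big1// => i _; rewrite subr_lt0 oy.
  apply/eqP; rewrite prodf_seq_eq0; apply/hasP.
  have : ~ (forall i, tnth y i < a i) by move=> H; move/negP: noy; apply; rewrite inE.
  move=> /existsNP[i /negP]; rewrite -leNgt => yi.
  by exists i; rewrite ?mem_index_enum//= subr_lt0 ltNge yi.
under eq_integral do rewrite E; under [RHS]eq_integral do rewrite E.
have mo := measurable_orthant a.
by rewrite !integral_indic// !setIT.
Qed.

End agree.

(** Orthants are stable under intersection, exhaust the space and generate its sigma-algebra, so
    [agree_orthant] determines the measures. *)
Theorem cramer_wold n (m1 m2 : {measure set (n.-tuple R) -> \bar R}) :
  m1 setT = 1%E -> m2 setT = 1%E ->
  (forall (t : 'I_n -> R) (A : set R), measurable A ->
     m1 (dot t @^-1` A) = m2 (dot t @^-1` A)) ->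
  forall A, measurable A -> m1 A = m2 A.
Proof.
move=> m1T m2T m12.
pose G : set (set (n.-tuple R)) := [set orthant a | a in setT].
(* Used to write a half-space in one coordinate as a countable union of orthants, the other
   coordinates being bounded by [k]. *)
have GoT (g : set (n.-tuple R)) : g = \bigcup_k (g `&` orthant (fun=> k%:R)).
  rewrite -setI_bigcupr; apply/esym/setIidPl => y _.
  pose M := \sum_(i < n) `|tnth y i|.
  exists (Num.truncn M).+1 => // i.
  rewrite (@le_lt_trans _ _ M) ?truncnS_gt//.
  rewrite (le_trans (ler_norm _))// /M (bigD1 i)//= lerDl.
  by apply: sumr_ge0.
have mo := @measurable_orthant n.
have mG : @measurable _ (n.-tuple R) = <<s G >>.
  apply/seteqP; split; last first.
    by apply: smallest_sub => [|_ [a _ <-]]; [exact: sigma_algebra_measurable|].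
  apply: smallest_sub; first exact: smallest_sigma_algebra.
  rewrite -bigcup_seq => B [i _] [A mA <-]; rewrite setTI => {B}.
  pose S := g_sigma_algebraType G.
  have mi : measurable_fun [set: S] (fun y : S => tnth (y : n.-tuple R) i).
    apply: (measurability _ (RGenInftyO.measurableE R)) => //.
    move=> _ [_ [c ->] <-]; rewrite setTI (GoT (_ @^-1` _)).
    apply: bigcupT_measurable => k; apply: sub_sigma_algebra.
    exists (fun j => if j == i then Num.min c k%:R else k%:R) => //.
    apply/seteqP; split => y /=.
      move=> oy; split => [|j].
        by have := oy i; rewrite eqxx in_itv/= lt_min => /andP[].
      by have := oy j; case: ifP => // _; rewrite lt_min => /andP[].
    by rewrite in_itv/= => -[yc yk] j; case: ifP => // /eqP ->; rewrite lt_min yc yk.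
  by rewrite -[X in <<s _ >> X]setTI; exact: (mi measurableT).
apply: (measure_unique G (fun k => orthant (fun=> k%:R))) => //.
- move=> _ _ [a _ <-] [b _ <-]; exists (fun i => Num.min (a i) (b i)) => //.
  apply/seteqP; split => y /= h.
    by split=> i; have := h i; rewrite lt_min => /andP[].
  by move=> i; rewrite lt_min h.1 h.2.
- by move=> k; exists (fun=> k%:R).
- by rewrite [RHS]GoT; apply: eq_bigcup => // k _; rewrite setTI.
- by move=> _ [a _ <-]; exact: agree_orthant.
- move=> k; apply: (@le_lt_trans _ _ (m1 setT)); last by rewrite m1T ltry.
  by apply: le_measure; rewrite ?inE.
Qed.

End cramer_wold.

(** * Gaussian densities *)

Section gauss1.
Context {R : realType}.
Local Notation leb := (@lebesgue_measure R).

(** Indexed by the variance, since variances are what adds up in convolutions and in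
    [schur_qform]. *)
Definition gpdf (v x : R) : R :=
  (Num.sqrt (pi *+ 2 * v))^-1 * expR (- x ^+ 2 / (v *+ 2)).

Lemma gpdf_ge0 v x : 0 <= gpdf v x.
Proof. by rewrite mulr_ge0 ?expR_ge0// invr_ge0 sqrtr_ge0. Qed.

Lemma measurable_gpdf v : measurable_fun [set: R] (gpdf v).
Proof.
apply: measurable_funM => //; apply: measurableT_comp => //.
by apply: measurable_funM => //; exact: measurableT_comp.
Qed.

Lemma normal_pdf_gpdf (m s x : R) : 0 < s -> normal_pdf m s x = gpdf (s ^+ 2) (x - m).
Proof.
move=> s0; rewrite normal_pdfE ?gt_eqF// /normal_peak /normal_fun /gpdf.
by congr ((Num.sqrt _)^-1 * _); ring.
Qed.

Lemma integral_gpdf v : 0 < v -> (\int[leb]_x (gpdf v x)%:E = 1)%E.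
Proof.
move=> v0; rewrite -(integral_normal_pdf 0 (Num.sqrt v)).
apply: eq_integral => x _; rewrite normal_pdf_gpdf ?sqrtr_gt0//.
by rewrite sqr_sqrtr ?ltW// subr0.
Qed.

Lemma gpdf_scale (c v x : R) : 0 < c -> 0 < v ->
  gpdf v x = c * gpdf (c ^+ 2 * v) (c * x).
Proof.
move=> c0 v0; rewrite /gpdf [RHS]mulrA; congr (_ * expR _); last first.
  by field; rewrite !gt_eqF.
rewrite (mulrCA (pi *+ 2)) (sqrtrM _ (sqr_ge0 c)) sqrtr_sqr gtr0_norm// invfM mulrA.
by rewrite divff ?mul1r// gt_eqF.
Qed.

(** Completing the square in [x]: for independent centred variables of variances [u] and [v] with
    sum [z], the joint density is the density of [z] times the conditional density of the first
    variable given [z]. *)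
Lemma gpdf_mul (u v x z : R) : 0 < u -> 0 < v ->
  gpdf v (z - x) * gpdf u x =
  gpdf (u + v) z * gpdf (u * v / (u + v)) (x - z * u / (u + v)).
Proof.
move=> u0 v0; have uv0 : 0 < u + v by rewrite addr_gt0.
have p0 : 0 <= pi *+ 2 :> R by rewrite mulrn_wge0// pi_ge0.
rewrite /gpdf mulrACA [RHS]mulrACA -!expRD -!invfM -!sqrtrM ?mulr_ge0// ?ltW//.
congr (_^-1 * expR _).
  by congr Num.sqrt; field; rewrite gt_eqF.
by field; rewrite !gt_eqF.
Qed.

Local Open Scope ereal_scope.

(* [gmean v f m] is the expectation of [f] under N(m, v), the point mass at
   [m] when [v = 0]. *)
Definition gmean (v : R) (f : R -> \bar R) (m : R) : \bar R :=
  if v == 0%R then f m else \int[leb]_z (f (m + z)%R * (gpdf v z)%:E).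

Lemma gmean0 f : gmean 0 f = f.
Proof. by apply/funext => x; rewrite /gmean eqxx. Qed.

Lemma gmeanE (v : R) (f : R -> \bar R) (m : R) : (0 < v)%R ->
  gmean v f m = \int[leb]_z (f (m + z)%R * (gpdf v z)%:E).
Proof. by move=> v0; rewrite /gmean; case: eqP v0 => // ->; rewrite ltxx. Qed.

Lemma gmean_ge0 (v : R) (f : R -> \bar R) (m : R) : (forall x, 0 <= f x) -> 0 <= gmean v f m.
Proof.
move=> f0; rewrite /gmean; case: ifP => // _.
by apply: integral_ge0 => z _; rewrite mule_ge0// lee_fin gpdf_ge0.
Qed.

Lemma measurable_gmean (v : R) (f : R -> \bar R) :
  measurable_fun [set: R] f -> (forall x, 0 <= f x) ->
  measurable_fun [set: R] (gmean v f).
Proof.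
move=> mf f0; have [->|vn0] := eqVneq v 0%R; first by rewrite gmean0.
rewrite (_ : gmean v f = fun m => \int[leb]_z (f (m + z)%R * (gpdf v z)%:E));
  last by apply/funext => m; rewrite /gmean (negbTE vn0).
pose F (p : R * R) := f (p.1 + p.2)%R * (gpdf v p.2)%:E.
apply: (@measurable_fun_fubini_tonelli_F _ _ _ (measurableTypeR R) R leb F).
  apply: emeasurable_funM.
    by apply: measurableT_comp => //; exact: measurable_funD.
  by apply/measurable_EFinP; apply: measurableT_comp => //; exact: measurable_gpdf.
by move=> p; rewrite /F mule_ge0// lee_fin gpdf_ge0.
Qed.

Lemma gmean_cst v : (0 <= v)%R -> forall m, gmean v (fun=> 1) m = 1.
Proof.
move=> v0 m; rewrite /gmean; case: ifPn => // vn0.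
under eq_integral do rewrite mul1e.
by rewrite integral_gpdf// lt_neqAle eq_sym vn0.
Qed.

(** Convolution of normal laws: after a translation and Tonelli, [gpdf_mul] confines [x] to a single
    normal density, which integrates to 1. *)
Lemma gmeanD (u v : R) (f : R -> \bar R) (m : R) : (0 <= u)%R -> (0 <= v)%R ->
  measurable_fun [set: R] f -> (forall x, 0 <= f x) ->
  gmean u (gmean v f) m = gmean (u + v) f m.
Proof.
move=> u0 v0 mf f0.
have [->|un0] := eqVneq u 0%R; first by rewrite gmean0 add0r.
have [->|vn0] := eqVneq v 0%R.
  by rewrite addr0 gmean0.
have {un0}u0 : (0 < u)%R by rewrite lt_neqAle eq_sym un0.
have {vn0}v0 : (0 < v)%R by rewrite lt_neqAle eq_sym vn0.
have uv0 : (0 < u + v)%R by rewrite addr_gt0.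
rewrite (gmeanE f m uv0) (gmeanE (gmean v f) m u0).
under eq_integral => x _ do rewrite (gmeanE f (m + x)%R v0).
transitivity (\int[leb]_x \int[leb]_z
    (f (m + z)%R * (gpdf v (z - x) * gpdf u x)%:E)).
  apply: eq_integral => x _; rewrite -ge0_integralZr//=; last 3 first.
  - apply: emeasurable_funM.
      by apply: measurableT_comp => //; exact: measurable_funD.
    by apply/measurable_EFinP; exact: measurable_gpdf.
  - by move=> z _; rewrite mule_ge0// lee_fin gpdf_ge0.
  - by rewrite lee_fin gpdf_ge0.
  rewrite -(ge0_integral_shift (- x)%R) /=.
  - apply: eq_integral => z _; rewrite -muleA -EFinM; congr (f _ * _).
    by rewrite addrACA subrr addr0.
  - apply: emeasurable_funM => //; apply: emeasurable_funM.
      by apply: measurableT_comp => //; exact: measurable_funD.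
    by apply/measurable_EFinP; exact: measurable_gpdf.
  - by move=> z; rewrite !mule_ge0// lee_fin gpdf_ge0.
pose F (p : R * R) := f (m + p.2)%R * (gpdf v (p.2 - p.1) * gpdf u p.1)%:E.
rewrite (@fubini_tonelli _ _ (measurableTypeR R) (measurableTypeR R) R leb leb F).
- apply: eq_integral => z _; rewrite /F/=.
  under eq_integral => x _ do rewrite gpdf_mul// EFinM muleA.
  rewrite ge0_integralZl//=; last 3 first.
  + apply/measurable_EFinP; apply: measurableT_comp; first exact: measurable_gpdf.
    exact: measurable_funB.
  + by move=> x _; rewrite lee_fin gpdf_ge0.
  + by rewrite mule_ge0// lee_fin gpdf_ge0.
  rewrite (_ : \int[_]_x _ = 1) ?mule1//.
  rewrite -(@integral_gpdf (u * v / (u + v))%R); last by rewrite divr_gt0// mulr_gt0.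
  rewrite -[RHS](ge0_integral_shift (- (z * u / (u + v)))%R)//.
    by apply/measurable_EFinP; exact: measurable_gpdf.
  by move=> x; rewrite lee_fin gpdf_ge0.
- apply: emeasurable_funM.
    by apply: measurableT_comp => //; exact: measurable_funD.
  apply/measurable_EFinP; apply: measurable_funM.
    apply: measurableT_comp; first exact: measurable_gpdf.
    exact: measurable_funB.
  by apply: measurableT_comp => //; exact: measurable_gpdf.
- by move=> p; rewrite /F mule_ge0// lee_fin mulr_ge0// gpdf_ge0.
Qed.

(** Change of scale; negative [c] reduces to positive [c] by symmetry of the density, and [c = 0]
    meets the point-mass convention of [gmean]. *)
Lemma gmean_lin (c v : R) (f : R -> \bar R) (a : R) : (0 < v)%R ->
  measurable_fun [set: R] f -> (forall x, 0 <= f x) ->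
  \int[leb]_x (f (a + c * x)%R * (gpdf v x)%:E) = gmean (c ^+ 2 * v) f a.
Proof.
move=> v0 mf f0.
have pos b : (0 < b)%R ->
    \int[leb]_x (f (a + b * x)%R * (gpdf v x)%:E) = gmean (b ^+ 2 * v) f a.
  move=> b0; have b2v : (0 < b ^+ 2 * v)%R by rewrite mulr_gt0 ?exprn_gt0.
  rewrite (gmeanE f a b2v).
  have mF : measurable_fun [set: R]
      (fun x => f (a + x)%R * (gpdf (b ^+ 2 * v) x)%:E).
    apply: emeasurable_funM.
      by apply: measurableT_comp => //; exact: measurable_funD.
    by apply/measurable_EFinP; exact: measurable_gpdf.
  have F0 x : 0 <= f (a + x)%R * (gpdf (b ^+ 2 * v) x)%:E.
    by rewrite mule_ge0// lee_fin gpdf_ge0.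
  rewrite -(ge0_integral_scale b0 mF F0) -ge0_integralZl//; last 2 first.
  - apply: (measurableT_comp mF (_ : measurable_fun [set: R] (fun x : R => b * x)%R)).
    exact: measurable_funM.
  - by rewrite lee_fin ltW.
  apply: eq_integral => x _; rewrite muleCA -EFinM.
  by rewrite -gpdf_scale.
have [c0|c0|->] := ltgtP c 0%R; [|exact: pos|].
- have mF : measurable_fun [set: R] (fun x => f (a + c * x)%R * (gpdf v x)%:E).
    apply: emeasurable_funM; last by apply/measurable_EFinP; exact: measurable_gpdf.
    apply: (measurableT_comp mf).
    by apply: measurable_funD => //; exact: measurable_funM.
  rewrite -ge0_integral_opp//; last first.
    by move=> x; rewrite mule_ge0// lee_fin gpdf_ge0.
  have nc0 : (0 < - c)%R by rewrite oppr_gt0.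
  have := pos _ nc0; rewrite sqrrN => <-.
  by apply: eq_integral => x _; rewrite mulrN mulNr /gpdf sqrrN.
- rewrite /gmean expr0n mul0r eqxx.
  under eq_integral do rewrite mul0r addr0.
  rewrite ge0_integralZl// ?integral_gpdf ?mule1//.
    by apply/measurable_EFinP; exact: measurable_gpdf.
  by move=> x _; rewrite lee_fin gpdf_ge0.
Qed.

End gauss1.

(** * Schur complements of positive definite matrices *)

Section schur.
Context {R : realType}.

Definition posdef n (B : 'M[R]_n) : Prop :=
  B^T = B /\ forall t : 'rV[R]_n, t != 0 -> 0 < qform B t t.

Lemma qform_sym n (B : 'M[R]_n) (u v : 'rV[R]_n) : B^T = B -> qform B u v = qform B v u.
Proof.
move=> sB; rewrite /qform -[in LHS](trmxK (u *m B *m v^T)) mxE.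
by rewrite !trmx_mul trmxK sB mulmxA.
Qed.

Section step.
Variables (n : nat) (B : 'M[R]_(1 + n)).
Hypothesis pB : posdef B.

(** For a Gaussian vector with covariance [B], these three are the covariance of the coordinates
    after the first, the regression coefficients of the first coordinate on them, and its residual
    variance. The size [1 + n] makes the block operations applicable. *)
Definition schur_rest : 'M[R]_n := drsubmx B.
Definition schur_reg : 'rV[R]_n := ursubmx B *m invmx schur_rest.
Definition schur_var : R := (ulsubmx B - schur_reg *m schur_rest *m schur_reg^T) 0 0.

Lemma posdef_rest : posdef schur_rest.
Proof.
have [sB pos] := pB; split; first by rewrite /schur_rest trmx_drsub sB.
move=> t t0; have := pos (row_mx 0 t).
rewrite /qform -[B in row_mx _ _ *m B]submxK mul_row_block tr_row_mx mul_row_col.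
rewrite !mul0mx trmx0 mulmx0 !add0r; apply.
by apply: contra t0 => /eqP; rewrite -row_mx0 => /eq_row_mx[_ ->].
Qed.

Hypothesis uB' : schur_rest \in unitmx.

Let U : 'M[R]_(1 + n) := block_mx 1%:M schur_reg 0 1%:M.
Let D : 'M[R]_(1 + n) := block_mx schur_var%:M 0 0 schur_rest.
Let V : 'M[R]_(1 + n) := block_mx 1%:M (- schur_reg) 0 1%:M.

Let UV : U *m V = 1%:M.
Proof.
rewrite mulmx_block !mul0mx !mulmx0 !mul1mx !mulmx1 !addr0 !add0r addNr.
by rewrite -scalar_mx_block.
Qed.

(** Block elimination of the first coordinate. With [U] unipotent, the quadratic form, the
    determinant and the inverse of [B] are all read off the block-diagonal [D]. *)
Lemma schur_decomp : B = U *m D *m U^T.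
Proof.
have [sB _] := pB.
have [sB' _] := posdef_rest.
have rB : schur_reg *m schur_rest = ursubmx B by rewrite /schur_reg mulmxKV.
rewrite !(mulmx_block, tr_block_mx) !trmx1 !trmx0.
rewrite !mul0mx !mulmx0 !mul1mx !mulmx1 !addr0 !add0r.
rewrite -[LHS]submxK; congr block_mx.
- have -> : schur_var%:M = ulsubmx B - schur_reg *m schur_rest *m schur_reg^T.
    by rewrite [RHS]mx11_scalar.
  by rewrite subrK.
- by rewrite rB.
- by rewrite -[in LHS]sB -trmx_ursub -rB trmx_mul sB'.
Qed.

Lemma schur_qform (t : 'rV[R]_(1 + n)) :
  qform B t t = (lsubmx t 0 0) ^+ 2 * schur_var +
    qform schur_rest (rsubmx t + lsubmx t *m schur_reg) (rsubmx t + lsubmx t *m schur_reg).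
Proof.
have tU : t *m U = row_mx (lsubmx t) (rsubmx t + lsubmx t *m schur_reg).
  rewrite -[t in LHS]hsubmxK mul_row_block !mulmx1 mulmx0 addr0.
  by rewrite addrC.
rewrite /qform {1}schur_decomp !mulmxA tU -(mulmxA _ U^T t^T) -trmx_mul tU.
rewrite mul_row_block !mulmx0 addr0 add0r tr_row_mx mul_row_col [LHS]mxE; congr (_ + _);
  last by rewrite /schur_reg !mulmxA.
by rewrite mxE big_ord1 mul_mx_scalar !mxE; ring.
Qed.

(** The vector [(1, - schur_reg)] annihilates the second term of [schur_qform], so the form takes
    the value [schur_var] there. *)
Lemma schur_var_gt0 : 0 < schur_var.
Proof.
have [_ pos] := pB; pose t : 'rV[R]_(1 + n) := row_mx 1%:M (- schur_reg).
have := pos t; rewrite schur_qform row_mxKl row_mxKr mul1mx addNr.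
rewrite /qform mul0mx mul0mx !mxE /= expr1n mul1r addr0; apply.
apply/eqP => /(congr1 lsubmx); rewrite row_mxKl => /matrixP/(_ 0 0).
by rewrite !mxE/= => /eqP; rewrite oner_eq0.
Qed.

Lemma schur_det : \det B = schur_var * \det schur_rest.
Proof.
rewrite {1}schur_decomp !det_mulmx det_tr det_ublock !det1 !mulr1 !mul1r.
by rewrite det_ublock det_scalar1.
Qed.

(** Obtained by inverting [U], [D] and [U^T]. The two terms are the exponents of the conditional
    density of the first coordinate and of the marginal density of the others. *)
Lemma schur_inv (y : 'rV[R]_(1 + n)) :
  qform (invmx B) y y =
  (lsubmx y 0 0 - (schur_reg *m (rsubmx y)^T) 0 0) ^+ 2 / schur_var +
  qform (invmx schur_rest) (rsubmx y) (rsubmx y).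
Proof.
have v0 := schur_var_gt0.
pose E : 'M[R]_(1 + n) := block_mx (schur_var^-1)%:M 0 0 (invmx schur_rest).
have DE : D *m E = 1%:M.
  rewrite mulmx_block !mul0mx !mulmx0 !addr0 !add0r mulmxV//.
  by rewrite -scalar_mxM divff ?gt_eqF// -scalar_mx_block.
have BI : B *m (V^T *m E *m V) = 1%:M.
  rewrite {1}schur_decomp !mulmxA -(mulmxA _ U^T V^T) -trmx_mul.
  have VU : V *m U = 1%:M by apply: mulmx1C.
  rewrite VU trmx1 mulmx1 -[U *m D *m E]mulmxA DE mulmx1 UV//.
have -> : invmx B = V^T *m E *m V.
  have [uB _] := mulmx1_unit BI.
  by rewrite -[RHS](mulKmx uB) BI mulmx1.
have yV : y *m V^T = row_mx (lsubmx y - rsubmx y *m schur_reg^T) (rsubmx y).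
  rewrite -[y in LHS]hsubmxK tr_block_mx !trmx1 trmx0 mul_row_block !mulmx1.
  by rewrite mulmx0 add0r linearN /= mulmxN.
set z := lsubmx y - _ in yV.
transitivity ((row_mx z (rsubmx y) *m E *m (row_mx z (rsubmx y))^T) 0 0).
  by rewrite -yV trmx_mul trmxK /qform !mulmxA.
rewrite /qform mul_row_block !mulmx0 addr0 add0r tr_row_mx mul_row_col [LHS]mxE.
congr (_ + _).
rewrite mxE big_ord1 mul_mx_scalar.
have -> : z = 
   (lsubmx y 0 0 - (schur_reg *m (rsubmx y)^T) 0 0)%:M.
  have tr00 (a b : 'rV[R]_n) : (a *m b^T) 0 0 = (b *m a^T) 0 0.
    by rewrite -[a *m b^T]trmxK trmx_mul trmxK mxE.
  by rewrite [LHS]mx11_scalar; congr (_%:M); rewrite /z mxE [X in _ + X]mxE tr00.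
by set x := (_ - _); rewrite !mxE /= mulr1n; ring.
Qed.

End step.

Lemma posdef_det_gt0 n (B : 'M[R]_n) : posdef B -> 0 < \det B.
Proof.
elim: n B => [|n IH] B pB; first by rewrite det_mx00.
have pB' := @posdef_rest n B pB.
have d' := IH _ pB'.
have u' : @schur_rest n B \in unitmx.
  by rewrite unitmxE unitfE gt_eqF.
by rewrite (@schur_det n B pB u') mulr_gt0// (schur_var_gt0 pB u').
Qed.

Lemma posdef_unit n (B : 'M[R]_n) : posdef B -> B \in unitmx.
Proof. by move=> /posdef_det_gt0 d0; rewrite unitmxE unitfE gt_eqF. Qed.

End schur.

(** * The Gaussian density on tuples and its linear images *)

Section gauss_density.
Context {R : realType}.
Local Notation leb := (@lebesgue_measure R).

Lemma qformE n (B : 'M[R]_n) (u v : 'rV[R]_n) :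
  qform B u v = \sum_i \sum_j u 0 i * B i j * v 0 j.
Proof.
rewrite /qform mxE exchange_big/=; apply: eq_bigr => j _.
by rewrite !mxE mulr_suml.
Qed.

Definition trow n (y : n.-tuple R) : 'rV[R]_n := \row_i tnth y i.

Lemma measurable_qform n (B : 'M[R]_n) :
  measurable_fun setT (fun y : n.-tuple R => qform B (trow y) (trow y)).
Proof.
under eq_fun do rewrite qformE.
apply: measurable_sum => i; apply: measurable_sum => j.
under eq_fun do rewrite !mxE.
apply: measurable_funM; last exact: measurable_tnth.
by apply: measurable_funM => //; exact: measurable_tnth.
Qed.

Definition gdens n (B : 'M[R]_n) (y : n.-tuple R) : R :=
  (Num.sqrt (pi *+ 2)) ^- n * (Num.sqrt (\det B))^-1 *
  expR (- 2^-1 * qform (invmx B) (trow y) (trow y)).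

Lemma gdens_ge0 n (B : 'M[R]_n) y : 0 <= gdens B y.
Proof. by rewrite !mulr_ge0 ?expR_ge0 ?invr_ge0 ?exprn_ge0 ?sqrtr_ge0. Qed.

Lemma measurable_gdens n (B : 'M[R]_n) : measurable_fun setT (gdens B).
Proof.
apply: measurable_funM => //; apply: measurableT_comp => //.
by apply: measurable_funM => //; exact: measurable_qform.
Qed.

Lemma lsubmx_row n (t : 'I_n.+1 -> R) :
  lsubmx ((\row_i t i) : 'rV_(1 + n)) 0 0 = t ord0.
Proof. by rewrite !mxE; congr t; apply/val_inj. Qed.

Lemma rsubmx_row n (t : 'I_n.+1 -> R) :
  rsubmx ((\row_i t i) : 'rV_(1 + n)) = \row_i t (lift ord0 i).
Proof. by apply/rowP => i; rewrite !mxE; congr t; apply/val_inj. Qed.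

(** Conditional density times marginal density: [schur_inv] splits the exponent and [schur_det] the
    normalization. *)
Lemma gdensS n (B : 'M[R]_(1 + n)) x (y : n.-tuple R) : posdef B ->
  @gdens n.+1 B [tuple of x :: y] =
  gpdf (schur_var B) (x - dot (fun i => schur_reg B 0 i) y) * gdens (schur_rest B) y.
Proof.
move=> pB; have pB' := posdef_rest pB; have uB' := posdef_unit pB'.
have v0 := schur_var_gt0 pB uB'; have d0 := posdef_det_gt0 pB'.
have p0 : 0 <= pi *+ 2 :> R by rewrite mulrn_wge0// pi_ge0.
rewrite /gdens (schur_inv pB uB') (schur_det pB uB').
have -> : lsubmx (trow [tuple of x :: y] : 'rV_(1 + n)) 0 0 = x.
  by rewrite /trow lsubmx_row tnth0.
have -> : rsubmx (trow [tuple of x :: y] : 'rV_(1 + n)) = trow y.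
  by rewrite /trow rsubmx_row; apply/rowP => i; rewrite !mxE tnthS.
have -> : (schur_reg B *m (trow y)^T) 0 0 = dot (fun i => schur_reg B 0 i) y.
  by rewrite mxE; apply: eq_bigr => i _; rewrite !mxE.
set z := x - _; rewrite /gpdf mulrACA -expRD; congr (_ * expR _); last first.
  by field; rewrite gt_eqF.
rewrite !sqrtrM ?(ltW v0)// exprS !invfM; ring.
Qed.

Local Open Scope ereal_scope.

(** Induction on the dimension. Integrating out the first coordinate by [gdensS] and [gmean_lin]
    gives a [gmean] of variance [t_0 ^+ 2 * schur_var]; the other coordinates give the second term
    of [schur_qform], and [gmeanD] adds the two. The point-mass case of [gmean] covers vanishing
    coefficients. *)
Theorem integral_gdens n (B : 'M[R]_n) (t : 'I_n -> R) (f : R -> \bar R) (a : R) :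
  posdef B -> measurable_fun [set: R] f -> (forall x, 0 <= f x) ->
  \int[lebn n]_y (f (a + dot t y)%R * (gdens B y)%:E) =
  gmean (qform B (\row_i t i) (\row_i t i)) f a.
Proof.
have mfd m (C : 'M[R]_m) (g : R -> \bar R) b s : measurable_fun [set: R] g ->
    measurable_fun setT (fun y => g (b + dot s y)%R * (gdens C y)%:E).
  move=> mg; apply: emeasurable_funM.
    apply: (measurableT_comp mg); apply: measurable_funD => //.
    exact: measurable_dot.
  by apply/measurable_EFinP; exact: measurable_gdens.
have fd0 m (C : 'M[R]_m) (g : R -> \bar R) b s y : (forall x, 0 <= g x) ->
    0 <= g (b + dot s y)%R * (gdens C y)%:E.
  by move=> g0; rewrite mule_ge0// lee_fin gdens_ge0.
elim: n B t f a => [|n IH] B t f a pB mf f0.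
  rewrite integral_lebn0; last exact: mfd.
  rewrite /gdens !qformE !big_ord0 mulr0 expR0 det_mx00 sqrtr1 expr0 invr1.
  by rewrite !mulr1 mule1 gmean0 /dot big_ord0 addr0.
have pB' := @posdef_rest _ n B pB; have uB' := posdef_unit pB'.
have v0 := schur_var_gt0 pB uB'.
rewrite (schur_qform pB uB') lsubmx_row rsubmx_row.
set v := schur_var _; set B' := schur_rest _; set l := schur_reg _ in v *.
(* Coefficients of the remaining coordinates once the first one is recentred at its regression on
   them. *)
pose t' := fun i : 'I_n => (t (lift ord0 i) + t ord0 * l 0 i)%R.
have -> : (\row_i t (lift ord0 i) + lsubmx ((\row_i t i) : 'rV_(1 + n)) *m l)%R =
    \row_i t' i.
  apply/rowP => i; rewrite mxE [X in (X + _)%R]mxE [RHS]mxE; congr (_ + _)%R.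
  by rewrite mxE big_ord1 lsubmx_row.
rewrite integral_lebnS_swap; [|exact: mfd|by move=> y; exact: fd0].
rewrite addrC -gmeanD//; last 2 first.
- have [_ pos] := pB'; have [->|/pos/ltW//] := eqVneq (\row_i t' i) 0%R.
  by rewrite /qform mul0mx mul0mx mxE.
- by rewrite mulr_ge0 ?sqr_ge0// ltW.
rewrite -IH//; last 2 first.
- exact: measurable_gmean.
- by move=> x; exact: gmean_ge0.
apply: eq_integral => y _.
have dotE x : (a + dot t [tuple of (x + dot (fun i => l 0 i) y)%R :: y] =
    (a + dot t' y) + t ord0 * x)%R.
  rewrite {1}/dot big_ord_recl tnth0 -!addrA; congr (_ + _)%R.
  rewrite mulrDr addrAC -addrA addrC; congr (_ + _)%R.
  rewrite /dot mulr_sumr -big_split/=; apply: eq_bigr => i _.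
  by rewrite tnthS /t'; ring.
have mlin (b c : R) : measurable_fun [set: R] (fun x : R => b + c * x)%R.
  by apply: measurable_funD => //; exact: measurable_funM.
rewrite -(gmean_lin (t ord0) (a + dot t' y)%R v0 mf f0).
under [LHS]eq_integral => x _ do rewrite (gdensS x y pB) -/v -/B' -/l EFinM muleA.
have mG : measurable_fun [set: R]
    (fun x => f (a + dot t' y + t ord0 * x)%R * (gpdf v x)%:E).
  apply: emeasurable_funM; first exact: (measurableT_comp mf (mlin _ _)).
  by apply/measurable_EFinP; exact: measurable_gpdf.
have G0 x : 0 <= f (a + dot t' y + t ord0 * x)%R * (gpdf v x)%:E.
  by rewrite mule_ge0// lee_fin gpdf_ge0.
have d0 : 0 <= (gdens B' y)%:E by rewrite lee_fin gdens_ge0.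
apply: etrans; last exact: (ge0_integralZr leb measurableT mG (fun x _ => G0 x) d0).
rewrite -(ge0_integral_shift (dot (fun i => l 0 i) y)%R).
- by apply: eq_integral => x _; rewrite dotE addrK.
- apply: emeasurable_funM; last exact: measurable_cst.
  apply: emeasurable_funM; last first.
    apply/measurable_EFinP; apply: (measurableT_comp (measurable_gpdf v)).
    exact: measurable_funB.
  have -> : (fun x => f (a + dot t [tuple of x :: y])%R) =
      (fun x => f (a + dot (fun i => t (lift ord0 i)) y + t ord0 * x)%R).
    apply/funext => x; congr f; rewrite -addrA; congr (_ + _)%R.
    rewrite {1}/dot big_ord_recl tnth0 addrC; congr (_ + _)%R.
    by apply: eq_bigr => i _; rewrite tnthS.
  exact: (measurableT_comp mf (mlin _ _)).
- by move=> x; rewrite !mule_ge0// lee_fin ?gpdf_ge0 ?gdens_ge0.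
Qed.

End gauss_density.

(** * The law of a Gaussian subvector *)

Section gauss_law.
Context {R : realType}.
Local Notation leb := (@lebesgue_measure R).
Local Open Scope ereal_scope.

Section gprob.
Variables (n : nat) (B : 'M[R]_n).

Definition gprob (A : set (n.-tuple R)) : \bar R :=
  \int[lebn n]_(y in A) (gdens B y)%:E.

Let gprob0 : gprob set0 = 0.
Proof. by rewrite /gprob integral_set0. Qed.

Let gprob_ge0 A : 0 <= gprob A.
Proof. by apply: integral_ge0 => y _; rewrite lee_fin gdens_ge0. Qed.

Let gprob_sigma_additive : semi_sigma_additive gprob.
Proof.
move=> F mF tF mUF; rewrite /gprob ge0_integral_bigcup//.
- apply: is_cvg_ereal_nneg_natsum_cond => k _ _.
  by apply: integral_ge0 => y _; rewrite lee_fin gdens_ge0.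
- by apply/measurable_EFinP/measurable_funTS; exact: measurable_gdens.
- by move=> y _; rewrite lee_fin gdens_ge0.
Qed.

HB.instance Definition _ := isMeasure.Build _ _ _ gprob
  gprob0 gprob_ge0 gprob_sigma_additive.

End gprob.

Lemma gprobE n (B : 'M[R]_n) A : measurable A ->
  gprob B A = \int[lebn n]_y ((\1_A y)%:E * (gdens B y)%:E).
Proof.
move=> mA; rewrite /gprob integral_mkcond; apply: eq_integral => y _.
by rewrite restrict_EFin/= /patch/= indicE; case: ifPn; rewrite ?mul1e ?mul0e.
Qed.

Lemma gprob_dot n (B : 'M[R]_n) (t : 'I_n -> R) (A : set R) : posdef B ->
  measurable A ->
  gprob B (dot t @^-1` A) =
  gmean (qform B (\row_i t i) (\row_i t i)) (fun r => (\1_A r)%:E) 0%R.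
Proof.
move=> pB mA; rewrite gprobE; last first.
  by rewrite -[X in measurable X]setTI; exact: measurable_dot.
rewrite -(integral_gdens t 0%R pB).
- by apply: eq_integral => y _; rewrite add0r.
- by apply/measurable_EFinP; exact: measurable_indic.
- by move=> x; rewrite lee_fin.
Qed.

Lemma gprobT n (B : 'M[R]_n) : posdef B -> gprob B setT = 1.
Proof.
move=> pB; have := @gprob_dot n B (fun=> 0%R) setT pB measurableT.
rewrite preimage_setT => ->; rewrite (_ : (fun _ => _) = fun=> 1); last first.
  by apply/funext => r; rewrite indicT.
apply: gmean_cst; have [_ pos] := pB.
by have [->|/pos/ltW//] := eqVneq (\row_i 0%R : 'rV[R]_n) 0%R;
  rewrite /qform mul0mx mul0mx mxE.
Qed.

Context d (T : measurableType d) (P : probability T R).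

(** Both sides are probability measures on tuples with the same images under every [dot t], so
    [cramer_wold] identifies them. *)
Lemma gaussian_subvector_law n m (Y : 'I_n -> {RV P >-> R}) (mu : 'rV[R]_n)
    (B : 'M[R]_n) (sigma : 'I_m -> 'I_n) (A : set (m.-tuple R)) :
  gaussian_vector Y mu B -> posdef (\matrix_(i, j) B (sigma i) (sigma j)) ->
  measurable A ->
  P [set w | A [tuple (Y (sigma i) w - mu 0 (sigma i))%R | i < m]] =
  gprob (\matrix_(i, j) B (sigma i) (sigma j)) A.
Proof.
set C := \matrix_(i, j) _; move=> [_ [_ HY]] pC mA.
pose Z w := [tuple (Y (sigma i) w - mu 0 (sigma i))%R | i < m].
have mZ : measurable_fun setT Z.
  apply/measurable_fun_tnthP => i.
  rewrite (_ : _ \o _ = fun w => Y (sigma i) w - mu 0 (sigma i))%R; last first.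
    by apply/funext => w; rewrite /= tnth_mktuple.
  by apply: measurable_funB => //; exact: measurable_funP.
apply: (@cramer_wold _ m (pushforward P Z) (gprob C)) => //.
- by change (P (Z @^-1` setT) = 1); rewrite preimage_setT probability_setT.
- exact: gprobT.
move=> t D mD.
change (P (Z @^-1` (dot t @^-1` D)) = gprob C (dot t @^-1` D)).
rewrite gprob_dot//.
(* Pushing the coefficients [t] forward along [sigma] turns a combination of the subvector into one
   of [Y], with the same variance. *)
pose s : 'rV[R]_n := (\row_k \sum_(i | sigma i == k) t i)%R.
have sE (F : 'I_n -> R) : (\sum_k s 0 k * F k = \sum_i t i * F (sigma i))%R.
  rewrite [RHS](partition_big sigma predT)//=; apply: eq_bigr => k _.
  by rewrite mxE mulr_suml; apply: eq_bigr => i /eqP ->.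
have qE : qform B s s = qform C (\row_i t i) (\row_i t i).
  rewrite !qformE.
  transitivity (\sum_i t i * \sum_k B (sigma i) k * s 0 k)%R.
    rewrite -(sE (fun i => \sum_k B i k * s 0 k)%R); apply: eq_bigr => i _.
    by rewrite mulr_sumr; apply: eq_bigr => k _; rewrite mulrA.
  apply: eq_bigr => i _; rewrite mulr_sumr.
  under eq_bigr do rewrite (mulrC (B _ _)).
  rewrite -mulr_sumr sE mulr_sumr; apply: eq_bigr => j _.
  by rewrite !mxE; ring.
rewrite -qE; have [t0|tn0] := eqVneq (\row_i t i) (0%R : 'rV[R]_m).
  have -> : qform B s s = 0%R by rewrite qE t0 /qform mul0mx mul0mx mxE.
  have t0' i : t i = 0%R by move/rowP/(_ i) : t0; rewrite !mxE.
  have d0 y : dot t y = 0%R by rewrite /dot big1// => i _; rewrite t0' mul0r.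
  rewrite gmean0 indicE.
  have [/set_mem D0|/negP D0] := boolP (0%R \in D).
    rewrite (_ : _ @^-1` _ = setT) ?probability_setT//.
    by apply/seteqP; split => w //= _; rewrite d0.
  rewrite (_ : _ @^-1` _ = set0) ?measure0//.
  by apply/seteqP; split => w //=; rewrite d0 => /mem_set.
have v0 : (0 < qform B s s)%R by rewrite qE; apply: pC.2.
set v := qform B s s in v0 *; set M := (\sum_i s 0 i * mu 0 i)%R.
have mD' : measurable [set r | D (r - M)%R].
  rewrite -[X in measurable X]setTI.
  exact: (measurable_funB (@measurable_id _ R setT) (@measurable_cst _ _ _ R setT M)).
transitivity (P (lincomb s Y @^-1` [set r | D (r - M)%R])).
  have E w : dot t (Z w) = (lincomb s Y w - M)%R.
    rewrite /lincomb (sE (fun i => Y i w)) /M (sE (fun i => mu 0%R i)) -sumrB.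
    by apply: eq_bigr => i _; rewrite tnth_mktuple mulrBr.
  by congr (P _); apply/seteqP; split => w /=; rewrite E.
rewrite ((HY s).1 v0 _ mD') -/M -/v gmeanE//.
transitivity (\int[leb]_r ((\1_D (r - M)%R)%:E * (gpdf v (r - M))%:E)).
  rewrite /normal_prob integral_mkcond; apply: eq_integral => r _.
  rewrite restrict_EFin/= /patch/= normal_pdf_gpdf ?sqrtr_gt0//.
  rewrite sqr_sqrtr ?(ltW v0)// indicE.
  have -> : (r \in [set r | D (r - M)%R]) = (r - M \in D)%R.
    by apply/idP/idP => /set_mem/mem_set.
  by case: ifPn; rewrite ?mul1e ?mul0e.
rewrite -[RHS](ge0_integral_shift (- M)%R).
- by apply: eq_integral => r _; rewrite add0r.
- apply: emeasurable_funM.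
    apply/measurable_EFinP; apply: (measurableT_comp (measurable_indic mD)).
    exact: measurable_funD.
  by apply/measurable_EFinP; exact: measurable_gpdf.
- by move=> z; rewrite mule_ge0// lee_fin gpdf_ge0.
Qed.
End gauss_law.

(** * One-dimensional Laplace integrals *)

Section exp_taylor.
Context {R : realType}.
Implicit Types x u c a : R.

(** Indexed by the number of terms: differentiation then lowers the index by one, and the induction
    for the remainder starts from the empty sum. *)
Fixpoint exp_tay n x : R := if n is m.+1 then exp_tay m x + x ^+ m / m`!%:R else 0.

Lemma is_derive_exp_tay n x : is_derive x 1 (exp_tay n) (exp_tay n.-1 x).
Proof.
elim: n => [|n IH].
  exact: (is_derive_cst (0 : R) x 1).
rewrite [X in is_derive _ _ X]
  (_ : _ = exp_tay n + (n`!%:R^-1) *: (fun y : R => y ^+ n)); last first.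
  by apply/funext => y /=; rewrite fctE /= mulrC.
have H : is_derive x (1:R) (fun y : R => y ^+ n) (n%:R * x ^+ n.-1).
  apply: DeriveDef; first exact: exprn_derivable.
  by rewrite exp_derive /GRing.scale/= mulr1.
have {}H : is_derive x 1 (n`!%:R^-1 *: (fun y : R => y ^+ n))
    (n`!%:R^-1 *: (n%:R * x ^+ n.-1)) by exact: is_deriveZ.
apply: (is_derive_eq (is_deriveD IH H)); case: n {IH H} => [|n] /=.
  by rewrite mul0r scaler0 addr0.
congr (_ + _); rewrite /GRing.scale/= factS natrM invfM mulrC.
by rewrite -mulrA mulrCA (mulrA _ _ (n`!%:R^-1)) divff ?mul1r//.
Qed.

(** By the mean value theorem the remainder after [n.+1] terms is [x] times the remainder after [n]
    terms at a point between 0 and [x]. *)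
Lemma exp_tay_bound n x : `|expR x - exp_tay n x| <= `|x| ^+ n * expR `|x|.
Proof.
elim: n x => [|n IH] x.
  by rewrite subr0 expr0 mul1r ger0_norm ?expR_ge0// ler_expR ler_norm.
pose f y := expR y - exp_tay n.+1 y.
have f0 : f 0 = 0.
  rewrite /f expR0; elim: n {IH f} => [|n IHn] /=.
    by rewrite expr0 divr1 add0r subrr.
  by rewrite /= in IHn *; rewrite (expr0n _ n.+1)/= mul0r addr0.
have df (y : R) : is_derive y 1 f (expR y - exp_tay n y).
  have := is_derive_exp_tay n.+1 y; rewrite /= => dt.
  exact: is_deriveB.
have cf A : {within A, continuous f}.
  apply: continuous_subspaceT => y.
  by apply/differentiable_continuous/derivable1_diffP; exact: (@ex_derive _ _ _ _ _ _ _ (df y)).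
have step c : `|c| <= `|x| -> `|(expR c - exp_tay n c) * x| <= `|x| ^+ n.+1 * expR `|x|.
  move=> cx; rewrite normrM exprSr mulrAC ler_wpM2r//.
  apply: le_trans (IH c) _; rewrite ler_pM ?expR_ge0 ?exprn_ge0//.
    by rewrite lerXn2r ?nnegrE.
  by rewrite ler_expR.
rewrite -/(f x); have [x0|x0|->] := ltgtP x 0; last first.
- by rewrite f0 normr0 mulr_ge0 ?expR_ge0 ?exprn_ge0.
- have [c] := MVT x0 (fun y _ => df y) (cf _).
  rewrite in_itv/= => /andP[c0 cx]; rewrite f0 !subr0 => ->; apply: step.
  by rewrite !ger0_norm ?ltW.
- have [c] := MVT x0 (fun y _ => df y) (cf _).
  rewrite in_itv/= => /andP[cx c0]; rewrite f0 !sub0r mulrN => /oppr_inj ->.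
  by apply: step; rewrite !ler0_norm ?lerN2 ?ltW.
Qed.

Definition hexp x : R := expR x - 1 - x.

Lemma hexp_ge0 x : 0 <= hexp x.
Proof. by rewrite /hexp -addrA -opprD subr_ge0 expR_ge1Dx. Qed.

(** Tangent lines of [expR] at [c] and [- c], with [expR c] and [expR (- c)] replaced by their lower
    bounds [1 + c] and [1 - c]. Letting [c] depend on [u] gives quadratic growth near 0; a fixed [c]
    gives linear growth far away. *)
Lemma hexp_ge_lin c u : 0 <= c <= 1 -> c * `|u| - c ^+ 2 <= hexp u.
Proof.
move=> /andP[c0 c1]; rewrite /hexp; have [u0|u0] := leP 0 u.
  rewrite ger0_norm//.
  have H : (1 + c) * (1 + (u - c)) <= expR u.
    rewrite -[X in _ <= expR X](subrKC c) expRD ler_pM ?expR_ge1Dx//; lra.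
  by nra.
rewrite ltr0_norm//.
have H : (1 - c) * (1 + (u + c)) <= expR u.
  have [h|h] := leP 0 (1 + (u + c)).
    have -> : expR u = expR (- c) * expR (u + c).
      by rewrite -expRD; congr expR; ring.
    by rewrite ler_pM ?expR_ge1Dx ?subr_ge0.
  rewrite (le_trans _ (expR_ge0 _))// mulr_ge0_le0//; lra.
by nra.
Qed.

Lemma hexp_ge_abs u : 4^-1 <= `|u| -> `|u| / 16 <= hexp u.
Proof.
move=> u4; have h : 0 <= (8^-1 : R) <= 1 by apply/andP; split; lra.
by have := hexp_ge_lin u h; apply: le_trans; lra.
Qed.

Lemma abs_le_hexp u : `|u| <= 2 + 2 * hexp u.
Proof.
have h : 0 <= (2^-1 : R) <= 1 by apply/andP; split; lra.
by have := hexp_ge_lin u h; lra.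
Qed.

(** For [|u| <= 2] take [c = |u| / 2], which gives [u ^+ 2 / 4 <= hexp u]; beyond, slope 1 gives
    linear growth, whence the term [hexp u ^+ 2]. *)
Lemma sqr_le_hexp u : u ^+ 2 <= 8 * (hexp u + hexp u ^+ 2).
Proof.
have h0 := hexp_ge0 u; have u0 := normr_ge0 u.
rewrite -[u ^+ 2]real_normK ?num_real//.
have [u2|u2] := leP `|u| 2.
  have h : 0 <= `|u| / 2 <= 1 by apply/andP; split; lra.
  by have := hexp_ge_lin u h; nra.
have := @hexp_ge_lin 1 u; rewrite lexx ler01 => /(_ isT).
by nra.
Qed.

Lemma expR_le2 x : x <= 4^-1 -> expR x <= 2.
Proof.
move=> x4; have : 2^-1 <= expR (- x).
  by apply: le_trans (expR_ge1Dx _); lra.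
by rewrite expRN => h; rewrite -[leLHS]invrK invf_ple ?posrE ?invr_gt0 ?expR_gt0.
Qed.

Lemma hexp_taylor u : `|u| <= 4^-1 ->
  `|hexp u - u ^+ 2 / 2 - u ^+ 3 / 6| <= 2 * u ^+ 4.
Proof.
move=> u4; have := exp_tay_bound 4 u; rewrite /=.
have -> : expR u - (0 + u ^+ 0 / 0`!%:R + u ^+ 1 / 1`!%:R + u ^+ 2 / 2`!%:R +
   u ^+ 3 / 3`!%:R) = hexp u - u ^+ 2 / 2 - u ^+ 3 / 6.
  by rewrite /hexp !factS fact0 !muln1/=; field.
move=> /le_trans; apply; rewrite mulrC -normrX (@ger0_norm _ (u ^+ 4)) ?exprn_even_ge0//.
by rewrite ler_wpM2r ?exprn_even_ge0// expR_le2.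
Qed.

Lemma exp_quad x : `|expR x - 1 - x| <= x ^+ 2 * expR `|x|.
Proof.
have := exp_tay_bound 2 x; rewrite /=.
have -> : expR x - (0 + x ^+ 0 / 0`!%:R + x ^+ 1 / 1`!%:R) = expR x - 1 - x.
  by rewrite fact0 expr0 expr1 !divr1; ring.
by rewrite real_normK ?num_real.
Qed.

Lemma expr_le_exp n x : 0 <= x -> x ^+ n <= n`!%:R * expR x.
Proof.
case: n => [|n] x0.
  by rewrite expr0 fact0 mul1r -expR0 ler_expR.
have := expR_ge1Dxn n x0; set a := x ^+ _ => h.
by rewrite mulrC -ler_pdivrMr ?ltr0n ?fact_gt0//; lra.
Qed.

(** Adding the values at [u] and [- u] cancels the cubic term of [hexp]. What remains is of size
    [a * u ^+ 4 + a ^+ 2 * u ^+ 6], which is of order [1 / a] at the scale [a * u ^+ 2 = O(1)]; the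
    cubic term would be of order [1 / sqrt a]. *)
Lemma laplace_near a u : 1 <= a -> `|u| <= 4^-1 ->
  `|expR (- a * hexp u) + expR (- a * hexp (- u)) - 2 * expR (- a * u ^+ 2 / 2)|
  <= 7000 / a * expR (- a * u ^+ 2 / 8).
Proof.
move=> a1 u4; have a0 : 0 < a by lra.
have a0' := ltW a0.
pose z v := - a * (hexp v - v ^+ 2 / 2).
have zE v : v ^+ 2 = u ^+ 2 -> expR (- a * hexp v) = expR (- a * u ^+ 2 / 2) * expR (z v).
  by move=> vu; rewrite -expRD -vu; congr expR; rewrite /z; field.
rewrite (zE u)// (zE (- u)) ?sqrrN//.
have t1 := hexp_taylor u4.
have t2 : `|hexp (- u) - u ^+ 2 / 2 + u ^+ 3 / 6| <= 2 * u ^+ 4.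
  have := @hexp_taylor (- u); rewrite normrN => /(_ u4).
  have -> : (- u) ^+ 4 = u ^+ 4 by ring.
  by congr (`|_| <= _); ring.
have uu : u ^+ 4 = `|u| * `|u| ^+ 3 by rewrite -exprS -normrX ger0_norm ?exprn_even_ge0.
have u3 : `|u ^+ 3| = `|u| ^+ 3 by rewrite normrX.
have w0 : 0 <= `|u| ^+ 3 by rewrite exprn_ge0.
have z1 : `|z u| <= a * `|u| ^+ 3.
  rewrite /z normrM normrN (gtr0_norm a0) ler_pM2l//.
  have := ler_normD (hexp u - u ^+ 2 / 2 - u ^+ 3 / 6) (u ^+ 3 / 6).
  rewrite subrK (normrM (u ^+ 3)) u3 (ger0_norm (_ : 0 <= 6^-1)) ?invr_ge0// => h.
  by nra.
have z2 : `|z (- u)| <= a * `|u| ^+ 3.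
  rewrite /z normrM normrN (gtr0_norm a0) ler_pM2l// sqrrN.
  have := ler_normD (hexp (- u) - u ^+ 2 / 2 + u ^+ 3 / 6) (- (u ^+ 3 / 6)).
  rewrite addrK normrN (normrM (u ^+ 3)) u3 (ger0_norm (_ : 0 <= 6^-1)) ?invr_ge0// => h.
  by nra.
have z12 : `|z u + z (- u)| <= 4 * a * u ^+ 4.
  have -> : z u + z (- u) = - a * ((hexp u - u ^+ 2 / 2 - u ^+ 3 / 6) +
     (hexp (- u) - u ^+ 2 / 2 + u ^+ 3 / 6)) by rewrite /z sqrrN; ring.
  rewrite normrM normrN (gtr0_norm a0) [leRHS]mulrAC [leRHS]mulrC ler_pM2l//.
  by apply: le_trans (ler_normD _ _) _; lra.
have ub : u ^+ 2 = `|u| ^+ 2 by rewrite real_normK ?num_real.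
have au3 : a * `|u| ^+ 3 <= a * u ^+ 2 / 4.
  rewrite -mulrA ler_pM2l// ub exprSr.
  by rewrite ler_wpM2l// exprn_ge0.
pose E := expR (a * u ^+ 2 / 4).
have q (v : R) : v ^+ 2 = u ^+ 2 -> `|z v| <= a * `|u| ^+ 3 ->
    `|expR (z v) - 1 - z v| <= a ^+ 2 * u ^+ 6 * E.
  move=> vu zv; apply: le_trans (exp_quad _) _.
  rewrite ler_pM ?sqr_ge0 ?expR_ge0//.
    rewrite -[z v ^+ 2]real_normK ?num_real//.
    have -> : a ^+ 2 * u ^+ 6 = (a * `|u| ^+ 3) ^+ 2.
      by rewrite exprMn -u3 real_normK ?num_real// -exprM.
    by rewrite lerXn2r ?nnegrE// mulr_ge0// ltW.
  by rewrite ler_expR (le_trans zv).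
have F : `|expR (z u) + expR (z (- u)) - 2| <= (4 * a * u ^+ 4 + 2 * (a ^+ 2 * u ^+ 6)) * E.
  have -> : expR (z u) + expR (z (- u)) - 2 = (expR (z u) - 1 - z u) +
     (expR (z (- u)) - 1 - z (- u)) + (z u + z (- u)) by ring.
  have E1 : 1 <= E by rewrite -[leLHS]expR0 /E ler_expR divr_ge0// mulr_ge0// sqr_ge0.
  apply: le_trans (ler_normD _ _) _; apply: le_trans (lerD (ler_normD _ _) z12) _.
  have := q u erefl z1; have := q (- u) (sqrrN u) z2.
  have : 4 * a * u ^+ 4 <= 4 * a * u ^+ 4 * E.
    by rewrite ler_peMr// mulr_ge0 ?exprn_even_ge0// mulr_ge0.
  by lra.
have -> : expR (- a * u ^+ 2 / 2) * expR (z u) + expR (- a * u ^+ 2 / 2) * expR (z (- u)) -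
  2 * expR (- a * u ^+ 2 / 2) =
  expR (- a * u ^+ 2 / 2) * (expR (z u) + expR (z (- u)) - 2) by ring.
rewrite normrM (ger0_norm (expR_ge0 _)).
apply: le_trans (ler_wpM2l (expR_ge0 _) F) _.
(* In terms of [y] the error is [(256 y^2 + 1024 y^3) / a], and [y^k <= k! exp y] bounds it by
   [7000 exp y / a], as [512 + 6144 <= 7000]. The exponents [- 4 y + y + 2 y] leave [- y]. *)
pose y := a * u ^+ 2 / 8.
have y0 : 0 <= y by rewrite divr_ge0// mulr_ge0// sqr_ge0.
have -> : 4 * a * u ^+ 4 + 2 * (a ^+ 2 * u ^+ 6) = a^-1 * (256 * y ^+ 2 + 1024 * y ^+ 3).
  by rewrite /y; field; rewrite gt_eqF.
have y2 := expr_le_exp 2 y0; have y3 := expr_le_exp 3 y0.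
have yb : 256 * y ^+ 2 + 1024 * y ^+ 3 <= 7000 * expR y.
  by move: y2 y3; rewrite !factS fact0 !muln1/=; have := expR_ge0 y; lra.
apply: (@le_trans _ _ (expR (- a * u ^+ 2 / 2) * (a^-1 * (7000 * expR y) * E))).
  by rewrite ler_wpM2l ?expR_ge0// ler_wpM2r ?expR_ge0// ler_wpM2l// invr_ge0 ltW.
rewrite le_eqVlt; apply/orP; left; apply/eqP.
transitivity (7000 / a * (expR (- a * u ^+ 2 / 2) * expR y * E)); first by ring.
by rewrite -!expRD; congr (_ * expR _); rewrite /y; field.
Qed.

(** Each of the three terms is small by itself: part of its decay is traded for the factor [1 / a]
    through [1 + t <= exp t], using [|u| >= 1/4]. *)
Lemma laplace_far a u : 1 <= a -> 4^-1 <= `|u| ->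
  `|expR (- a * hexp u) + expR (- a * hexp (- u)) - 2 * expR (- a * u ^+ 2 / 2)|
  <= 300 / a * (expR (- a * u ^+ 2 / 8) + expR (- a * `|u| / 32)).
Proof.
move=> a1 u4; have a0 : 0 < a by lra.
have a0' := ltW a0.
have b (v : R) : `|v| = `|u| -> expR (- a * hexp v) <= 128 / a * expR (- a * `|u| / 32).
  move=> vu; apply: (@le_trans _ _ (expR (- a * `|u| / 16))).
    rewrite ler_expR -mulrA ler_nM2l ?oppr_lt0// -vu; apply: hexp_ge_abs.
    by rewrite vu.
  have -> : - a * `|u| / 16 = - (a * `|u| / 32) + - a * `|u| / 32 by field.
  rewrite expRD ler_wpM2r ?expR_ge0// expRN -[leRHS]invrK lef_pV2 ?posrE ?expR_gt0//; last first.
    by rewrite invr_gt0 divr_gt0.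
  rewrite invf_div; have := expR_ge1Dx (a * `|u| / 32).
  by apply: le_trans; nra.
have b3 : expR (- a * u ^+ 2 / 2) <= 128 / a * expR (- a * u ^+ 2 / 8).
  have -> : - a * u ^+ 2 / 2 = - (a * u ^+ 2 * 3 / 8) + - a * u ^+ 2 / 8 by field.
  rewrite expRD ler_wpM2r ?expR_ge0// expRN -[leRHS]invrK lef_pV2 ?posrE ?expR_gt0//; last first.
    by rewrite invr_gt0 divr_gt0.
  rewrite invf_div; have := expR_ge1Dx (a * u ^+ 2 * 3 / 8).
  have : 16^-1 <= u ^+ 2 by rewrite -[u ^+ 2]real_normK ?num_real//; nra.
  by move=> ?; apply: le_trans; nra.
have b1 := b u erefl; have b2 := b (- u) (normrN u).
have e1 := expR_ge0 (- a * hexp u); have e2 := expR_ge0 (- a * hexp (- u)).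
have e3 := expR_ge0 (- a * u ^+ 2 / 2).
have e4 : 0 <= a^-1 * expR (- a * u ^+ 2 / 8) by rewrite mulr_ge0 ?expR_ge0// invr_ge0 ltW.
have e5 : 0 <= a^-1 * expR (- a * `|u| / 32) by rewrite mulr_ge0 ?expR_ge0// invr_ge0 ltW.
by rewrite ler_norml; apply/andP; split; lra.
Qed.

End exp_taylor.

Section laplace.
Context {R : realType}.
Local Notation leb := (@lebesgue_measure R).
Local Open Scope ereal_scope.

Lemma measurable_hexp : measurable_fun [set: R] (@hexp R).
Proof. by apply: measurable_funB => //; exact: measurable_funB. Qed.

Lemma measurable_exp_hexp (a : R) :
  measurable_fun [set: R] (fun u : R => expR (- a * hexp u)).
Proof.
apply: measurableT_comp => //; apply: measurable_funM => //.
exact: measurable_hexp.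
Qed.

Lemma measurable_exp_sqr (c : R) :
  measurable_fun [set: R] (fun u : R => expR (c * u ^+ 2)).
Proof. by apply: measurableT_comp => //; exact: measurable_funM. Qed.

Lemma measurable_exp_abs (c : R) :
  measurable_fun [set: R] (fun u : R => expR (c * `|u|)).
Proof.
by apply: measurableT_comp => //; apply: measurable_funM.
Qed.

Lemma integral_exp_sqr (c : R) : (0 < c)%R ->
  \int[leb]_u (expR (- c * u ^+ 2))%:E = (Num.sqrt (pi / c))%:E.
Proof.
move=> c0; pose v := (2 * c)^-1%R; have v0 : (0 < v)%R by rewrite invr_gt0 mulr_gt0.
pose s := Num.sqrt (pi *+ 2 * v)%R.
have s0 : (0 < s)%R by rewrite sqrtr_gt0 mulr_gt0// mulrn_wgt0// pi_gt0.
have sE : (pi *+ 2 * v = pi / c)%R by rewrite /v; field; rewrite gt_eqF.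
rewrite -sE -/s -[RHS]mule1 -(integral_gpdf v0).
have mg : measurable_fun [set: R] (fun x : R => (gpdf v x)%:E).
  by apply/measurable_EFinP; exact: measurable_gpdf.
have g0 (x : R) : 0 <= (gpdf v x)%:E by rewrite lee_fin gpdf_ge0.
have s0' : 0 <= s%:E by rewrite lee_fin ltW.
apply: etrans; last exact: (ge0_integralZl leb measurableT mg (fun x _ => g0 x) s0').
apply: eq_integral => u _; rewrite -EFinM; congr (_%:E).
rewrite /gpdf -/s [RHS]mulrA divff ?gt_eqF// mul1r.
by congr expR; rewrite /v; field; rewrite gt_eqF.
Qed.

Lemma integral_exp_abs_le (c : R) : (0 < c)%R ->
  \int[leb]_u (expR (- c * `|u|))%:E <= (2 / c)%:E.
Proof.
move=> c0; have mE := measurable_exponential_pdf c.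
have mE' : measurable_fun [set: R] (fun u : R => (exponential_pdf c u)%:E).
  by apply/measurable_EFinP.
have mEN : measurable_fun [set: R] (fun u : R => (exponential_pdf c (- u))%:E).
  by apply/measurable_EFinP; apply: measurableT_comp.
have E0 (u : R) : (0 <= exponential_pdf c u)%R by apply: exponential_pdf_ge0; exact: ltW.
have I1 := integral_exponential_pdf c0.
have I2 : \int[leb]_u (exponential_pdf c (- u))%:E = 1.
  by rewrite -[RHS]I1 -[RHS]ge0_integral_opp// => u; rewrite lee_fin.
have c0' : 0 <= (c^-1)%:E by rewrite lee_fin invr_ge0 ltW.
apply: (@le_trans _ _ (\int[leb]_u ((c^-1)%:E *
    ((exponential_pdf c u)%:E + (exponential_pdf c (- u))%:E)))).
  apply: ge0_le_integral => //.
  - by apply/measurable_EFinP; exact: measurable_exp_abs.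
  - by apply: emeasurable_funM => //; exact: emeasurable_funD.
  move=> u _; rewrite -EFinD -EFinM lee_fin.
  have [u0|u0] := leP 0%R u.
    rewrite ger0_norm// (exponential_pdfE _ u0) mulrDr mulrA mulVf ?gt_eqF//.
    by rewrite mul1r lerDl mulr_ge0// invr_ge0 ltW.
  have u0' : (0 <= - u)%R by rewrite oppr_ge0 ltW.
  rewrite ltr0_norm// (exponential_pdfE _ u0') mulrDr [(_ * (c * _))%R]mulrA mulVf ?gt_eqF//.
  by rewrite mul1r lerDr mulr_ge0// invr_ge0 ltW.
have mD : measurable_fun [set: R]
    (fun u : R => (exponential_pdf c u)%:E + (exponential_pdf c (- u))%:E).
  exact: emeasurable_funD.
have D0 (u : R) : 0 <= (exponential_pdf c u)%:E + (exponential_pdf c (- u))%:E.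
  by rewrite -EFinD lee_fin addr_ge0.
rewrite (ge0_integralZl leb measurableT mD (fun x _ => D0 x) c0').
have E0' (u : R) : 0 <= (exponential_pdf c u)%:E by rewrite lee_fin.
rewrite (ge0_integralD leb measurableT (fun x _ => E0' x) mE' (fun x _ => E0' (- x)%R) mEN).
by rewrite I1 I2 -EFinD -EFinM lee_fin mulrC.
Qed.

(** Twice the integral is the integral of the symmetrized [S], which the two preceding estimates
    compare pointwise with the Gaussian [ph]. *)
Theorem laplace_integral : exists C : R, forall a : R, (1 <= a)%R -> exists r : R,
  \int[leb]_u (expR (- a * hexp u))%:E = (Num.sqrt (pi *+ 2 / a) * (1 + r))%:E /\
  (`|r| <= C / a)%R.
Proof.
(* The existentials keep the numerals opaque. [7300 = 7000 + 300] covers the Gaussian parts of both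
   estimates. *)
have [k1 k1E] : exists k : R, k = 7300%R by exists 7300%R.
have [k2 k2E] : exists k : R, k = 300%R by exists 300%R.
have k10 : (0 <= k1)%R by rewrite k1E ler0n.
have k20 : (0 <= k2)%R by rewrite k2E ler0n.
(* The Gaussian part of [W] integrates to [2 * s] times its coefficient, the exponential part to at
   most [64 / a <= 64 * s] times its coefficient. *)
pose k3 : R := (2 * k1 + 64 * k2)%R.
exists k3 => a a1; have a0 : (0 < a)%R by lra.
set G := \int[leb]_u _; pose s := Num.sqrt (pi *+ 2 / a)%R.
have p2 : (2 <= pi :> R)%R by exact: pi_ge2.
have s0 : (0 < s)%R by rewrite sqrtr_gt0 divr_gt0// mulrn_wgt0// pi_gt0.
have as_ : (a^-1 <= s)%R.
  rewrite -[leLHS]ger0_norm ?invr_ge0 ?(ltW a0)// -sqrtr_sqr /s ler_sqrt//.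
    rewrite expr2 ler_pM2r ?invr_gt0//; have : (a^-1 <= 1)%R by rewrite invf_le1.
    by move: p2; rewrite mulr2n; lra.
  by apply: divr_ge0; [apply: mulrn_wge0; exact: pi_ge0|exact: ltW].
pose S (u : R) := (expR (- a * hexp u) + expR (- a * hexp (- u)))%R.
pose ph (u : R) := (2 * expR (- (a / 2) * u ^+ 2))%R.
pose W (u : R) := (k1 / a * expR (- (a / 8) * u ^+ 2) + k2 / a * expR (- (a / 32) * `|u|))%R.
have bnd (u : R) : (`|S u - ph u| <= W u)%R.
  have e1 : (0 <= a^-1 * expR (- (a / 8) * u ^+ 2))%R by rewrite mulr_ge0 ?expR_ge0// invr_ge0 ltW.
  have e2 : (0 <= a^-1 * expR (- (a / 32) * `|u|))%R by rewrite mulr_ge0 ?expR_ge0// invr_ge0 ltW.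
  have r2 : (- a * u ^+ 2 / 2 = - (a / 2) * u ^+ 2)%R by field.
  have r8 : (- a * u ^+ 2 / 8 = - (a / 8) * u ^+ 2)%R by field.
  have r32 : (- a * `|u| / 32 = - (a / 32) * `|u|)%R by field.
  have [u4|u4] := leP `|u|%R 4^-1%R.
    have := laplace_near a1 u4; rewrite r2 r8 => h.
    by apply: le_trans h _; rewrite /W k1E k2E; lra.
  have := laplace_far a1 (ltW u4); rewrite r2 r8 r32 => h.
  by apply: le_trans h _; rewrite /W k1E k2E; lra.
have mS1 : measurable_fun [set: R] (fun u : R => (expR (- a * hexp u))%:E).
  by apply/measurable_EFinP; exact: measurable_exp_hexp.
have mS2 : measurable_fun [set: R] (fun u : R => (expR (- a * hexp (- u)))%:E).
  apply/measurable_EFinP; apply: (measurableT_comp (measurable_exp_hexp a)).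
  exact: oppr_measurable.
have S10 (u : R) : 0 <= (expR (- a * hexp u))%:E by rewrite lee_fin expR_ge0.
have mS : measurable_fun [set: R] (fun u : R => (S u)%:E).
  by under eq_fun do rewrite EFinD; exact: emeasurable_funD.
have IS : \int[leb]_u (S u)%:E = G + G.
  under eq_integral do rewrite EFinD.
  rewrite (ge0_integralD leb measurableT (fun x _ => S10 x) mS1 (fun x _ => S10 (- x)%R) mS2).
  congr (_ + _); exact: (ge0_integral_opp mS1 S10).
have mph0 (c : R) : measurable_fun [set: R] (fun u : R => (expR (- c * u ^+ 2))%:E).
  by apply/measurable_EFinP; exact: measurable_exp_sqr.
have ph00 (c u : R) : 0 <= (expR (- c * u ^+ 2))%:E by rewrite lee_fin expR_ge0.
have mph : measurable_fun [set: R] (fun u : R => (ph u)%:E).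
  by apply/measurable_EFinP; apply: measurable_funM => //; exact: measurable_exp_sqr.
have Iph : \int[leb]_u (ph u)%:E = (2 * s)%:E.
  under eq_integral do rewrite EFinM.
  rewrite (ge0_integralZl leb measurableT (mph0 _) (fun x _ => ph00 _ x))//.
  rewrite integral_exp_sqr ?divr_gt0// -EFinM; congr (2 * Num.sqrt _)%:E.
  by field; rewrite gt_eqF.
have mab (c : R) : measurable_fun [set: R] (fun u : R => (expR (- c * `|u|))%:E).
  by apply/measurable_EFinP; exact: measurable_exp_abs.
have ab0 (c u : R) : 0 <= (expR (- c * `|u|))%:E by rewrite lee_fin expR_ge0.
have mW : measurable_fun [set: R] (fun u : R => (W u)%:E).
  apply/measurable_EFinP; apply: measurable_funD; apply: measurable_funM => //.
    exact: measurable_exp_sqr.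
  exact: measurable_exp_abs.
have W0 (u : R) : (0 <= W u)%R by exact: le_trans (normr_ge0 _) (bnd u).
have c1 : 0 <= (k1 / a)%:E by rewrite lee_fin mulr_ge0// invr_ge0 ltW.
have c2 : 0 <= (k2 / a)%:E by rewrite lee_fin mulr_ge0// invr_ge0 ltW.
have IW : \int[leb]_u (W u)%:E <= (k3 / a * s)%:E.
  under eq_integral do rewrite EFinD !EFinM.
  have mW1 : measurable_fun [set: R] (fun u : R => (k1 / a)%:E * (expR (- (a / 8) * u ^+ 2))%:E).
    by apply: emeasurable_funM; [exact: measurable_cst|].
  have mW2 : measurable_fun [set: R] (fun u : R => (k2 / a)%:E * (expR (- (a / 32) * `|u|))%:E).
    by apply: emeasurable_funM; [exact: measurable_cst|].
  have W10 (u : R) : 0 <= (k1 / a)%:E * (expR (- (a / 8) * u ^+ 2))%:E by rewrite mule_ge0.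
  have W20 (u : R) : 0 <= (k2 / a)%:E * (expR (- (a / 32) * `|u|))%:E by rewrite mule_ge0.
  rewrite (ge0_integralD leb measurableT (fun x _ => W10 x) mW1 (fun x _ => W20 x) mW2).
  rewrite (ge0_integralZl leb measurableT (mph0 _) (fun x _ => ph00 _ x) c1).
  rewrite (ge0_integralZl leb measurableT (mab _) (fun x _ => ab0 _ x) c2).
  rewrite integral_exp_sqr ?divr_gt0//.
  have -> : Num.sqrt (pi / (a / 8))%R = (2 * s)%R.
    have -> : (pi / (a / 8) = 2 ^+ 2 * (pi *+ 2 / a))%R by field; rewrite gt_eqF.
    by rewrite (sqrtrM _ (sqr_ge0 _)) sqrtr_sqr ger0_norm.
  have h := integral_exp_abs_le (divr_gt0 a0 (ltr0n _ 32)).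
  apply: le_trans (leeD2l _ (lee_wpmul2l c2 h)) _.
  rewrite -!EFinM -EFinD lee_fin.
  have -> : (2 / (a / 32) = 64 * a^-1)%R by field; rewrite gt_eqF.
  have ai : (0 < a^-1)%R by rewrite invr_gt0.
  have : (k2 * a^-1 * a^-1 <= k2 * a^-1 * s)%R.
    by rewrite ler_wpM2l// mulr_ge0// invr_ge0 ltW.
  by rewrite /k3; lra.
have U1 : G + G <= (2 * s)%:E + (k3 / a * s)%:E.
  rewrite -IS -Iph; apply: le_trans (leeD2l _ IW).
  have p0 (u : R) : 0 <= (ph u)%:E by rewrite lee_fin mulr_ge0 ?expR_ge0.
  have w0 (u : R) : 0 <= (W u)%:E by rewrite lee_fin.
  rewrite -(ge0_integralD leb measurableT (fun x _ => p0 x) mph (fun x _ => w0 x) mW).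
  apply: ge0_le_integral => //.
  - by move=> u _; rewrite lee_fin addr_ge0 ?expR_ge0.
  - exact: emeasurable_funD.
  - move=> u _; rewrite -EFinD lee_fin.
    by have := bnd u; rewrite ler_norml => /andP[_]; lra.
have U2 : (2 * s)%:E <= G + G + (k3 / a * s)%:E.
  rewrite -IS -Iph; apply: le_trans (leeD2l _ IW).
  have p0 (u : R) : 0 <= (S u)%:E by rewrite lee_fin addr_ge0 ?expR_ge0.
  have w0 (u : R) : 0 <= (W u)%:E by rewrite lee_fin.
  rewrite -(ge0_integralD leb measurableT (fun x _ => p0 x) mS (fun x _ => w0 x) mW).
  apply: ge0_le_integral => //.
  - by move=> u _; rewrite lee_fin mulr_ge0 ?expR_ge0.
  - exact: emeasurable_funD.
  - move=> u _; rewrite -EFinD lee_fin.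
    by have := bnd u; rewrite ler_norml => /andP[+ _]; lra.
have G0 : 0 <= G by apply: integral_ge0 => u _.
have : G \is a fin_num.
  rewrite ge0_fin_numE//; apply: (@le_lt_trans _ _ (G + G)); first by rewrite leeDl.
  by apply: le_lt_trans U1 _; rewrite -EFinD ltry.
move=> /fineK; set g := fine G => gE.
rewrite -gE in U1 U2 *.
move: U1 U2; rewrite -!EFinD !lee_fin => U1 U2.
exists (g / s - 1)%R; rewrite addrC subrK mulrC divfK ?gt_eqF//; split => //.
rewrite ler_norml lerBrDr lerBlDr ler_pdivrMr// ler_pdivlMr//.
have as0 : (0 <= k3 / a * s)%R 
    by rewrite mulr_ge0 ?(ltW s0)// mulr_ge0 ?invr_ge0 ?(ltW a0)// addr_ge0// mulr_ge0.
by apply/andP; split; lra.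
Qed.

End laplace.

(** * The exponential constraint *)

Section dirichlet.
Context {R : realType}.
Local Notation leb := (@lebesgue_measure R).

Lemma measurable_ler_cst d (T : measurableType d) (c : R) (f : T -> R) :
  measurable_fun setT f -> measurable_fun setT (fun x => (c <= f x)%R%:R : R).
Proof.
move=> mf; rewrite (_ : (fun _ => _) = \1_(f @^-1` `[c, +oo[)); last first.
  apply/funext => x; rewrite indicE; congr (_%:R); congr nat_of_bool.
  by apply/idP/idP => [h|/set_mem]; rewrite ?inE/= in_itv/= andbT.
by apply: measurable_indic; rewrite -[X in measurable X]setTI; apply: mf.
Qed.

Lemma measurable_lebn_tail n (f : n.+1.-tuple R -> \bar R) :
  measurable_fun setT f -> (forall x, 0 <= f x)%E ->
  measurable_fun setT (fun y : n.-tuple R => \int[leb]_x f [tuple of x :: y])%E.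
Proof.
move=> mf f0; apply: (@measurable_fun_fubini_tonelli_G _ _ (measurableTypeR R)
  (n.-tuple R) R leb (f \o @consp R n)) => [|p]; last exact: f0.
by apply: measurableT_comp => //; exact: measurable_consp.
Qed.

Variables (m : nat) (beta : 'I_m.+1 -> R).
Hypotheses (beta1 : beta ord0 = 1) (beta_gt0 : forall i, 0 < beta i).

Let w0 : R := \sum_i beta i.

(** The constraint reads [w0 * exp v_0 >= 1 + sum_(i > 0) beta_i * exp v_i]: its constant 1 is
    treated as the term of a coordinate equal to 0 with weight [beta ord0 = 1]. This explains that
    value of [beta], the sum [w0], and why the weights [dir_w] sum to 1. *)
Definition dir_w (i : 'I_m.+1) : R := if i == ord0 then w0 else - beta i.

Definition dir_sum (v : m.+1.-tuple R) : R := \sum_i dir_w i * expR (tnth v i).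

Definition log_mean (l : m.+1.-tuple R) : R :=
  ln ((\sum_i beta i * expR (tnth l i)) / w0).

(** [l] is a system of homogeneous coordinates with gauge [l_0]: adding a constant to all of them
    does not change the image. The slack [e] is the excess of the leading coordinate over the least
    value that the constraint allows. *)
Definition dir_map (e : R) (l : m.+1.-tuple R) : m.+1.-tuple R :=
  [tuple if i == ord0 then log_mean l - tnth l ord0 + e
         else tnth l i - tnth l ord0 | i < m.+1].

Lemma w0_gt0 : 0 < w0.
Proof.
rewrite /w0 big_ord_recl; apply: ltr_wpDr => //.
by apply: sumr_ge0 => i _; exact: ltW.
Qed.

Lemma sum_beta_exp_gt0 (l : m.+1.-tuple R) : 0 < \sum_i beta i * expR (tnth l i).
Proof.
rewrite big_ord_recl; apply: ltr_wpDr; last by rewrite mulr_gt0 ?expR_gt0.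
by apply: sumr_ge0 => i _; rewrite mulr_ge0 ?expR_ge0// ltW.
Qed.

Lemma measurable_lin n (c : 'I_n -> R) (f : 'I_n -> R -> R) :
  (forall i, measurable_fun [set: R] (f i)) ->
  measurable_fun setT (fun v : n.-tuple R => \sum_i c i * f i (tnth v i)).
Proof.
move=> mf; apply: measurable_sum => i; apply: measurable_funM => //.
by apply: (measurableT_comp (mf i)); exact: measurable_tnth.
Qed.

Lemma measurable_log_mean : measurable_fun setT log_mean.
Proof.
apply: (measurableT_comp (@measurable_ln R)); apply: measurable_funM => //.
exact: (@measurable_lin _ beta (fun=> expR)).
Qed.

Lemma measurable_dir_map :
  measurable_fun setT (fun p : m.+1.-tuple R * R => dir_map p.2 p.1).
Proof.
apply/measurable_fun_tnthP => i.
have mt j : measurable_fun setT (fun p : m.+1.-tuple R * R => tnth p.1 j).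
  by apply: (measurableT_comp (measurable_tnth j)).
rewrite (_ : _ \o _ = fun p => if i == ord0
    then log_mean p.1 - tnth p.1 ord0 + p.2 else tnth p.1 i - tnth p.1 ord0).
  case: (i == ord0); last exact: measurable_funB.
  apply: measurable_funD => //; apply: measurable_funB => //.
  by apply: (measurableT_comp measurable_log_mean).
by apply/funext => p /=; rewrite tnth_mktuple.
Qed.

Lemma measurable_dir_sum : measurable_fun setT dir_sum.
Proof. exact: (@measurable_lin _ dir_w (fun=> expR)). Qed.

Section pointwise.
Variables (r : R) (y : m.-tuple R).

Let l : m.+1.-tuple R := [tuple of r :: tadd [tuple r | _ < m] y].
Let l0 : m.+1.-tuple R := [tuple of 0 :: y].

Let tnth_l i : tnth l i = r + tnth l0 i.
Proof.
case: (unliftP ord0 i) => [j|] ->; last by rewrite !tnth0 addr0.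
by rewrite !tnthS !tnth_mktuple addrC.
Qed.

Let sum_l : \sum_i beta i * expR (tnth l i) = expR r * \sum_i beta i * expR (tnth l0 i).
Proof.
by rewrite mulr_sumr; apply: eq_bigr => i _; rewrite tnth_l expRD mulrCA.
Qed.

Lemma log_mean_shift : log_mean l = r + log_mean l0.
Proof.
have s0 := sum_beta_exp_gt0 l0; have w00 := w0_gt0.
by rewrite /log_mean sum_l -mulrA lnM ?posrE ?expR_gt0 ?divr_gt0// expRK.
Qed.

Lemma dir_map_shift e : dir_map e l = [tuple of (e + log_mean l0) :: y].
Proof.
apply: eq_from_tnth => i; rewrite tnth_mktuple log_mean_shift.
case: (unliftP ord0 i) => [j|] -> /=; last by rewrite !tnth0; ring.
by rewrite !tnthS tnth_mktuple tnth0 tnth_mktuple addrK.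
Qed.

Lemma dot_dir_w x : dot dir_w [tuple of x :: y] =
  w0 * x - \sum_(i < m) beta (lift ord0 i) * tnth y i.
Proof.
rewrite /dot big_ord_recl tnth0 /dir_w eqxx -sumrN; congr (_ + _).
by apply: eq_bigr => i _; rewrite tnthS /= mulNr.
Qed.

(** [log_mean l0] is the value of the leading coordinate at which the constraint becomes an
    equality. *)
Lemma dir_sum_shift e : (1 <= dir_sum [tuple of (e + log_mean l0) :: y]) = (0 <= e).
Proof.
have s0 := sum_beta_exp_gt0 l0; have w00 := w0_gt0.
rewrite /dir_sum big_ord_recl tnth0 {1}/dir_w eqxx expRD /log_mean.
rewrite lnK ?posrE ?divr_gt0//.
have -> : \sum_(i < m) dir_w (lift ord0 i) *
    expR (tnth [tuple of e + log_mean l0 :: y] (lift ord0 i)) =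
    1 - \sum_i beta i * expR (tnth l0 i).
  rewrite [in RHS]big_ord_recl tnth0 expR0 mulr1 beta1 opprD addrA subrr add0r -sumrN.
  by apply: eq_bigr => i _; rewrite !tnthS /dir_w/= mulNr.
set S := \sum_i _ in s0 *.
have -> : w0 * (expR e * (S / w0)) = expR e * S by field; rewrite gt_eqF.
rewrite addrCA lerDl subr_ge0 -[leLHS]mul1r ler_pM2r//.
by rewrite -[X in X <= _]expR0 ler_expR.
Qed.

(* With the gauge [l ord0 = r], the weight [expR (- lam * w0 * hexp (r + a))],
   [a] being the log of the mean, turns the dependence on the constraint into
   independent factors. *)
Lemma dir_exponent (lam e : R) :
  - (lam * w0) * hexp (r + log_mean l0) +
    - lam * dot dir_w [tuple of (e + log_mean l0) :: y] =
  - (lam * w0) * e + - lam * \sum_i beta i * hexp (tnth l i).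
Proof.
have s0 := sum_beta_exp_gt0 l0; have w00 := w0_gt0.
have -> : \sum_i beta i * hexp (tnth l i) =
    expR r * (\sum_i beta i * expR (tnth l0 i)) - w0 - w0 * r -
    \sum_(i < m) beta (lift ord0 i) * tnth y i.
  have -> : \sum_(i < m) beta (lift ord0 i) * tnth y i = \sum_i beta i * tnth l0 i.
    rewrite [RHS]big_ord_recl tnth0 mulr0 add0r.
    by apply: eq_bigr => i _; rewrite tnthS.
  rewrite -sum_l /w0 mulr_suml -!sumrB; apply: eq_bigr => i _.
  by rewrite /hexp tnth_l; ring.
have E : expR (log_mean l0) = (\sum_i beta i * expR (tnth l0 i)) / w0.
  by rewrite /log_mean lnK// posrE divr_gt0.
rewrite dot_dir_w /hexp expRD E.
set S := \sum_i beta i * expR _; set T := \sum_(i < m) _.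
by field; rewrite gt_eqF.
Qed.

End pointwise.

Local Open Scope ereal_scope.

(** For each tail [y], the auxiliary variable [r] and the leading coordinate are both translated by
    [log_mean (0 :: y)]; then [dir_exponent] matches the two integrands with [l = (r, r + y)]. *)
Theorem dirichlet_transform (lam : R) (F : m.+1.-tuple R -> \bar R) :
  (0 < lam)%R -> measurable_fun setT F -> (forall v, 0 <= F v) ->
  \int[leb]_r (expR (- (lam * w0) * hexp r))%:E *
  \int[lebn m.+1]_v (((1 <= dir_sum v)%R%:R * expR (- lam * dot dir_w v))%:E * F v) =
  \int[lebn m.+1]_l \int[leb]_e
    (((0 <= e)%R%:R * expR (- (lam * w0) * e) *
      expR (- lam * \sum_i beta i * hexp (tnth l i)))%:E * F (dir_map e l)).
Proof.
move=> lam0 mF F0.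
set f : m.+1.-tuple R -> \bar R := fun v => _ * F v.
pose K (p : m.+1.-tuple R * R) : \bar R :=
  ((0 <= p.2)%R%:R * expR (- (lam * w0) * p.2) *
      expR (- lam * \sum_i beta i * hexp (tnth p.1 i)))%:E * F (dir_map p.2 p.1).
pose Psi l := \int[leb]_e K (l, e).
have mf : measurable_fun setT f.
  apply: emeasurable_funM => //; apply/measurable_EFinP; apply: measurable_funM.
    exact: (measurable_ler_cst _ measurable_dir_sum).
  apply: measurableT_comp => //; apply: measurable_funM => //.
  exact: measurable_dot.
have f0 v : 0 <= f v by rewrite /f mule_ge0// lee_fin mulr_ge0 ?expR_ge0.
have mK : measurable_fun setT K.
  apply: emeasurable_funM; last by apply: (measurableT_comp mF measurable_dir_map).
  apply/measurable_EFinP; apply: measurable_funM.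
    apply: measurable_funM; first exact: measurable_ler_cst.
    by apply: measurableT_comp => //; exact: measurable_funM.
  apply: measurableT_comp => //; apply: measurable_funM => //.
  have := @measurable_lin _ beta (fun=> @hexp R) (fun=> measurable_hexp).
  by move=> h; apply: (measurableT_comp h).
have K0 p : 0 <= K p by rewrite /K mule_ge0// lee_fin !mulr_ge0 ?expR_ge0.
have mPsi : measurable_fun setT Psi.
  exact: (@measurable_fun_fubini_tonelli_F _ _ (m.+1.-tuple R) (measurableTypeR R) R leb K).
have Psi0 l : 0 <= Psi l by apply: integral_ge0 => e _.
change (\int[leb]_r (expR (- (lam * w0) * hexp r))%:E * \int[lebn m.+1]_v f v =
  \int[lebn m.+1]_l Psi l).
rewrite (integral_lebnS mPsi Psi0).
(* Translating the tail of [l] by its gauge [r] makes [dir_map e l] independent of [r]. *)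
under [RHS]eq_integral => r _ do
  rewrite -(integral_lebn_shift [tuple r | _ < m] (measurable_cons_tail r mPsi)
    (fun y => Psi0 _)).
pose sh (p : R * m.-tuple R) : m.+1.-tuple R :=
  [tuple of p.1 :: tadd [tuple p.1 | _ < m] p.2].
have msh : measurable_fun setT sh.
  apply: measurable_cons => //; apply/measurable_fun_tnthP => i.
  rewrite (_ : _ \o _ = fun p => tnth p.2 i + p.1)%R; last first.
    by apply/funext => p /=; rewrite !tnth_mktuple.
  apply: measurable_funD => //.
  exact: (measurableT_comp (measurable_tnth i) measurable_snd).
have mPs : measurable_fun setT (Psi \o sh) by exact: measurableT_comp.
have Ps0 p : 0 <= (Psi \o sh) p by exact: Psi0.
rewrite [RHS](@fubini_tonelli _ _ (measurableTypeR R) (m.-tuple R) R leb (lebn m)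
  (Psi \o sh) mPs Ps0).
rewrite (integral_lebnS_swap mf f0).
have G0 : 0 <= \int[leb]_r (expR (- (lam * w0) * hexp r))%:E.
  by apply: integral_ge0 => r _; rewrite lee_fin expR_ge0.
have I0 (y : m.-tuple R) : 0 <= \int[leb]_x f [tuple of x :: y].
  by apply: integral_ge0 => x _.
rewrite -(ge0_integralZl (lebn m) measurableT (measurable_lebn_tail mf f0) (fun y _ => I0 y) G0).
apply: eq_integral => y _.
set a := log_mean [tuple of 0%R :: y].
have mG : measurable_fun [set: R] (fun r : R => (expR (- (lam * w0) * hexp r))%:E).
  by apply/measurable_EFinP; exact: measurable_exp_hexp.
have mGa : measurable_fun [set: R] (fun r : R => (expR (- (lam * w0) * hexp (r + a)))%:E).
  apply: (measurableT_comp mG); exact: measurable_funD.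
have g0 (r : R) : 0 <= (expR (- (lam * w0) * hexp r))%:E by rewrite lee_fin expR_ge0.
rewrite -(ge0_integral_shift a mG g0).
rewrite -(ge0_integralZr leb measurableT mGa (fun r _ => g0 (r + a)%R) (I0 y)).
apply: eq_integral => r _.
have mfx : measurable_fun [set: R] (fun x : R => f [tuple of x :: y]).
  by apply: (measurableT_comp mf); exact: measurable_cons.
have mfa : measurable_fun [set: R] (fun x : R => f [tuple of (x + a)%R :: y]).
  by apply: (measurableT_comp mfx); exact: measurable_funD.
rewrite -(ge0_integral_shift a mfx (fun x => f0 _)).
rewrite -(ge0_integralZl leb measurableT mfa (fun x _ => f0 _) (g0 (r + a)%R)).
apply: eq_integral => e _.
rewrite /f /K /sh/= dir_map_shift muleA -EFinM dir_sum_shift; congr (_%:E * _).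
by rewrite mulrCA -expRD dir_exponent expRD mulrA.
Qed.

End dirichlet.

(** * Asymptotic equivalence with relative error 1/L *)

Section near1.
Context {R : realType}.
Implicit Types f g : R -> R.

(** Quantified form of [f L = 1 + O(1 / L)]; the conditions on [K] and [L0] are normalizations that
    spare sign checks. *)
Definition near1 f : Prop :=
  exists K L0 : R, [/\ 0 <= K, 1 <= L0 & forall L, L0 <= L -> `|f L - 1| <= K / L].

Lemma near1_eq f g : (exists L0 : R, forall L, L0 <= L -> f L = g L) ->
  near1 f -> near1 g.
Proof.
move=> [M fg] [K [L0 [K0 L01 H]]].
exists K, (Num.max M L0); split=> // [|L]; first by rewrite le_max L01 orbT.
by rewrite ge_max => /andP[/fg <- /H].
Qed.

Lemma near1_perturb f g : near1 f ->
  (exists K L0 : R, forall L, L0 <= L -> `|g L - f L| <= K / L) -> near1 g.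
Proof.
move=> [K [L0 [K0 L01 H]]] [K' [L0' H']].
exists (K + `|K'|), (Num.max L0 L0'); split=> [||L]; first exact: addr_ge0.
  by rewrite le_max L01.
rewrite ge_max => /andP[h1 h2]; have L_gt0 : 0 < L by lra.
have -> : g L - 1 = (f L - 1) + (g L - f L) by ring.
apply: le_trans (ler_normD _ _) _; rewrite mulrDl lerD ?H//.
by apply: le_trans (H' _ h2) _; rewrite ler_wpM2r ?invr_ge0 ?ler_norm// ltW.
Qed.

Lemma near1_cst : near1 (fun=> 1).
Proof. by exists 0, 1; split=> // L _; rewrite subrr normr0 mul0r. Qed.

Lemma near1_le2 f : near1 f -> exists L0 : R, forall L, L0 <= L -> 2^-1 <= f L <= 2.
Proof.
move=> [K [L0 [K0 L01 H]]]; exists (Num.max L0 (2 * K)) => L.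
rewrite ge_max => /andP[h1 h2]; have L_gt0 : 0 < L by lra.
have /ler_normlP[] : `|f L - 1| <= 2^-1.
  by apply: le_trans (H _ h1) _; rewrite ler_pdivrMr//; lra.
by move=> ? ?; apply/andP; split; lra.
Qed.

Lemma near1_mul f g : near1 f -> near1 g -> near1 (fun L => f L * g L).
Proof.
move=> nf ng; have [M2 B] := near1_le2 nf; apply: (near1_perturb nf).
case: ng => K [L0 [K0 L01 H]]; exists (2 * K), (Num.max L0 M2) => L.
rewrite ge_max => /andP[h1 h2]; have /andP[b1 b2] := B _ h2.
have L_gt0 : 0 < L by lra.
have -> : f L * g L - f L = f L * (g L - 1) by ring.
rewrite normrM -mulrA; apply: ler_pM => //; last exact: H.
by rewrite ger0_norm//; lra.
Qed.

Lemma near1_inv f : near1 f -> near1 (fun L => (f L)^-1).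
Proof.
move=> nf; have [M2 B] := near1_le2 nf; apply: (near1_perturb near1_cst).
case: nf => K [L0 [K0 L01 H]]; exists (2 * K), (Num.max L0 M2) => L.
rewrite ge_max => /andP[h1 h2]; have /andP[b1 b2] := B _ h2.
have f_gt0 : 0 < f L by lra.
have -> : (f L)^-1 - 1 = (f L)^-1 * (1 - f L) by field; rewrite gt_eqF.
rewrite normrM -mulrA; apply: ler_pM => //; last by rewrite distrC; exact: H.
by rewrite gtr0_norm ?invr_gt0// -[leRHS]invrK lef_pV2 ?posrE.
Qed.

Lemma near1_prod (I : Type) (s : seq I) (f : I -> R -> R) :
  (forall i, near1 (f i)) -> near1 (fun L => \prod_(i <- s) f i L).
Proof.
move=> nf; elim: s => [|i s IH].
  by apply: (near1_eq _ near1_cst); exists 0 => L _; rewrite big_nil.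
by apply: (near1_eq _ (near1_mul (nf i) IH)); exists 0 => L _; rewrite big_cons.
Qed.

Lemma near1_scale (c : R) f : 0 < c -> near1 f -> near1 (fun L => f (c * L)).
Proof.
move=> c0 [K [L0 [K0 L01 H]]]; exists (K / c), (Num.max 1 (L0 / c)); split.
- by rewrite divr_ge0// ltW.
- by rewrite le_max lexx.
- move=> L; rewrite ge_max ler_pdivrMr// mulrC => /andP[L1 h].
  by apply: le_trans (H _ h) _; rewrite invfM mulrA.
Qed.

Lemma near1_shift (c : R) f : near1 f -> near1 (fun L => f (L + c)).
Proof.
move=> [K [L0 [K0 L01 H]]].
exists (2 * K), (Num.max 1 (Num.max (L0 - c) (2 * `|c|))); split.
- exact: mulr_ge0.
- by rewrite le_max lexx.
- move=> L; rewrite !ge_max => /and3P[L1 h1 h2].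
  have nc := ler_norm (- c); rewrite normrN in nc.
  have h : L0 <= L + c by lra.
  have L_gt0 : 0 < L by lra.
  apply: le_trans (H _ h) _; rewrite ler_pdivrMr; last by lra.
  have h3 : 1 <= 2 * (L + c) / L by rewrite ler_pdivlMr//; lra.
  have -> : 2 * K / L * (L + c) = K * (2 * (L + c) / L) by ring.
  by rewrite ler_peMr.
Qed.

Lemma near1_exp (g : R -> R) :
  (exists K L0 : R, forall L, L0 <= L -> `|g L| <= K / L) ->
  near1 (fun L => expR (g L)).
Proof.
move=> [K [L0 H]]; apply: (near1_perturb near1_cst).
exists (2 * `|K|), (Num.max (Num.max 1 L0) (4 * `|K|)) => L.
rewrite !ge_max => /andP[/andP[L1 h1] h2].
have L_gt0 : 0 < L by lra.
have gK : `|g L| <= `|K| / L.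
  apply: le_trans (H _ h1) _.
  by rewrite ler_wpM2r ?invr_ge0 ?ler_norm// ltW.
have g4 : `|g L| <= 4^-1.
  by apply: le_trans gK _; rewrite ler_pdivrMr//; lra.
rewrite -mulrA; apply: le_trans (ler_wpM2l (ler0n _ 2) gK).
have := exp_tay_bound 1 (g L); rewrite /= expr0 fact0 divr1 add0r expr1 => /le_trans; apply.
by rewrite mulrC ler_wpM2r// expR_le2// (le_trans _ g4).
Qed.

Lemma near1_sqrt f : near1 f -> near1 (fun L => Num.sqrt (f L)).
Proof.
move=> nf; have [M2 B] := near1_le2 nf; apply: (near1_perturb near1_cst).
case: nf => K [L0 [K0 L01 H]]; exists K, (Num.max L0 M2) => L.
rewrite ge_max => /andP[h1 h2]; have /andP[b1 b2] := B _ h2.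
apply: le_trans (H _ h1).
have s0 := sqrtr_ge0 (f L).
have -> : f L - 1 = (Num.sqrt (f L) - 1) * (Num.sqrt (f L) + 1).
  by rewrite -subr_sqr sqr_sqrtr ?expr1n//; lra.
by rewrite normrM ler_peMr// ger0_norm; lra.
Qed.

Lemma near1_ratio (c : R) : near1 (fun L => L / (L + c)).
Proof.
apply: (near1_perturb near1_cst); exists (2 * `|c|), (1 + 2 * `|c|) => L hL.
have nc := ler_norm (- c); rewrite normrN in nc; have c0 := normr_ge0 c.
have L0 : 0 < L by lra.
have Lc : 0 < L + c by lra.
have -> : L / (L + c) - 1 = - (c / (L + c)) by field; rewrite gt_eqF.
rewrite normrN normrM normfV (gtr0_norm Lc) ler_pdivrMr//.
rewrite mulrAC ler_pdivlMr//; nra.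
Qed.

End near1.

(** * First-order expansion of the constrained integral *)

Section dirichlet_pointwise.
Context {R : realType}.
Variables (m : nat) (beta : 'I_m.+1 -> R).
Hypotheses (beta_gt0 : forall i, 0 < beta i).

Local Notation w0 := (\sum_i beta i).

Let w0_gt0' : 0 < w0.
Proof.
rewrite big_ord_recl; apply: ltr_wpDr => //.
by apply: sumr_ge0 => i _; exact: ltW.
Qed.

Variable l : m.+1.-tuple R.

Let H : R := \sum_i hexp (tnth l i).
Let lbar : R := (\sum_i beta i * tnth l i) / w0.

Lemma sum_hexp_ge0 : 0 <= H.
Proof. by apply: sumr_ge0 => i _; exact: hexp_ge0. Qed.

Lemma hexp_le_sum i : hexp (tnth l i) <= H.
Proof.
by rewrite /H (bigD1 i)//= lerDl; apply: sumr_ge0 => j _; exact: hexp_ge0.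
Qed.

Lemma sqr_tnth_le i : tnth l i ^+ 2 <= 8 * (H + H ^+ 2).
Proof.
apply: le_trans (sqr_le_hexp _) _; rewrite ler_pM2l//.
by rewrite lerD ?hexp_le_sum// lerXn2r ?nnegrE ?hexp_ge0 ?sum_hexp_ge0 ?hexp_le_sum.
Qed.

(** Common bound for the coordinates and their mean, of order [sqrt H] for small [H] and [H] for
    large [H]. *)
Let tau := Num.sqrt (8 * (H + H ^+ 2)).

Let tau2 : tau ^+ 2 = 8 * (H + H ^+ 2).
Proof.
rewrite sqr_sqrtr//; have H0 := sum_hexp_ge0.
by rewrite mulr_ge0// addr_ge0// sqr_ge0.
Qed.

Let tau0 : 0 <= tau. Proof. exact: sqrtr_ge0. Qed.

Lemma abs_tnth_le i : `|tnth l i| <= tau.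
Proof.
rewrite -(@ler_pXn2r _ 2)// ?nnegrE//.
by rewrite tau2 real_normK ?num_real//; exact: sqr_tnth_le.
Qed.

Lemma abs_mean_le : `|lbar| <= tau.
Proof.
rewrite /lbar normrM normfV (gtr0_norm w0_gt0') ler_pdivrMr//.
apply: le_trans (ler_norm_sum _ _ _) _; rewrite mulr_sumr; apply: ler_sum => i _.
by rewrite normrM (gtr0_norm (beta_gt0 i)) mulrC ler_wpM2r ?abs_tnth_le// ltW.
Qed.

Let sum_pos : 0 < \sum_i beta i * expR (tnth l i).
Proof.
rewrite big_ord_recl; apply: ltr_wpDr; last by rewrite mulr_gt0 ?expR_gt0.
by apply: sumr_ge0 => i _; rewrite mulr_ge0 ?expR_ge0// ltW.
Qed.

(** Jensen's inequality gives the lower bound. For the upper one, the mean of [exp l_i] is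
    [1 + lbar] plus a mean of [hexp l_i], hence at most [1 + lbar + H <= exp (lbar + H)]. So
    [log_mean] is linear up to an error of second order. *)
Lemma log_mean_bounds : 0 <= log_mean beta l - lbar <= H.
Proof.
rewrite subr_ge0 lerBlDr; apply/andP; split.
- rewrite -ler_expR /log_mean lnK; last by rewrite posrE divr_gt0.
  rewrite ler_pdivlMr//.
  have -> : expR lbar * w0 = \sum_i beta i * (expR lbar * (1 + (tnth l i - lbar))).
    have E : \sum_i beta i * (tnth l i - lbar) = 0.
      under eq_bigr do rewrite mulrBr; rewrite sumrB -mulr_suml.
      by rewrite /lbar mulrCA divff ?gt_eqF// mulr1 subrr.
    transitivity (\sum_i (expR lbar * beta i +
        expR lbar * (beta i * (tnth l i - lbar)))).
      by rewrite big_split/= -!mulr_sumr E mulr0 addr0.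
    by apply: eq_bigr => i _; ring.
  apply: ler_sum => i _; rewrite ler_wpM2l ?(ltW (beta_gt0 i))//.
  rewrite -[X in _ <= expR X](subrKC lbar) expRD ler_wpM2l ?expR_ge0//.
  exact: expR_ge1Dx.
- rewrite -ler_expR /log_mean lnK; last by rewrite posrE divr_gt0.
  apply: le_trans (expR_ge1Dx _).
  rewrite ler_pdivrMr// mulrDl mul1r mulrDl /lbar divfK ?gt_eqF//.
  have -> : \sum_i beta i * expR (tnth l i) = w0 + (\sum_i beta i * hexp (tnth l i) +
      \sum_i beta i * tnth l i).
    rewrite -!big_split/=; apply: eq_bigr => i _; rewrite /hexp; ring.
  rewrite lerD2l lerD2r /H mulr_suml; apply: ler_sum => i _.
  rewrite mulrC ler_wpM2l ?hexp_ge0// (bigD1 i)//= lerDl.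
  by apply: sumr_ge0 => j _; exact: ltW.
Qed.

Variable e : R.
Hypothesis e0 : 0 <= e.

Let v := dir_map beta e l.

Lemma sqr_dir_map_le i : tnth v i ^+ 2 <= 100 * (H + H ^+ 2 + e ^+ 2).
Proof.
have H0 := sum_hexp_ge0; have H2 := sqr_ge0 H; have e2 := sqr_ge0 e.
have l0 := abs_tnth_le ord0; have li := abs_tnth_le i.
have ab := abs_mean_le; have /andP[b0 b1] := log_mean_bounds.
have t2 := tau2; have t0 := tau0.
(* [x] is a difference of two quantities bounded by [tau], [y] a nonnegative excess;
   [(x + y)^2 <= 2 x^2 + 2 y^2] yields at most [64 (H + H^2) + 4 H^2 + 4 e^2]. *)
have key (x y : R) : `|x| <= 2 * tau -> 0 <= y <= H + e ->
    (x + y) ^+ 2 <= 100 * (H + H ^+ 2 + e ^+ 2).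
  move=> hx /andP[y0 hy].
  have x2 : x ^+ 2 <= 4 * tau ^+ 2.
    rewrite -[x ^+ 2]real_normK ?num_real//.
    have -> : 4 * tau ^+ 2 = (2 * tau) ^+ 2 by ring.
    by rewrite lerXn2r ?nnegrE// mulr_ge0.
  have y2 : y ^+ 2 <= 2 * H ^+ 2 + 2 * e ^+ 2.
    apply: (@le_trans _ _ ((H + e) ^+ 2)); last by have := sqr_ge0 (H - e); lra.
    by rewrite lerXn2r ?nnegrE// addr_ge0.
  have xy : (x + y) ^+ 2 <= 2 * x ^+ 2 + 2 * y ^+ 2 by have := sqr_ge0 (x - y); lra.
  by rewrite t2 in x2; lra.
rewrite /v tnth_mktuple; case: ifP => _.
- have -> : log_mean beta l - tnth l ord0 + e =
    (lbar - tnth l ord0) + ((log_mean beta l - lbar) + e) by ring.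
  apply: key; last by rewrite addr_ge0// lerD2r.
  by apply: le_trans (ler_normB _ _) _; rewrite mulr_natl mulr2n lerD.
- rewrite -[X in X ^+ 2]addr0; apply: key; last by rewrite lexx addr_ge0.
  by apply: le_trans (ler_normB _ _) _; rewrite mulr_natl mulr2n lerD.
Qed.

(** Coefficients in [l] of [dot c (dir_map beta e l)] after [log_mean] is replaced by the weighted
    mean of [l], and [e] by 0. *)
Definition dir_lin (c : 'I_m.+1 -> R) (i : 'I_m.+1) : R :=
  c ord0 * beta i / w0 + (if i == ord0 then - \sum_j c j else c i).

Lemma dir_linE (c : 'I_m.+1 -> R) :
  dot c v - dot (dir_lin c) l = c ord0 * (log_mean beta l - lbar + e).
Proof.
rewrite {2}/dot /dir_lin.
under [X in _ - X]eq_bigr do rewrite mulrDl.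
rewrite big_split/=.
have -> : \sum_(i < m.+1) c ord0 * beta i / w0 * tnth l i = c ord0 * lbar.
  rewrite /lbar mulrA mulr_sumr mulr_suml; apply: eq_bigr => i _.
  by rewrite -!mulrA; congr (_ * (_ * _)); rewrite mulrC.
have -> : dot c v = c ord0 * (log_mean beta l + e) +
    \sum_(i < m) c (lift ord0 i) * tnth l (lift ord0 i) - (\sum_j c j) * tnth l ord0.
  rewrite /dot big_ord_recl /v tnth_mktuple/=.
  under eq_bigr do rewrite tnth_mktuple/= mulrBr.
  rewrite sumrB -mulr_suml [in RHS]big_ord_recl; ring.
rewrite [in X in _ - X]big_ord_recl eqxx.
have -> : \sum_(i < m) (if lift ord0 i == ord0 then - \sum_j c j
    else c (lift ord0 i)) * tnth l (lift ord0 i) =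
  \sum_(i < m) c (lift ord0 i) * tnth l (lift ord0 i) by apply: eq_bigr.
ring.
Qed.

Lemma dot_le_hexp (d : 'I_m.+1 -> R) :
  dot d l <= (\sum_i `|d i|) * (2 + 2 * H).
Proof.
rewrite /dot mulr_suml; apply: ler_sum => i _.
apply: le_trans (ler_norm _) _; rewrite normrM ler_wpM2l//.
by apply: le_trans (abs_le_hexp _) _; rewrite lerD2l ler_pM2l// hexp_le_sum.
Qed.

End dirichlet_pointwise.

Section exp_diff.
Context {R : realType}.

Lemma expR_diff_le (x y : R) : `|expR x - expR y| <= `|x - y| * (expR x + expR y).
Proof.
have one (a b : R) : b <= a -> expR a - expR b <= (a - b) * expR a.
  move=> ba; have := @expR_ge1Dx R (b - a).
  rewrite expRD expRN -ler_pdivrMr ?invr_gt0 ?expR_gt0// invrK; nra.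
have ex := expR_ge0 x; have ey := expR_ge0 y.
have [xy|yx] := leP x y.
  rewrite distrC ger0_norm ?subr_ge0 ?ler_expR// distrC ger0_norm ?subr_ge0//.
  apply: le_trans (one _ _ xy) _; rewrite ler_wpM2l ?subr_ge0//; lra.
rewrite ger0_norm ?subr_ge0 ?ler_expR ?(ltW yx)// ger0_norm ?subr_ge0 ?(ltW yx)//.
apply: le_trans (one _ _ (ltW yx)) _; rewrite ler_wpM2l ?subr_ge0 ?(ltW yx)//; lra.
Qed.

(** Source of the factor [1 / lam] in the error: with [y = t * x], both [x] and [x ^+ 2] are at most
    [1 / t] times a power of [y], and [exp y] absorbs these with constants 1 and 2. *)
Lemma poly_exp_decay (t x : R) : 1 <= t -> 0 <= x ->
  (x + x ^+ 2) * expR (- t * x) <= 3 / t.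
Proof.
move=> t1 x0; have t0 : 0 < t by lra.
have y0 : 0 <= t * x by rewrite mulr_ge0// ltW.
have y1 := expr_le_exp 1 y0; have y2 := expr_le_exp 2 y0.
rewrite mulNr expRN ler_pdivrMr ?expR_gt0//.
have ex := expR_ge0 (t * x); have tx : 0 <= t^-1 by rewrite invr_ge0 ltW.
have ti : t^-1 <= 1 by rewrite invf_le1.
have -> : x + x ^+ 2 = t^-1 * (t * x) ^+ 1 + t^-1 * (t^-1 * (t * x) ^+ 2).
  by field; rewrite gt_eqF.
have -> : 3 / t * expR (t * x) = t^-1 * (3 * expR (t * x)) by ring.
rewrite -mulrDr ler_wpM2l//.
move: y1 y2; rewrite !factS fact0 !muln1/= => y1 y2.
have : t^-1 * (t * x) ^+ 2 <= (t * x) ^+ 2 by rewrite ler_piMl// sqr_ge0.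
lra.
Qed.

End exp_diff.

(** * Exponentially tilted Laplace integrals *)

Section gamma_asymptotics.
Context {R : realType}.
Local Notation leb := (@lebesgue_measure R).
Local Open Scope ereal_scope.

Lemma laplace_near1 : exists2 g : R -> R, near1 g & forall a : R, (1 <= a)%R ->
  \int[leb]_u (expR (- a * hexp u))%:E = (Num.sqrt (pi *+ 2 / a) * g a)%:E.
Proof.
have [C HC] := @laplace_integral R.
pose g (a : R) := (fine (\int[leb]_u (expR (- a * hexp u))%:E) / Num.sqrt (pi *+ 2 / a))%R.
have s0 (a : R) : (1 <= a)%R -> (0 < Num.sqrt (pi *+ 2 / a))%R.
  move=> a1; rewrite sqrtr_gt0; apply: divr_gt0; last lra.
  by apply: mulrn_wgt0; exact: pi_gt0.
exists g => [|a a1].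
  exists `|C|%R, 1%R; split=> // a a1; have [r [E rC]] := HC a a1.
  rewrite /g E/= mulrAC divff ?gt_eqF ?s0// mul1r addrC addKr.
  apply: le_trans rC _; apply: ler_wpM2r; last exact: ler_norm.
  by rewrite invr_ge0; lra.
have [r [E rC]] := HC a a1.
by rewrite /g E/=; congr (_%:E); field; rewrite gt_eqF ?s0.
Qed.

(** Up to elementary factors this is [Gamma(a + c)]. The translation by [ln (1 + c / a)] absorbs the
    tilt [exp (c * u)] and turns the parameter [a] into [a + c], so the tilt causes no error of
    order [1 / sqrt a]. The prefactor is harmless because
    [(a + c) * ln (1 + c / a) = c + O(1 / a)]. *)
Lemma gamma_near1 (c : R) : exists2 f : R -> R, near1 f &
  exists a0 : R, forall a : R, (a0 <= a)%R ->
  \int[leb]_u (expR (c * u) * expR (- a * hexp u))%:E = (Num.sqrt (pi *+ 2 / a) * f a)%:E.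
Proof.
have [g ng Hg] := laplace_near1.
pose s (a : R) := ln (1 + c / a)%R.
exists (fun a => expR ((a + c) * s a - c) * Num.sqrt (a / (a + c)) * g (a + c)%R)%R.
  apply: near1_mul; last exact: near1_shift.
  apply: near1_mul; last by apply: near1_sqrt; exact: near1_ratio.
  apply: near1_exp; exists (c ^+ 2)%R, (1 + `|c|)%R => a ha.
  have nc := ler_norm (- c)%R; rewrite normrN in nc; have c0 := normr_ge0 c.
  have a0 : (0 < a)%R by lra.
  have ac : (0 < a + c)%R by lra.
  have E : (1 + c / a = (a + c) / a)%R by field; rewrite gt_eqF.
  have q : (0 < 1 + c / a)%R by rewrite E divr_gt0.
  have u1 : (s a <= c / a)%R by rewrite -ler_expR lnK ?posrE// expR_ge1Dx.
  have u2 : (- s a <= a / (a + c) - 1)%R.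
    rewrite /s -lnV ?posrE// E invf_div.
    rewrite -ler_expR lnK ?posrE ?divr_gt0//.
    by apply: le_trans (expR_ge1Dx _); rewrite subrKC.
  have v1 : ((a + c) * s a <= (a + c) * (c / a))%R by rewrite ler_pM2l.
  have v2 : ((a + c) * - s a <= (a + c) * (a / (a + c) - 1))%R by rewrite ler_pM2l.
  have w1 : ((a + c) * (c / a) = c + c ^+ 2 / a)%R by field; rewrite gt_eqF.
  have w2 : ((a + c) * (a / (a + c) - 1) = - c)%R by field; rewrite gt_eqF.
  have w3 : (0 <= c ^+ 2 / a)%R by rewrite divr_ge0 ?sqr_ge0 ?ltW.
  rewrite w1 in v1; rewrite w2 mulrN in v2.
  by rewrite ler_norml; apply/andP; split; lra.
exists (2 + `|c|)%R => a ha.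
have nc := ler_norm (- c)%R; rewrite normrN in nc; have c0 := normr_ge0 c.
have a0 : (0 < a)%R by lra.
have ac : (0 < a + c)%R by lra.
have ac1 : (1 <= a + c)%R by lra.
have E : (1 + c / a = (a + c) / a)%R by field; rewrite gt_eqF.
have q : (0 < 1 + c / a)%R by rewrite E divr_gt0.
have es : expR (s a) = ((a + c) / a)%R by rewrite /s lnK ?posrE// E.
have mF : measurable_fun [set: R] (fun u : R => (expR (c * u) * expR (- a * hexp u))%:E).
  apply/measurable_EFinP; apply: measurable_funM; last exact: measurable_exp_hexp.
  by apply: measurableT_comp => //; exact: measurable_funM.
have F0 (u : R) : 0 <= (expR (c * u) * expR (- a * hexp u))%:E.
  by rewrite lee_fin mulr_ge0 ?expR_ge0.
rewrite -(ge0_integral_shift (s a) mF F0).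
under eq_integral => u _.
  have -> : (expR (c * (u + s a)) * expR (- a * hexp (u + s a)) =
      expR ((a + c) * s a - c) * expR (- (a + c) * hexp u))%R.
    have h1 : (expR (u + s a) = expR u * ((a + c) / a))%R by rewrite expRD es.
    rewrite -!expRD /hexp h1; congr expR.
    by field; rewrite gt_eqF.
  rewrite EFinM; over.
have mh : measurable_fun [set: R] (fun u : R => (expR (- (a + c) * hexp u))%:E).
  by apply/measurable_EFinP; exact: measurable_exp_hexp.
have h0 (u : R) : 0 <= (expR (- (a + c) * hexp u))%:E by rewrite lee_fin expR_ge0.
have e0 : 0 <= (expR ((a + c) * s a - c))%:E by rewrite lee_fin expR_ge0.
rewrite (ge0_integralZl leb measurableT mh (fun u _ => h0 u) e0) Hg// -EFinM.
have p0 : (0 <= pi *+ 2 / a :> R)%R.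
  by apply: divr_ge0; [apply: mulrn_wge0; exact: pi_ge0|exact: ltW].
have -> : Num.sqrt (pi *+ 2 / (a + c))%R =
    (Num.sqrt (pi *+ 2 / a) * Num.sqrt (a / (a + c)))%R.
  by rewrite -sqrtrM//; congr Num.sqrt; field; rewrite !gt_eqF.
by congr (_%:E); ring.
Qed.

Lemma integral_half_exp (k : R) : (0 < k)%R ->
  \int[leb]_e ((0 <= e)%R%:R * expR (- k * e))%:E = (k^-1)%:E.
Proof.
move=> k0.
have mE : measurable_fun [set: R] (fun u : R => (exponential_pdf k u)%:E).
  by apply/measurable_EFinP; exact: measurable_exponential_pdf.
have E0 (u : R) : 0 <= (exponential_pdf k u)%:E.
  by rewrite lee_fin; apply: exponential_pdf_ge0; exact: ltW.
have k0' : 0 <= (k^-1)%:E by rewrite lee_fin invr_ge0 ltW.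
rewrite -[RHS]mule1 -(integral_exponential_pdf k0).
apply: etrans; last exact: (ge0_integralZl leb measurableT mE (fun u _ => E0 u) k0').
apply: eq_integral => e _; rewrite -EFinM; congr (_%:E).
have [e0|e0] := leP 0%R e.
  by rewrite (exponential_pdfE _ e0) mul1r mulrA mulVf ?mul1r// gt_eqF.
by rewrite (lt0_exponential_pdf _ e0) mul0r mulr0.
Qed.

Lemma integral_half_exp_prod m (k : R) (phi : 'I_m -> R -> R) : (0 < k)%R ->
  (forall i, measurable_fun [set: R] (phi i)) -> (forall i x, 0 <= phi i x)%R ->
  \int[(lebn m \x leb)]_p
    (((0 <= p.2)%R%:R * expR (- k * p.2)) * \prod_(i < m) phi i (tnth p.1 i))%:E =
  (k^-1)%:E * \prod_(i < m) \int[leb]_x (phi i x)%:E.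
Proof.
move=> k0 mphi phi0.
have mprod : measurable_fun setT (fun t : m.-tuple R => (\prod_(i < m) phi i (tnth t i))%R).
  elim: (index_enum _) => [|i s IHs].
    by under eq_fun do rewrite big_nil; exact: measurable_cst.
  under eq_fun do rewrite big_cons; apply: measurable_funM => //.
  by apply: (measurableT_comp (mphi i)); exact: measurable_tnth.
have prod0 (t : m.-tuple R) : (0 <= \prod_(i < m) phi i (tnth t i))%R.
  by apply: prodr_ge0.
have mh : measurable_fun [set: R] (fun e : R => ((0 <= e)%R%:R * expR (- k * e))%R).
  apply: measurable_funM; first exact: measurable_ler_cst.
  by apply: measurableT_comp => //; exact: measurable_funM.
have h0 (e : R) : (0 <= (0 <= e)%R%:R * expR (- k * e))%R by rewrite mulr_ge0 ?expR_ge0.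
rewrite fubini_tonelli1; last 2 first.
- apply/measurable_EFinP; apply: measurable_funM.
    by apply: (measurableT_comp mh).
  by apply: (measurableT_comp mprod).
- by move=> p; rewrite lee_fin mulr_ge0.
transitivity (\int[lebn m]_t ((k^-1)%:E * (\prod_(i < m) phi i (tnth t i))%R%:E)).
  apply: eq_integral => t _; rewrite /fubini_F/=.
  under eq_integral do rewrite EFinM.
  have mh' : measurable_fun [set: R] (fun e : R => ((0 <= e)%R%:R * expR (- k * e))%:E).
    exact/measurable_EFinP.
  have h0' (e : R) : 0 <= ((0 <= e)%R%:R * expR (- k * e))%:E by rewrite lee_fin.
  have p0' : 0 <= (\prod_(i < m) phi i (tnth t i))%R%:E by rewrite lee_fin.
  rewrite (ge0_integralZr leb measurableT mh' (fun e _ => h0' e) p0').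
  by rewrite integral_half_exp.
rewrite ge0_integralZl//; last 3 first.
- exact/measurable_EFinP.
- by move=> t _; rewrite lee_fin.
- by rewrite lee_fin invr_ge0 ltW.
congr (_ * _); under eq_integral do rewrite -prodEFin.
rewrite (integral_lebn_prod (f := fun i x => (phi i x)%:E))//.
by move=> i; exact/measurable_EFinP.
Qed.

End gamma_asymptotics.

(** * Asymptotics of the constrained integral *)

Section dirichlet_asymptotics.
Context {R : realType}.
Local Notation leb := (@lebesgue_measure R).
Variables (m : nat) (beta : 'I_m.+1 -> R).
Hypotheses (beta1 : beta ord0 = 1) (beta_gt0 : forall i, 0 < beta i).

Local Notation w0 := (\sum_i beta i).

Variables (z : m.+1.-tuple R -> R) (c : 'I_m.+1 -> R) (M : R).
Hypotheses (mz : measurable_fun setT z) (M0 : 0 <= M) (zM : forall v, z v <= M)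
  (zc : forall v, `|z v - dot c v| <= M * \sum_i tnth v i ^+ 2).

Local Notation d := (dir_lin beta c).
Local Notation hsum l := (\sum_i hexp (tnth l i)).

Lemma pos_family_lb n (f : 'I_n -> R) : (forall i, 0 < f i) ->
  exists2 delta, 0 < delta & forall i, delta <= f i.
Proof.
move=> f0; pose s := \sum_i (f i)^-1.
have s0 : 0 <= s by apply: sumr_ge0 => i _; rewrite invr_ge0 ltW.
exists (1 + s)^-1 => [|i]; first by rewrite invr_gt0; lra.
rewrite -[leRHS]invrK lef_pV2 ?posrE ?invr_gt0//; last by lra.
rewrite /s (bigD1 i)//=; have : 0 <= \sum_(j < n | j != i) (f j)^-1.
  by apply: sumr_ge0 => j _; rewrite invr_ge0 ltW.
lra.
Qed.

(** [sqr_dir_map_le] controls the quadratic remainder of [z], and [log_mean_bounds] the nonlinearity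
    of the change of variables. *)
Lemma dir_lin_error : exists2 K : R, 0 <= K & forall (l : m.+1.-tuple R) (e : R), 0 <= e ->
  `|z (dir_map beta e l) - dot d l| <=
  K * ((e + e ^+ 2) + (hsum l + hsum l ^+ 2)).
Proof.
exists (M * (m.+1%:R * 100) + `|c ord0|) => [|l e e0].
  by rewrite addr_ge0// mulr_ge0.
have H0 := @sum_hexp_ge0 _ _ l.
set H := \sum_i _ in H0 *; set v := dir_map beta e l.
have e2 := sqr_ge0 e; have H2 := sqr_ge0 H.
have E := @dir_linE _ _ beta l e c.
have /andP[b0 b1] := log_mean_bounds beta_gt0 l.
set a := (\sum_i _) / w0 in E b0 b1.
have -> : z v - dot d l = (z v - dot c v) + c ord0 * (log_mean beta l - a + e).
  by rewrite -E; ring.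
apply: le_trans (ler_normD _ _) _; rewrite mulrDl lerD//.
- apply: le_trans (zc v) _; rewrite -mulrA ler_wpM2l//.
  apply: (@le_trans _ _ (\sum_(i < m.+1) (100 * (H + H ^+ 2 + e ^+ 2)))).
    by apply: ler_sum => i _; exact: sqr_dir_map_le.
  rewrite sumr_const card_ord -[leLHS]mulr_natl -mulrA ler_wpM2l//.
  by rewrite ler_wpM2l//; lra.
- rewrite normrM ler_wpM2l//.
  rewrite ger0_norm; last by rewrite addr_ge0.
  by move: b1; rewrite -/H; lra.
Qed.

Lemma dir_exp_error : exists K C : R, [/\ 0 <= K, 0 <= C &
  forall (l : m.+1.-tuple R) (e : R), 0 <= e ->
  `|expR (z (dir_map beta e l)) - expR (dot d l)| <=
  K * ((e + e ^+ 2) + (hsum l + hsum l ^+ 2)) * expR (C * hsum l)].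
Proof.
have [K K0 HK] := dir_lin_error.
pose D := \sum_i `|d i|; have D0 : 0 <= D by apply: sumr_ge0.
exists (K * (expR M + expR (2 * D))), (2 * D); split.
- by rewrite mulr_ge0// addr_ge0// expR_ge0.
- by rewrite mulr_ge0.
move=> l e e0; apply: le_trans (expR_diff_le _ _) _.
have H0 := @sum_hexp_ge0 _ _ l.
set H := \sum_i _ in H0 *.
have K' := HK l e e0.
set Q := (e + e ^+ 2) + _ in K' *.
have -> : K * (expR M + expR (2 * D)) * Q * expR (2 * D * H) =
  (K * Q) * ((expR M + expR (2 * D)) * expR (2 * D * H)) by ring.
apply: ler_pM; [exact: normr_ge0 | by rewrite addr_ge0 ?expR_ge0 | exact: K' |].
rewrite mulrDl lerD//.
- apply: (@le_trans _ _ (expR M)); first by rewrite ler_expR.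
  rewrite -[leLHS]mulr1 ler_wpM2l ?expR_ge0// -[leLHS]expR0 ler_expR.
  by rewrite mulr_ge0// mulr_ge0.
- rewrite -expRD ler_expR; apply: le_trans (dot_le_hexp _ _) _.
  by rewrite -/D -/H; lra.
Qed.

Definition dir_weight (lam : R) (p : m.+1.-tuple R * R) : R :=
  (0 <= p.2)%R%:R * expR (- (lam * w0) * p.2) *
  expR (- lam * \sum_i beta i * hexp (tnth p.1 i)).

Let w00 : 0 < w0 := w0_gt0 beta_gt0.

(** The weight at [lam] is the weight at [lam / 2] times another such half. The second half beats
    [exp (C * H)] and turns the polynomial error into [O(1 / lam)]; the first remains for
    integration. *)
Lemma dir_weight_error : exists K lam0 : R, [/\ 0 <= K, 1 <= lam0 &
  forall (lam : R) p, lam0 <= lam ->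
  `|dir_weight lam p * expR (z (dir_map beta p.2 p.1)) -
    dir_weight lam p * expR (dot d p.1)| <= K / lam * dir_weight (lam / 2) p].
Proof.
have [K [C [K0 C0 HK]]] := dir_exp_error.
have [delta delta0 Hdelta] := pos_family_lb beta_gt0.
(* The threshold ensures [lam * w0 / 2 >= 1], [lam * delta / 4 >= 1] and [lam * delta / 4 >= C]. The
   error constants are the [3] of [poly_exp_decay] divided by [w0 / 2] and by [delta / 4]. *)
exists (K * (6 / w0 + 12 / delta)), (1 + 2 / w0 + (4 / delta) * (1 + C)); split.
- by rewrite mulr_ge0// addr_ge0// divr_ge0// ltW.
- have : 0 <= 2 / w0 by rewrite divr_ge0// ltW.
  have : 0 <= (4 / delta) * (1 + C) by rewrite mulr_ge0 ?addr_ge0// divr_ge0// ltW.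
  by lra.
move=> lam [l e] hlam /=.
have q1 : 0 <= 2 / w0 by rewrite divr_ge0// ltW.
have q2 : 0 <= 4 / delta by rewrite divr_ge0// ltW.
have q3 : 0 <= (4 / delta) * C by rewrite mulr_ge0.
have lam_gt0 : 0 < lam by lra.
have h1 : 1 <= lam * w0 / 2.
  have : 2 / w0 <= lam by lra.
  by rewrite ler_pdivrMr//; lra.
have h2 : 1 <= lam * delta / 4.
  have : 4 / delta <= lam by lra.
  by rewrite ler_pdivrMr//; lra.
have h3 : C <= lam * delta / 4.
  have : 4 * C / delta <= lam by lra.
  by rewrite ler_pdivrMr//; lra.
rewrite -mulrBr normrM.
have wge0 la : 0 <= dir_weight la (l, e) by rewrite /dir_weight !mulr_ge0 ?expR_ge0.
rewrite (ger0_norm (wge0 _)).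
have [e0|e0] := leP 0 e; last first.
  by rewrite /dir_weight/= (leNgt 0 e) e0/= !mul0r mulr0.
have := HK l e e0.
have H0 := @sum_hexp_ge0 _ _ l.
set H := \sum_i hexp _ in H0 *; set X := `|_ - _| => HX.
pose S := \sum_i beta i * hexp (tnth l i).
have HS : delta * H <= S.
  rewrite /H /S mulr_sumr; apply: ler_sum => i _.
  by rewrite ler_wpM2r ?hexp_ge0.
have -> : dir_weight lam (l, e) =
    dir_weight (lam / 2) (l, e) * (expR (- (lam * w0 / 2) * e) * expR (- (lam / 2) * S)).
  rewrite /dir_weight/= e0 !mul1r -/S -!expRD; congr expR; by field.
rewrite -[leLHS]mulrA [leLHS]mulrC; apply: ler_wpM2r; first exact: wge0.
rewrite [leLHS]mulrC.
apply: (@le_trans _ _ (K * (e + e ^+ 2 + (H + H ^+ 2)) * expR (C * H) *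
    (expR (- (lam * w0 / 2) * e) * expR (- (lam * delta / 2) * H)))).
  apply: ler_pM; [exact: normr_ge0 | by rewrite mulr_ge0 ?expR_ge0 | exact: HX |].
  apply: ler_wpM2l; first exact: expR_ge0.
  rewrite ler_expR !mulNr lerN2.
  have -> : lam * delta / 2 * H = lam / 2 * (delta * H) by ring.
  by apply: ler_wpM2l => //; rewrite divr_ge0// ltW.
have eE : expR (C * H) * expR (- (lam * delta / 2) * H) <= expR (- (lam * delta / 4) * H).
  rewrite -expRD ler_expR; have : C * H <= lam * delta / 4 * H by rewrite ler_wpM2r.
  by lra.
have d1 := poly_exp_decay h1 e0; have d2 := poly_exp_decay h2 H0.
have x1 : expR (- (lam * w0 / 2) * e) <= 1.
  by rewrite -[leRHS]expR0 ler_expR mulNr oppr_le0 mulr_ge0//; lra.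
have x2 : expR (- (lam * delta / 4) * H) <= 1.
  by rewrite -[leRHS]expR0 ler_expR mulNr oppr_le0 mulr_ge0//; lra.
set E1 := expR (- (lam * w0 / 2) * e) in d1 x1 *.
set E2 := expR (- (lam * delta / 4) * H) in d2 x2 eE *.
have E10 : 0 <= E1 by exact: expR_ge0.
have E20 : 0 <= E2 by exact: expR_ge0.
have ee : 0 <= e + e ^+ 2 by rewrite addr_ge0// sqr_ge0.
have HH : 0 <= H + H ^+ 2 by rewrite addr_ge0// sqr_ge0.
have -> : K * (e + e ^+ 2 + (H + H ^+ 2)) * expR (C * H) *
    (E1 * expR (- (lam * delta / 2) * H)) =
    K * ((e + e ^+ 2 + (H + H ^+ 2)) * E1 * (expR (C * H) * expR (- (lam * delta / 2) * H))).
  by ring.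
rewrite -[K * _ / lam]mulrA; apply: ler_wpM2l => //.
apply: (@le_trans _ _ ((e + e ^+ 2 + (H + H ^+ 2)) * E1 * E2)).
  by apply: ler_wpM2l => //; rewrite mulr_ge0// addr_ge0.
have k1 : (e + e ^+ 2) * E1 * E2 <= (e + e ^+ 2) * E1.
  by rewrite ler_piMr// mulr_ge0.
have k2 : (H + H ^+ 2) * E2 * E1 <= (H + H ^+ 2) * E2.
  by rewrite ler_piMr// mulr_ge0.
have -> : (6 / w0 + 12 / delta) / lam = 3 / (lam * w0 / 2) + 3 / (lam * delta / 4).
  by field; rewrite !gt_eqF.
by lra.
Qed.

Lemma measurable_dir_weight lam : measurable_fun setT (dir_weight lam).
Proof.
apply: measurable_funM.
  apply: measurable_funM; first exact: measurable_ler_cst.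
  by apply: measurableT_comp => //; exact: measurable_funM.
apply: measurableT_comp => //; apply: measurable_funM => //.
have := @measurable_lin _ _ beta (fun=> @hexp R) (fun=> measurable_hexp).
by move=> h; apply: (measurableT_comp h).
Qed.

Lemma dir_weight_ge0 lam p : 0 <= dir_weight lam p.
Proof. by rewrite /dir_weight !mulr_ge0 ?expR_ge0. Qed.

Lemma dir_weight_prod lam p : dir_weight lam p * expR (dot d p.1) =
  (0 <= p.2)%R%:R * expR (- (lam * w0) * p.2) *
  \prod_(i < m.+1) (expR (d i * tnth p.1 i) * expR (- (lam * beta i) * hexp (tnth p.1 i))).
Proof.
rewrite /dir_weight -mulrA; congr (_ * _).
rewrite -expRD mulr_sumr /dot -big_split/= expR_sum; apply: eq_bigr => i _.
by rewrite -expRD; congr expR; ring.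
Qed.

Lemma dir_weight_prod0 lam p : dir_weight lam p =
  (0 <= p.2)%R%:R * expR (- (lam * w0) * p.2) *
  \prod_(i < m.+1) expR (- (lam * beta i) * hexp (tnth p.1 i)).
Proof.
rewrite /dir_weight; congr (_ * _).
by rewrite mulr_sumr expR_sum; apply: eq_bigr => i _; congr expR; ring.
Qed.

(** The integral over the slack times the Gaussian leading terms of the one-dimensional Laplace
    integrals. *)
Definition dir_scale (lam : R) : R :=
  (lam * w0)^-1 * \prod_(i < m.+1) Num.sqrt (pi *+ 2 / (lam * beta i)).

Lemma dir_scale_gt0 lam : 0 < lam -> 0 < dir_scale lam.
Proof.
move=> l0; rewrite mulr_gt0 ?invr_gt0 ?mulr_gt0//; apply: prodr_gt0 => i _.
by rewrite sqrtr_gt0 divr_gt0 ?mulr_gt0// mulrn_wgt0// pi_gt0.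
Qed.

Local Open Scope ereal_scope.

Lemma dir_linear_asymp : exists2 f : R -> R, near1 f &
  exists lam0 : R, forall lam : R, (lam0 <= lam)%R ->
  \int[(lebn m.+1 \x leb)]_p (dir_weight lam p * expR (dot d p.1))%:E =
  (dir_scale lam * f lam)%:E.
Proof.
pose P i (f : R -> R) := near1 f /\ exists a0 : R, forall a : R, (a0 <= a)%R ->
  \int[leb]_u (expR (d i * u) * expR (- a * hexp u))%:E = (Num.sqrt (pi *+ 2 / a) * f a)%:E.
have /choice[f Pf] : forall i, exists f, P i f.
  by move=> i; have [f nf Hf] := gamma_near1 (d i); exists f.
exists (fun lam => \prod_(i < m.+1) f i (beta i * lam))%R.
  by apply: near1_prod => i; apply: near1_scale => //; exact: (Pf i).1.
have /choice[a Ha] : forall i, exists a0 : R, forall a : R, (a0 <= a)%R ->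
    \int[leb]_u (expR (d i * u) * expR (- a * hexp u))%:E =
    (Num.sqrt (pi *+ 2 / a) * f i a)%:E.
  by move=> i; exact: (Pf i).2.
exists (1 + \sum_i (`|a i| / beta i))%R => lam hlam.
have sum0 : (0 <= \sum_i (`|a i| / beta i))%R.
  by apply: sumr_ge0 => i _; rewrite divr_ge0// ltW.
have lam0 : (0 < lam)%R by lra.
have ha i : (a i <= lam * beta i)%R.
  rewrite -ler_pdivrMr//; apply: le_trans hlam.
  apply: (@le_trans _ _ (`|a i| / beta i)%R).
    by rewrite ler_wpM2r ?invr_ge0 ?ler_norm// ltW.
  rewrite (bigD1 i)//= addrCA lerDl addr_ge0//.
  by apply: sumr_ge0 => j _; rewrite divr_ge0// ltW.
under eq_integral do rewrite dir_weight_prod.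
rewrite (integral_half_exp_prod (k := (lam * w0)%R)
  (phi := fun i x => expR (d i * x) * expR (- (lam * beta i) * hexp x))%R); last 3 first.
- by rewrite mulr_gt0.
- move=> i; apply: measurable_funM; last exact: measurable_exp_hexp.
  by apply: measurableT_comp => //; exact: measurable_funM.
- by move=> i x; rewrite mulr_ge0 ?expR_ge0.
rewrite (eq_bigr (fun i => (Num.sqrt (pi *+ 2 / (lam * beta i)) * f i (lam * beta i)%R)%:E));
  last by move=> i _; exact: Ha.
rewrite prodEFin -EFinM /dir_scale -mulrA -big_split/=; congr (_ * _)%:E.
by apply: eq_bigr => i _; rewrite (mulrC lam).
Qed.

(** Halving [lam] multiplies [dir_scale] by the constant [2 * sqrt 2 ^+ m.+1], so the integrated
    error keeps the order of the main term; the last factor 2 bounds the product of corrections. *)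
Lemma dir_weight_half : exists2 C : R, (0 <= C)%R &
  exists lam0 : R, forall lam : R, (lam0 <= lam)%R ->
  \int[(lebn m.+1 \x leb)]_p (dir_weight (lam / 2) p)%:E <= (C * dir_scale lam)%:E.
Proof.
have [g ng Hg] := @laplace_near1 R.
have ngp : near1 (fun lam => \prod_(i < m.+1) g (beta i / 2 * lam))%R.
  by apply: near1_prod => i; apply: near1_scale => //; rewrite divr_gt0.
have [lam1 Hl1] := near1_le2 ngp.
exists (2 * Num.sqrt 2 ^+ m.+1 * 2)%R; first by rewrite !mulr_ge0 ?exprn_ge0 ?sqrtr_ge0.
exists (Num.max lam1 (1 + \sum_i (2 / beta i)))%R => lam.
rewrite ge_max => /andP[h1 hlam].
have sum0 : (0 <= \sum_i (2 / beta i))%R.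
  by apply: sumr_ge0 => i _; rewrite divr_ge0// ltW.
have lam0 : (0 < lam)%R by lra.
have ha i : (1 <= lam / 2 * beta i)%R.
  have : (2 / beta i <= lam)%R.
    apply: le_trans hlam; rewrite (bigD1 i)//= addrCA lerDl addr_ge0//.
    by apply: sumr_ge0 => j _; rewrite divr_ge0// ltW.
  by rewrite ler_pdivrMr//; lra.
under eq_integral do rewrite dir_weight_prod0.
rewrite (integral_half_exp_prod (k := (lam / 2 * w0)%R)
  (phi := fun i x => expR (- (lam / 2 * beta i) * hexp x))%R); last 3 first.
- by rewrite mulr_gt0// divr_gt0.
- by move=> i; exact: measurable_exp_hexp.
- by move=> i x; exact: expR_ge0.
rewrite (eq_bigr (fun i => (Num.sqrt (pi *+ 2 / (lam / 2 * beta i)) * g (lam / 2 * beta i)%R)%:E));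
  last by move=> i _; exact: Hg.
rewrite prodEFin -EFinM lee_fin /dir_scale.
have -> : (\prod_(i < m.+1) (Num.sqrt (pi *+ 2 / (lam / 2 * beta i)) * g (lam / 2 * beta i)) =
  Num.sqrt 2 ^+ m.+1 * \prod_(i < m.+1) Num.sqrt (pi *+ 2 / (lam * beta i)) *
  \prod_(i < m.+1) g (beta i / 2 * lam))%R.
  rewrite big_split/=; congr (_ * _)%R; last first.
    by apply: eq_bigr => i _; congr g; ring.
  rewrite -[X in (_ ^+ X)%R](card_ord m.+1) -prodr_const -big_split/=; apply: eq_bigr => i _.
  by rewrite -sqrtrM//; congr Num.sqrt; field; rewrite !gt_eqF.
have /andP[g1 g2] := Hl1 _ h1.
set G := (\prod_(i < m.+1) g _)%R in g1 g2 *; set S := (\prod_(i < m.+1) Num.sqrt _)%R.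
have S0 : (0 <= S)%R by apply: prodr_ge0 => i _; exact: sqrtr_ge0.
have -> : ((lam / 2 * w0)^-1 * (Num.sqrt 2 ^+ m.+1 * S * G) =
   (2 * Num.sqrt 2 ^+ m.+1 * ((lam * w0)^-1 * S)) * G)%R.
  by field; rewrite !gt_eqF.
have -> : (2 * Num.sqrt 2 ^+ m.+1 * 2 * ((lam * w0)^-1 * S) =
  (2 * Num.sqrt 2 ^+ m.+1 * ((lam * w0)^-1 * S)) * 2)%R by ring.
apply: ler_wpM2l => //.
by rewrite !mulr_ge0 ?exprn_ge0 ?sqrtr_ge0// invr_ge0 mulr_ge0// ltW.
Qed.

(** By [dir_weight_error], the right side of [dirichlet_transform] with [F = exp z] has the
    asymptotics of its version with [z] linearized; dividing by the auxiliary Laplace integral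
    isolates the integral sought. *)
Theorem dirichlet_asymp : exists2 f : R -> R, near1 f &
  exists lam0 : R, forall lam : R, (lam0 <= lam)%R ->
  \int[lebn m.+1]_v
    (((1 <= dir_sum beta v)%R%:R * expR (- lam * dot (dir_w beta) v)) * expR (z v))%:E =
  (dir_scale lam / Num.sqrt (pi *+ 2 / (lam * w0)) * f lam)%:E.
Proof.
have [f1 nf1 [l1 H1]] := dir_linear_asymp.
have [C C0 [l2 H2]] := dir_weight_half.
have [K [l3 [K0 l31 H3]]] := dir_weight_error.
have [g ng Hg] := @laplace_near1 R.
pose A lam := \int[(lebn m.+1 \x leb)]_p (dir_weight lam p * expR (z (dir_map beta p.2 p.1)))%:E.
pose fA lam := (fine (A lam) / dir_scale lam)%R.
have mA lam : measurable_fun setT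
    (fun p => (dir_weight lam p * expR (z (dir_map beta p.2 p.1)))%:E).
  apply/measurable_EFinP; apply: measurable_funM; first exact: measurable_dir_weight.
  apply: measurableT_comp => //.
  exact: (measurableT_comp mz (measurable_dir_map beta)).
have mB lam : measurable_fun setT
    (fun p : m.+1.-tuple R * R => (dir_weight lam p * expR (dot d p.1))%:E).
  apply/measurable_EFinP; apply: measurable_funM; first exact: measurable_dir_weight.
  apply: measurableT_comp => //.
  by apply: (measurableT_comp (measurable_dot d)).
have mC lam (k : R) : measurable_fun setT (fun p => (k * dir_weight lam p)%:E).
  by apply/measurable_EFinP; apply: measurable_funM => //; exact: measurable_dir_weight.
have A0 lam p : 0 <= (dir_weight lam p * expR (z (dir_map beta p.2 p.1)))%:E.
  by rewrite lee_fin mulr_ge0 ?dir_weight_ge0 ?expR_ge0.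
have B0 lam (p : m.+1.-tuple R * R) : 0 <= (dir_weight lam p * expR (dot d p.1))%:E.
  by rewrite lee_fin mulr_ge0 ?dir_weight_ge0 ?expR_ge0.
have bnd lam : (Num.max l1 (Num.max l2 l3) <= lam)%R ->
    [/\ A lam = (dir_scale lam * fA lam)%:E & (`|fA lam - f1 lam| <= K * C / lam)%R].
  rewrite !ge_max => /and3P[h1 h2 h3]; have lam0 : (0 < lam)%R by lra.
  have s0 := dir_scale_gt0 lam0.
  have kl : (0 <= K / lam)%R by rewrite divr_ge0// ltW.
  have C0' lam' p : 0 <= (K / lam * dir_weight lam' p)%:E.
    by rewrite lee_fin mulr_ge0 ?dir_weight_ge0.
  have Ierr : \int[(lebn m.+1 \x leb)]_p (K / lam * dir_weight (lam / 2) p)%:E <=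
      (K / lam * (C * dir_scale lam))%:E.
    under eq_integral do rewrite EFinM.
    rewrite ge0_integralZl//; last 2 first.
    - by apply/measurable_EFinP; exact: measurable_dir_weight.
    - by move=> p _; rewrite lee_fin dir_weight_ge0.
    rewrite (EFinM (K / lam)%R (C * _)%R).
    by apply: lee_wpmul2l; [rewrite lee_fin | exact: H2].
  have U1 : A lam <= (dir_scale lam * f1 lam)%:E + (K / lam * (C * dir_scale lam))%:E.
    rewrite -H1//; apply: le_trans (leeD2l _ Ierr).
    rewrite -ge0_integralD//; [|exact: mB|exact: mC].
    apply: ge0_le_integral => //; [exact: mA|exact: (emeasurable_funD (mB _) (mC _ _))|].
    move=> p _; rewrite -EFinD lee_fin.
    by have := H3 lam p h3; rewrite ler_norml => /andP[_]; lra.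
  have U2 : (dir_scale lam * f1 lam)%:E <= A lam + (K / lam * (C * dir_scale lam))%:E.
    rewrite -H1//; apply: le_trans (leeD2l _ Ierr).
    rewrite /A -ge0_integralD//; [|exact: mA|exact: mC].
    apply: ge0_le_integral => //; [exact: mB|exact: (emeasurable_funD (mA _) (mC _ _))|].
    move=> p _; rewrite -EFinD lee_fin.
    by have := H3 lam p h3; rewrite ler_norml => /andP[+ _]; lra.
  have : A lam \is a fin_num.
    rewrite ge0_fin_numE; last by apply: integral_ge0.
    by apply: le_lt_trans U1 _; rewrite -EFinD ltry.
  move=> /fineK aE; have sfA : (dir_scale lam * fA lam = fine (A lam))%R.
    by rewrite /fA mulrC divfK// gt_eqF.
  rewrite sfA aE; split=> //.
  move: U1 U2; rewrite -aE -!EFinD !lee_fin -sfA.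
  have -> : (K / lam * (C * dir_scale lam) = dir_scale lam * (K * C / lam))%R by ring.
  rewrite -!mulrDr !ler_pM2l// => U1 U2.
  by rewrite ler_norml; apply/andP; split; lra.
have nfA : near1 fA.
  apply: (near1_perturb nf1); exists (K * C)%R, (Num.max l1 (Num.max l2 l3)) => lam h.
  by have [] := bnd lam h.
exists (fun lam => fA lam * (g (w0 * lam))^-1)%R.
  by apply: near1_mul => //; apply: near1_inv; exact: near1_scale.
have [l4 Hl4] := near1_le2 (near1_scale w00 ng).
exists (Num.max (Num.max l1 (Num.max l2 l3)) (Num.max l4 (w0^-1)%R)) => lam.
rewrite ge_max => /andP[hA]; rewrite ge_max => /andP[h4 hw].
have lam0 : (0 < lam)%R by apply: lt_le_trans hw; rewrite invr_gt0.
have hw1 : (1 <= lam * w0)%R by rewrite -ler_pdivrMr// div1r.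
have [AE _] := bnd lam hA.
have mez : measurable_fun setT (fun v : m.+1.-tuple R => (expR (z v))%:E).
  by apply/measurable_EFinP; exact: measurableT_comp.
have := @dirichlet_transform R m beta beta1 beta_gt0 lam (fun v => (expR (z v))%:E) lam0 mez
   (fun v => expR_ge0 _).
set J := \int[lebn m.+1]_v _.
have -> : \int[lebn m.+1]_l \int[leb]_e
    (((0 <= e)%R%:R * expR (- (lam * w0) * e) *
      expR (- lam * \sum_i beta i * hexp (tnth l i)))%:E *
     (expR (z (dir_map beta e l)))%:E) = A lam.
  by rewrite /A fubini_tonelli1//; exact: mA.
rewrite AE Hg//.
have /andP[g1 g2] := Hl4 lam h4.
rewrite (mulrC lam).
set gl := g _ in g1 g2 *.
have s0 : (0 < Num.sqrt (pi *+ 2 / (w0 * lam)))%R.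
  by rewrite sqrtr_gt0 divr_gt0 ?mulr_gt0// mulrn_wgt0// pi_gt0.
set s := Num.sqrt _ in s0 *.
have gl0 : (0 < gl)%R by lra.
have sg0 : (0 < s * gl)%R by rewrite mulr_gt0.
move=> HJ.
(* Finiteness of [J] is deduced here, a positive multiple of it being finite. *)
case: J HJ => [r| |].
- rewrite -EFinM => -[HJ]; congr (_%:E).
  have -> : r = (s * gl * r / (s * gl))%R by rewrite mulrAC divff ?mul1r// gt_eqF.
  by rewrite HJ; field; rewrite !gt_eqF.
- by rewrite gt0_muley ?lte_fin.
- by rewrite gt0_muleNy ?lte_fin.
Qed.

End dirichlet_asymptotics.

(** * The Gaussian vector on the support *)

Section qform_bilinear.
Context {R : realType}.

Lemma qformDl n (B : 'M[R]_n) (u v w : 'rV[R]_n) :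
  qform B (u + v) w = qform B u w + qform B v w.
Proof. by rewrite /qform !mulmxDl mxE. Qed.

Lemma qformDr n (B : 'M[R]_n) (u v w : 'rV[R]_n) :
  qform B w (u + v) = qform B w u + qform B w v.
Proof. by rewrite /qform linearD/= mulmxDr mxE. Qed.

Lemma qformZl n (B : 'M[R]_n) (a : R) (u v : 'rV[R]_n) :
  qform B (a *: u) v = a * qform B u v.
Proof. by rewrite /qform -!scalemxAl mxE. Qed.

Lemma qformZr n (B : 'M[R]_n) (a : R) (u v : 'rV[R]_n) :
  qform B u (a *: v) = a * qform B u v.
Proof. by rewrite /qform linearZ/= -scalemxAr mxE. Qed.

Lemma qform_expand n (B : 'M[R]_n) (u v : 'rV[R]_n) (a : R) : B^T = B ->
  qform B (u + a *: v) (u + a *: v) =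
  qform B u u + 2 * a * qform B u v + a ^+ 2 * qform B v v.
Proof.
move=> sB; rewrite !(qformDl, qformDr, qformZl, qformZr) (qform_sym v u sB).
ring.
Qed.

Lemma invmx_sym n (B : 'M[R]_n) : B^T = B -> (invmx B)^T = invmx B.
Proof. by move=> sB; rewrite trmx_inv sB. Qed.

Lemma qform_inv_ge0 n (B : 'M[R]_n) (u : 'rV[R]_n) : posdef B ->
  0 <= qform (invmx B) u u.
Proof.
move=> pB; have [sB pos] := pB; have Bu := posdef_unit pB.
have -> : qform (invmx B) u u = qform B (u *m invmx B) (u *m invmx B).
  by rewrite /qform trmx_mul (invmx_sym sB) mulmxKV// mulmxA.
by have [->|/pos/ltW//] := eqVneq (u *m invmx B) 0; rewrite /qform !mul0mx mxE.
Qed.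

Lemma qform_abs_le n (B : 'M[R]_n) (u : 'rV[R]_n) :
  `|qform B u u| <= (\sum_i \sum_j `|B i j|) * \sum_i u 0 i ^+ 2.
Proof.
rewrite qformE; apply: le_trans (ler_norm_sum _ _ _) _; rewrite mulr_suml.
apply: ler_sum => i _; apply: le_trans (ler_norm_sum _ _ _) _; rewrite mulr_suml.
apply: ler_sum => j _.
have si k : u 0 k ^+ 2 <= \sum_i u 0 i ^+ 2.
  by rewrite (bigD1 k)//= lerDl; apply: sumr_ge0 => ? _; exact: sqr_ge0.
have := si i; have := si j; set s := \sum_i _ => hj hi.
have -> : u 0 i * B i j * u 0 j = B i j * (u 0 i * u 0 j) by ring.
rewrite normrM ler_wpM2l// ler_norml; apply/andP; split.
  by have := sqr_ge0 (u 0 i + u 0 j); lra.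
by have := sqr_ge0 (u 0 i - u 0 j); lra.
Qed.

End qform_bilinear.

Lemma measurable_set_ge {R : realType} d (T : measurableType d) (c : R) (f : T -> R) :
  measurable_fun setT f -> measurable [set x | c <= f x].
Proof.
move=> mf; rewrite (_ : [set x | _] = setT `&` f @^-1` `[c, +oo[).
  exact: mf (measurable_itv _).
by apply/seteqP; split=> x /=; rewrite in_itv/= andbT => // -[].
Qed.

Section gaussian_laplace.
Context {R : realType}.
Variables (n m : nat) (sigma : 'I_m.+1 -> 'I_n.+1) (mu : 'rV[R]_n.+1)
  (B : 'M[R]_n.+1) (w : 'I_m.+1 -> R).
Local Notation Bb := (Bbar sigma B).
Local Notation Q := (abar sigma B).
Local Notation S := (Sbar sigma B).
Local Notation Lb := (Lbar sigma mu B).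
Hypotheses (pB : posdef Bb) (S0 : 0 < S)
  (AE : forall i, Abar sigma B i = S * w i) (w0 : 0 < w ord0)
  (wneg : forall i, i != ord0 -> w i < 0) (w1 : \sum_i w i = 1).

Definition sign0 k (i : 'I_k.+1) : R := if i == ord0 then 1 else -1.

Let beta (i : 'I_m.+1) : R := if i == ord0 then 1 else - w i.

Let beta1 : beta ord0 = 1. Proof. by rewrite /beta eqxx. Qed.

Let beta_gt0 i : 0 < beta i.
Proof. by rewrite /beta; case: eqVneq => // i0; rewrite oppr_gt0 wneg. Qed.

Let beta_sum : \sum_i beta i = w ord0.
Proof.
have := w1; rewrite (bigD1 ord0)//= => E.
rewrite (bigD1 ord0)//= beta1.
have -> : \sum_(i < m.+1 | i != ord0) beta i = - \sum_(i < m.+1 | i != ord0) w i.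
  by rewrite -sumrN; apply: eq_bigr => i i0; rewrite /beta (negbTE i0).
by lra.
Qed.

Let dir_wE i : dir_w beta i = w i.
Proof.
rewrite /dir_w beta_sum /beta; case: eqVneq => [->//|i0]; first by rewrite opprK.
Qed.

Let wn0 i : w i != 0.
Proof. by have [->|i0] := eqVneq i ord0; [rewrite gt_eqF|rewrite lt_eqF// wneg]. Qed.

Definition Lrow : 'rV[R]_m.+1 := \row_i Lb i.

(** The part of the Gaussian exponent free of [L], up to an additive constant. *)
Let z (v : m.+1.-tuple R) : R :=
  qform Q (trow v) Lrow - 2^-1 * qform Q (trow v) (trow v).

Let c (i : 'I_m.+1) : R := \sum_j Q i j * Lb j.

Let qLdot v : qform Q (trow v) Lrow = dot c v.
Proof.
rewrite qformE /dot; apply: eq_bigr => i _; rewrite /c mulr_suml.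
by apply: eq_bigr => j _; rewrite !mxE; ring.
Qed.

Let mz : measurable_fun setT z.
Proof.
apply: measurable_funB.
  by under eq_fun do rewrite qLdot; exact: measurable_dot.
by apply: measurable_funM => //; exact: measurable_qform.
Qed.

Let symQ : Q^T = Q. Proof. by apply: invmx_sym; case: pB. Qed.

(** Completing the square: the maximum is attained at [v = Lrow]. *)
Let z_le v : z v <= 2^-1 * qform Q Lrow Lrow.
Proof.
have := qform_inv_ge0 (trow v + (-1) *: Lrow) pB.
rewrite -/(abar sigma B) qform_expand// /z; lra.
Qed.

Let K := \sum_i \sum_j `|Q i j|.
Let M := 2^-1 * (qform Q Lrow Lrow + K).

Let K0 : 0 <= K.
Proof. by apply: sumr_ge0 => i _; apply: sumr_ge0. Qed.

Let L0 : 0 <= qform Q Lrow Lrow.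
Proof. exact: qform_inv_ge0. Qed.

Let z_quad v : `|z v - dot c v| <= M * \sum_i tnth v i ^+ 2.
Proof.
rewrite /z qLdot addrAC subrr sub0r normrN normrM ger0_norm ?invr_ge0//.
rewrite /M -mulrA ler_wpM2l ?invr_ge0//.
apply: le_trans (qform_abs_le _ _) _.
have -> : \sum_i trow v 0 i ^+ 2 = \sum_i tnth v i ^+ 2.
  by apply: eq_bigr => i _; rewrite mxE.
rewrite ler_wpM2r ?lerDr//; apply: sumr_ge0 => i _; exact: sqr_ge0.
Qed.

(** Since [Lb i] is [mu - ln |w_i|], adding the mean back to a shifted coordinate gives
    [L + ln |w_i| + v_i]. *)
Let s (L : R) : m.+1.-tuple R := [tuple L - Lb i | i < m.+1].

Let trow_shift L v : trow (tadd (s L) v) = trow v + (-1) *: Lrow + L *: const_mx 1.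
Proof. by apply/rowP => i; rewrite !mxE !tnth_mktuple; ring. Qed.

(** [AE] says that [Q] maps the all-ones vector to [S * w]; hence the exponent couples [L] and [v]
    only through [w . v], as in [dirichlet_asymp]. *)
Let qform1 (u : 'rV[R]_m.+1) : qform Q u (const_mx 1) = S * \sum_i w i * u 0 i.
Proof.
rewrite qformE mulr_sumr; apply: eq_bigr => i _.
transitivity (u 0 i * \sum_j Q i j).
  by rewrite mulr_sumr; apply: eq_bigr => j _; rewrite [X in _ * X = _]mxE mulr1.
by have := AE i; rewrite /Abar => ->; ring.
Qed.

Let gdens_shift L v : gdens Bb (tadd (s L) v) =
  ((Num.sqrt (pi *+ 2)) ^- m.+1 * (Num.sqrt (\det Bb))^-1 *
   expR (- 2^-1 * S * L ^+ 2 + L * (S * \sum_i w i * Lb i) - 2^-1 * qform Q Lrow Lrow)) *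
  (expR (- (L * S) * dot (dir_w beta) v) * expR (z v)).
Proof.
rewrite /gdens trow_shift -[RHS]mulrA; congr (_ * _).
rewrite -!expRD; congr expR.
rewrite -/(abar sigma B) !qform_expand// !(qformDl, qformZl) !qform1.
have -> : \sum_i w i * (trow v) 0 i = dot (dir_w beta) v.
  by apply: eq_bigr => i _; rewrite dir_wE mxE.
have -> : \sum_i w i * Lrow 0 i = \sum_i w i * Lb i.
  by apply: eq_bigr => i _; rewrite mxE.
have -> : \sum_i w i * (const_mx 1 : 'rV[R]_m.+1) 0 i = 1.
  by rewrite -[RHS]w1; apply: eq_bigr => i _; rewrite mxE mulr1.
by rewrite /z; field.
Qed.

Let event_shift L v :
  (expR L <= \sum_i sign0 i * expR (tnth (tadd (s L) v) i + mu 0 (sigma i))) =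
  (1 <= dir_sum beta v).
Proof.
have -> : \sum_i sign0 i * expR (tnth (tadd (s L) v) i + mu 0 (sigma i)) =
   expR L * dir_sum beta v.
  rewrite /dir_sum mulr_sumr; apply: eq_bigr => i _.
  rewrite dir_wE !tnth_mktuple /Lbar AE normrM (gtr0_norm S0).
  have -> : S / (S * `|w i|) = `|w i|^-1 by field; rewrite normr_eq0 wn0 gt_eqF.
  have wi0 : 0 < `|w i| by rewrite normr_gt0.
  rewrite lnV ?posrE//.
  have -> : tnth v i + (L - (- ln `|w i| + mu 0 (sigma i))) + mu 0 (sigma i) =
    L + (ln `|w i| + tnth v i) by ring.
  rewrite !expRD lnK ?posrE//.
  rewrite /sign0; case: (eqVneq i ord0) => [->|/wneg wi].
    by rewrite (gtr0_norm w0); ring.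
  by rewrite (ltr0_norm wi); ring.
by rewrite -[leLHS]mulr1 ler_pM2l ?expR_gt0.
Qed.

Let quadE : \sum_(i < m.+1) \sum_(k < m.+1) Q i k * Lb i * Lb k = qform Q Lrow Lrow.
Proof.
rewrite qformE; apply: eq_bigr => i _; apply: eq_bigr => j _.
by rewrite [Lrow 0 i]mxE [Lrow 0 j]mxE; ring.
Qed.

Lemma powR_half_opp (L : R) k : 0 < L ->
  L `^ (- ((1 + k%:R) / 2)) = (Num.sqrt L ^+ k.+1)^-1.
Proof.
move=> Lgt0; rewrite powRN; congr (_^-1).
have -> : (1 + k%:R) / 2 = 2^-1 * k.+1%:R :> R by rewrite -natr1; ring.
by rewrite powRrM powR12_sqrt ?ltW// powR_mulrn ?sqrtr_ge0.
Qed.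

(** Matches the closed form of the statement with the constants coming from [gdens_shift] and from
    [dir_scale] at [lam = L * S]. *)
Let main_coef L : 0 < L -> main_term sigma mu B (expR L) =
  ((Num.sqrt (pi *+ 2)) ^- m.+1 * (Num.sqrt (\det Bb))^-1 *
   expR (- 2^-1 * S * L ^+ 2 + L * (S * \sum_i w i * Lb i) - 2^-1 * qform Q Lrow Lrow)) *
  (dir_scale beta (L * S) / Num.sqrt (pi *+ 2 / ((L * S) * \sum_i beta i))).
Proof.
move=> Lgt0; rewrite /main_term expRK powR_half_opp// /Cconst quadE.
have -> : expR L `^ (\sum_i Abar sigma B i * Lb i) = expR (L * (S * \sum_i w i * Lb i)).
  rewrite /powR gt_eqF ?expR_gt0// expRK mulrC; congr (expR (_ * _)).
  by rewrite mulr_sumr; apply: eq_bigr => i _; rewrite AE mulrA.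
have -> : expR (- 2^-1 * S * L ^+ 2 + L * (S * \sum_i w i * Lb i) - 2^-1 * qform Q Lrow Lrow)
  = expR (- 2^-1 * S * L ^+ 2) * expR (L * (S * \sum_i w i * Lb i)) *
    expR (- 2^-1 * qform Q Lrow Lrow).
  by rewrite -!expRD; congr expR; ring.
set E1 := expR _; set E2 := expR _; set E3 := expR _.
have p2 : 0 < pi *+ 2 :> R by rewrite mulrn_wgt0// pi_gt0.
have dB := posdef_det_gt0 pB.
rewrite (sqrtrM _ (ltW p2)).
have -> : \prod_(i < m.+1) `|Abar sigma B i| = S ^+ m.+1 * (w ord0 * \prod_(i < m.+1) beta i).
  rewrite [X in _ = _ * (_ * X)](bigD1 ord0)//= beta1 mul1r.
  rewrite -[X in S ^+ X](card_ord m.+1) -prodr_const.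
  rewrite -[X in _ = _ * (X * _)](gtr0_norm w0).
  have -> : `|w ord0| * \prod_(i < m.+1 | i != ord0) beta i = \prod_(i < m.+1) `|w i|.
    rewrite [RHS](bigD1 ord0)//=; congr (_ * _); apply: eq_bigr => i i0.
    by rewrite /beta (negbTE i0) (ltr0_norm (wneg i0)).
  by rewrite -big_split/=; apply: eq_bigr => i _; rewrite AE normrM (gtr0_norm S0).
have Pb0 : 0 < \prod_(i < m.+1) beta i by apply: prodr_gt0.
set Pb := \prod_(i < m.+1) beta i in Pb0 *.
rewrite /dir_scale beta_sum.
have sqrtX (x : R) k : 0 <= x -> Num.sqrt (x ^+ k) = Num.sqrt x ^+ k.
  move=> x0; elim: k => [|k IH]; first by rewrite !expr0 sqrtr1.
  by rewrite !exprS sqrtrM// IH.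
have LS0 : 0 < L * S by rewrite mulr_gt0.
have sV (x : R) : 0 < x -> Num.sqrt (pi *+ 2 / x) = Num.sqrt (pi *+ 2) / Num.sqrt x.
  by move=> x0; rewrite (sqrtrM _ (ltW p2)) sqrtrV ?ltW.
have -> : \prod_(i < m.+1) Num.sqrt (pi *+ 2 / (L * S * beta i)) =
    Num.sqrt (pi *+ 2) ^+ m.+1 / (Num.sqrt L ^+ m.+1 * Num.sqrt S ^+ m.+1 * Num.sqrt Pb).
  have -> : Num.sqrt Pb = \prod_(i < m.+1) Num.sqrt (beta i).
    rewrite /Pb; elim/big_rec2: _ => [|i x1 x2 _ <-]; first by rewrite sqrtr1.
    by rewrite sqrtrM// ltW.
  have cst (x : R) : x ^+ m.+1 = \prod_(i < m.+1) x by rewrite prodr_const card_ord.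
  rewrite !cst -!big_split/= -prodf_div.
  apply: eq_bigr => i _; rewrite sV ?mulr_gt0// !sqrtrM ?mulr_ge0 ?ltW//.
rewrite sV ?mulr_gt0// (sqrtrM _ (ltW LS0)) (sqrtrM _ (ltW Lgt0)).
rewrite (sqrtrM _ (ltW S0)) sqrtrV; last by rewrite mulr_ge0 ?exprn_ge0 ?mulr_ge0 ?ltW.
rewrite (sqrtrM _ (exprn_ge0 _ (ltW S0))) (sqrtrM _ (ltW w0)) sqrtX ?ltW//.
have q0 (x : R) : 0 < x -> Num.sqrt x != 0 by move=> x0; rewrite gt_eqF// sqrtr_gt0.
(* [L], [S] and [w ord0] become squares of their roots, and the roots and their powers are
   generalized to nonzero atoms, so that [field] can conclude. *)
have lE : L = Num.sqrt L * Num.sqrt L by rewrite -expr2 sqr_sqrtr ?ltW.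
have sE : S = Num.sqrt S * Num.sqrt S by rewrite -expr2 sqr_sqrtr ?ltW.
have wE : w ord0 = Num.sqrt (w ord0) * Num.sqrt (w ord0) by rewrite -expr2 sqr_sqrtr ?ltW.
have lX := q0 _ Lgt0; have sX := q0 _ S0; have wX := q0 _ w0; have pX := q0 _ p2.
have bX := q0 _ Pb0; have dX := q0 _ dB.
rewrite !exprS.
move: (expf_neq0 m lX) (expf_neq0 m sX) (expf_neq0 m pX).
move: (Num.sqrt L ^+ m) (Num.sqrt S ^+ m) (Num.sqrt (pi *+ 2) ^+ m) => lm sm pm lm0 sm0 pm0.
move: (Num.sqrt L) (Num.sqrt S) (Num.sqrt (w ord0)) (Num.sqrt (pi *+ 2)) (Num.sqrt Pb)
  (Num.sqrt (\det Bb)) lX sX wX pX bX dX lE sE wE => l t p a q dt l0 t0 p0 a0 q0' d0 lE sE wE.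
rewrite lE sE wE; field.
by rewrite l0 t0 p0 a0 q0' d0 lm0 sm0 pm0.
Qed.

Lemma measurable_exceed L : measurable [set y : m.+1.-tuple R |
  expR L <= \sum_i sign0 i * expR (tnth y i + mu 0 (sigma i))].
Proof.
have mf : measurable_fun setT
    (fun y : m.+1.-tuple R => \sum_i sign0 i * expR (tnth y i + mu 0 (sigma i))).
  apply: measurable_sum => i; apply: measurable_funM => //.
  apply: measurableT_comp => //; apply: measurable_funD => //.
  exact: measurable_tnth.
exact: measurable_set_ge.
Qed.

Theorem gprob_asymp : exists2 f : R -> R, near1 f &
  exists L1 : R, forall L : R, L1 <= L ->
  gprob Bb [set y | expR L <= \sum_i sign0 i * expR (tnth y i + mu 0 (sigma i))] =
  (main_term sigma mu B (expR L) * f L)%:E.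
Proof.
have M0 : 0 <= M by rewrite /M mulr_ge0 ?addr_ge0 ?invr_ge0.
have zM v : z v <= M by apply: le_trans (z_le v) _; rewrite /M; move: K0; lra.
have [f nf [lam0 Hf]] := dirichlet_asymp beta1 beta_gt0 mz M0 zM z_quad.
exists (fun L => f (S * L)); first exact: near1_scale.
exists (Num.max 1 (lam0 / S)) => L; rewrite ge_max ler_pdivrMr// => /andP[L1 hL].
have Lgt0 : 0 < L by lra.
rewrite gprobE; last exact: measurable_exceed.
set A := [set y | _].
have mF : measurable_fun setT (fun y => ((\1_A y)%:E * (gdens Bb y)%:E)%E).
  apply: emeasurable_funM; last by apply/measurable_EFinP; exact: measurable_gdens.
  by apply/measurable_EFinP; apply: measurable_indic; exact: measurable_exceed.
have F0 y : (0 <= (\1_A y)%:E * (gdens Bb y)%:E)%E.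
  by rewrite mule_ge0// lee_fin ?gdens_ge0.
rewrite -(integral_lebn_shift (s L) mF F0).
rewrite main_coef//; set k := (_ * expR _).
have k0 : 0 <= k by rewrite !mulr_ge0 ?expR_ge0 ?invr_ge0 ?exprn_ge0 ?sqrtr_ge0.
pose G (v : m.+1.-tuple R) :=
  (((1 <= dir_sum beta v)%R%:R * expR (- (L * S) * dot (dir_w beta) v)) * expR (z v)).
have -> : (\int[lebn m.+1]_t ((\1_A (tadd (s L) t))%:E * (gdens Bb (tadd (s L) t))%:E) =
   \int[lebn m.+1]_v (k%:E * (G v)%:E))%E.
  apply: eq_integral => v _; rewrite gdens_shift -/k -!EFinM; congr (_%:E).
  have -> : \1_A (tadd (s L) v) = (1 <= dir_sum beta v)%R%:R :> R.
    rewrite -(event_shift L) indicE; congr (_%:R); congr nat_of_bool.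
    by apply/idP/idP; rewrite inE.
  by rewrite /G; ring.
have mG : measurable_fun setT (fun v => (G v)%:E).
  apply/measurable_EFinP; apply: measurable_funM; last exact: measurableT_comp.
  apply: measurable_funM.
    exact: (measurable_ler_cst _ (measurable_dir_sum beta)).
  by apply: measurableT_comp => //; apply: measurable_funM => //; exact: measurable_dot.
have G0 v : (0 <= (G v)%:E)%E by rewrite lee_fin !mulr_ge0 ?expR_ge0.
rewrite (ge0_integralZl (lebn m.+1) measurableT mG (fun v _ => G0 v)); last by rewrite lee_fin.
rewrite Hf; last exact: hL.
by rewrite -EFinM (mulrC S L) mulrA.
Qed.

End gaussian_laplace.

(** * The minimizer *)

Section minimizer.
Context {R : realType}.

(** If [qform B u t] were nonzero, a suitable multiple of [t] added to [u] would give the form the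
    value [-1], because it is affine along [t]. *)
Lemma psd_kernel n (B : 'M[R]_n) (t : 'rV[R]_n) : B^T = B ->
  (forall u, 0 <= qform B u u) -> qform B t t = 0 -> t *m B = 0.
Proof.
move=> sB psd t0.
have ort u : qform B u t = 0.
  apply/eqP/negPn/negP => ut.
  have := psd (u + (- (1 + qform B u u) / (2 * qform B u t)) *: t).
  rewrite qform_expand// t0 mulr0 addr0.
  have -> : 2 * (- (1 + qform B u u) / (2 * qform B u t)) * qform B u t =
    - (1 + qform B u u) by field.
  by lra.
apply/rowP => j; have := ort (delta_mx 0 j); rewrite (qform_sym _ _ sB).
rewrite /qform trmx_delta -colE !mxE; exact.
Qed.

Lemma psd_posdef n (B : 'M[R]_n) : B^T = B ->
  (forall u, 0 <= qform B u u) -> 0 < \det B -> posdef B.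
Proof.
move=> sB psd dB; split=> // t t0; rewrite lt_neqAle psd andbT eq_sym.
apply: contraNneq t0 => /(psd_kernel sB psd) tB.
have Bu : B \in unitmx by rewrite unitmxE unitfE gt_eqF.
by rewrite -(mulmxK Bu t) tB mul0mx.
Qed.

Lemma posdef_sub n m (B : 'M[R]_n) (sigma : 'I_m -> 'I_n) : injective sigma ->
  posdef B -> posdef (\matrix_(i, j) B (sigma i) (sigma j)).
Proof.
move=> inj [sB pos]; split.
  by apply/matrixP => i j; rewrite !mxE -[in LHS]sB mxE.
move=> t t0; pose E : 'M[R]_(m, n) := \matrix_(i, k) (k == sigma i)%:R.
have EE : (\matrix_(i, j) B (sigma i) (sigma j)) = E *m B *m E^T.
  have EB i k : (E *m B) i k = B (sigma i) k.
    rewrite mxE (bigD1 (sigma i))//= mxE eqxx mul1r big1 ?addr0// => l li.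
    by rewrite mxE (negbTE li) mul0r.
  apply/matrixP => i j; rewrite [RHS]mxE (bigD1 (sigma j))//= EB !mxE eqxx mulr1.
  by rewrite big1 ?addr0// => k kj; rewrite EB !mxE (negbTE kj) mulr0.
have -> : qform (\matrix_(i, j) B (sigma i) (sigma j)) t t = qform B (t *m E) (t *m E).
  by rewrite EE /qform trmx_mul !mulmxA.
apply: pos; apply: contraNneq t0 => /rowP tE; apply/eqP/rowP => i.
have := tE (sigma i); rewrite !mxE (bigD1 i)//= !mxE eqxx mulr1 big1 ?addr0// => k ki.
by rewrite !mxE (inj_eq inj) eq_sym (negbTE ki) mulr0.
Qed.

Lemma sum_inj n m (sigma : 'I_m -> 'I_n) (F : 'I_n -> R) : injective sigma ->
  (forall k, F k != 0 -> exists i, sigma i = k) ->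
  \sum_i F (sigma i) = \sum_k F k.
Proof.
move=> inj H.
rewrite [RHS](bigID (fun k => [exists i, sigma i == k]))/= [X in _ + X]big1 ?addr0.
  rewrite -(big_imset (A := 'I_m) F (in2W inj))/=.
  apply: eq_bigl => k; apply/imsetP/existsP => [[i _ ->]|[i /eqP <-]].
    by exists i.
  by exists i.
move=> k nk; apply/eqP/negPn/negP => /H[i ik]; case/negP: nk.
by apply/existsP; exists i; apply/eqP.
Qed.

Section kkt.
Variables (n : nat) (B : 'M[R]_n.+1) (w : 'rV[R]_n.+1).
Hypotheses (pB : posdef B) (wmin : is_simplex_minimizer B w).

Let sB : B^T = B. Proof. by case: pB. Qed.

(** Half the partial derivative of the quadratic form at [w]. *)
Definition grad k := qform B (delta_mx 0 k) w.

Let w_le0 k : k != ord0 -> w 0 k <= 0.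
Proof. by case: wmin => -[_ [h _]] _; exact: h. Qed.

Let w_sum : \sum_k w 0 k = 1. Proof. by case: wmin => -[_ []]. Qed.

Lemma simplex_head_ge1 : 1 <= w 0 ord0.
Proof.
have := w_sum; rewrite (bigD1 ord0)//=.
have : \sum_(i < n.+1 | i != ord0) w 0 i <= 0 by apply: sumr_le0 => i; exact: w_le0.
by lra.
Qed.

Let dir k : 'rV[R]_n.+1 := delta_mx 0 ord0 - delta_mx 0 k.

Let simplex_move k (a : R) : k != ord0 -> w 0 k <= a -> - 1 <= a ->
  simplex1 (w + a *: dir k).
Proof.
move=> k0 wa a1; have w1 := simplex_head_ge1.
have E i : (w + a *: dir k) 0 i = w 0 i + a * ((i == ord0)%:R - (i == k)%:R).
  by rewrite !mxE.
split; last split.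
- by rewrite E eqxx eq_sym (negbTE k0) mulr1n mulr0n; lra.
- move=> i i0; rewrite E (negbTE i0) mulr0n; have := w_le0 i0.
  by case: (eqVneq i k) => [->|_]; rewrite ?mulr1n ?mulr0n; lra.
- under eq_bigr do rewrite E; rewrite big_split/= w_sum -mulr_sumr big_split/= sumrN.
  have d j : \sum_(i < n.+1) (i == j)%:R = 1 :> R.
    by rewrite (bigD1 j)//= eqxx big1 ?addr0// => i /negbTE ->.
  by rewrite !d subrr mulr0 addr0.
Qed.

Let move_ge k (a : R) : k != ord0 -> w 0 k <= a -> - 1 <= a ->
  0 <= 2 * a * (grad ord0 - grad k) + a ^+ 2 * qform B (dir k) (dir k).
Proof.
move=> k0 wa a1; have [_ /(_ _ (simplex_move k0 wa a1))] := wmin.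
rewrite qform_expand// (qform_sym w _ sB) -addrA lerDl.
have -> : dir k = delta_mx 0 ord0 + (-1) *: delta_mx 0 k by rewrite scaleN1r.
by rewrite qformDl qformZl /grad mulN1r.
Qed.

(** First-order condition at an endpoint: if [b < 0], the step [a = min r (- b / (1 + |q|))] is too
    short for the quadratic term to compensate. *)
Let slope_ge0 (b q r : R) : 0 < r ->
  (forall a, 0 <= a <= r -> 0 <= 2 * a * b + a ^+ 2 * q) -> 0 <= b.
Proof.
move=> r0 H; rewrite leNgt; apply/negP => b0.
have q1 : 0 < 1 + `|q| by have := normr_ge0 q; lra.
pose a := Num.min r (- b / (1 + `|q|)).
have a0 : 0 < a by rewrite lt_min r0/= divr_gt0//; lra.
have ar : a <= r by rewrite ge_min lexx.
have aq : a * (1 + `|q|) <= - b by rewrite -ler_pdivlMr// ge_min lexx orbT.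
have := H a; rewrite (ltW a0) ar => /(_ isT).
have -> : 2 * a * b + a ^+ 2 * q = a * (2 * b + a * q) by ring.
rewrite pmulr_rge0//.
have : a * q <= a * `|q| by rewrite ler_pM2l// ler_norm.
have : a * `|q| <= - b - a by lra.
lra.
Qed.

(* Moving mass from [k] to the head ([w + a *: (e_0 - e_k)], [a >= 0]) stays in
   the simplex; when [w 0 k < 0] the opposite move is admissible as well. *)
Lemma grad_le k : grad k <= grad ord0.
Proof.
have [->//|k0] := eqVneq k ord0; rewrite -subr_ge0.
apply: (@slope_ge0 _ (qform B (dir k) (dir k)) 1) => // a /andP[a0 _].
by apply: move_ge => //; have := w_le0 k0; lra.
Qed.

Lemma grad_eq k : w 0 k != 0 -> grad k = grad ord0.
Proof.
have [->//|k0] := eqVneq k ord0 => wk; apply/le_anti; rewrite grad_le/=.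
have wk0 : w 0 k < 0 by rewrite lt_neqAle wk w_le0.
rewrite -subr_ge0.
apply: (@slope_ge0 _ (qform B (dir k) (dir k)) (Num.min 1 (- w 0 k))).
  by rewrite lt_min ltr01/= oppr_gt0.
move=> a /andP[a0]; rewrite le_min => /andP[a1 aw].
have wa : w 0 k <= - a by lra.
have a1' : -1 <= - a by lra.
by have := move_ge k0 wa a1'; rewrite sqrrN; lra.
Qed.

(** Complementary slackness: the gradient is constant on the support, and the weights sum to 1. *)
Lemma qform_grad : qform B w w = grad ord0.
Proof.
have -> : qform B w w = \sum_k w 0 k * grad k.
  rewrite qformE; apply: eq_bigr => i _; rewrite /grad qformE [X in _ = _ * X](bigD1 i)//=.
  rewrite [X in _ = _ * (_ + X)]big1 ?addr0; last first.
    by move=> j ji; rewrite big1// => l _; rewrite mxE eqxx (negbTE ji)/= !mul0r.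
  by rewrite mulr_sumr; apply: eq_bigr => j _; rewrite mxE !eqxx mul1r mulrA.
rewrite -[RHS]mul1r -w_sum mulr_suml; apply: eq_bigr => k _.
by have [->|/grad_eq->//] := eqVneq (w 0 k) 0; rewrite !mul0r.
Qed.

Lemma minimizer_qform_gt0 : 0 < qform B w w.
Proof.
have [_ pos] := pB; apply: pos; apply/eqP => w0.
by have := simplex_head_ge1; rewrite w0 mxE; lra.
Qed.

End kkt.
End minimizer.

(** * Row sums of the inverse covariance on the support *)

Section reduced.
Context {R : realType}.
Variables (n m : nat) (B : 'M[R]_n.+1) (w : 'rV[R]_n.+1) (sigma : 'I_m -> 'I_n.+1).
Hypotheses (pB : posdef B) (wmin : is_simplex_minimizer B w) (inj : injective sigma)
  (supp : forall k, w 0 k != 0 -> exists i, sigma i = k) (supp0 : forall i, w 0 (sigma i) != 0).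
Local Notation s := (qform B w w).

Let pBb : posdef (Bbar sigma B). Proof. exact: posdef_sub. Qed.

Let weights_Bbar : (\row_i w 0 (sigma i)) *m Bbar sigma B = s *: const_mx 1.
Proof.
apply/rowP => j; rewrite !mxE mulr1.
transitivity (grad B w (sigma j)); last by rewrite (grad_eq pB wmin)// qform_grad.
transitivity (\sum_k w 0 k * B k (sigma j)).
  rewrite -(@sum_inj _ _ _ sigma (fun k => w 0 k * B k (sigma j)))//.
    by apply: eq_bigr => i _; rewrite !mxE.
  by move=> k wk; apply: supp; apply: contraNneq wk => ->; rewrite mul0r.
have [sB _] := pB.
rewrite /grad (qform_sym _ _ sB) /qform trmx_delta -colE !mxE.
by apply: eq_bigr => i _.
Qed.

(** On the support the optimality conditions are the linear system [w *m Bbar = s *: 1]; inverting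
    it expresses the row sums of the inverse through [w], and so fixes their signs. *)
Lemma Abar_minimizer i : Abar sigma B i = s^-1 * w 0 (sigma i).
Proof.
have s0 := minimizer_qform_gt0 pB wmin.
have E : \row_i w 0 (sigma i) = s *: (const_mx 1 *m abar sigma B).
  by rewrite scalemxAl -weights_Bbar mulmxK//; exact: posdef_unit.
have := congr1 (fun u : 'rV_m => u 0 i) E; rewrite !mxE => ->.
rewrite mulKf ?gt_eqF//; apply: eq_bigr => j _; rewrite mxE mul1r.
have [sB _] := pBb; have := invmx_sym sB; rewrite -/(abar sigma B) => {1}<-.
by rewrite mxE.
Qed.

Lemma sum_support : \sum_i w 0 (sigma i) = 1.
Proof.
have [[_ [_ <-]] _] := wmin.
by rewrite (@sum_inj _ _ _ sigma (fun k => w 0 k)).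
Qed.

Lemma Sbar_minimizer : Sbar sigma B = s^-1.
Proof.
rewrite /Sbar; under eq_bigr do rewrite Abar_minimizer.
by rewrite -mulr_sumr sum_support mulr1.
Qed.

End reduced.

(** * Invariance of the main term under relabelling of the support *)

Section permutation.
Context {R : realType}.
Variables (n m : nat) (sigma : 'I_m -> 'I_n.+1) (mu : 'rV[R]_n.+1) (B : 'M[R]_n.+1)
  (p : 'S_m).
Hypothesis Bu : Bbar sigma B \in unitmx.
Local Notation sp := (sigma \o p).

Let permT (A : 'M[R]_m) : perm_mx p *m A *m (perm_mx p)^T = \matrix_(i, j) A (p i) (p j).
Proof.
by rewrite tr_perm_mx -row_permE -col_permE; apply/matrixP => i j; rewrite !mxE.
Qed.

Let BbarE : Bbar sp B = perm_mx p *m Bbar sigma B *m (perm_mx p)^T.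
Proof. by rewrite permT; apply/matrixP => i j; rewrite !mxE. Qed.

Let PPT : (perm_mx p)^T *m perm_mx p = 1%:M :> 'M[R]_m.
Proof. by rewrite tr_perm_mx -perm_mxM mulVg perm_mx1. Qed.

Let det_perm_bar : \det (Bbar sp B) = \det (Bbar sigma B).
Proof.
by rewrite BbarE !det_mulmx mulrAC -det_mulmx (mulmx1C PPT) det1 mul1r.
Qed.

Let abarE i j : abar sp B i j = abar sigma B (p i) (p j).
Proof.
have -> : abar sp B = perm_mx p *m abar sigma B *m (perm_mx p)^T.
  have Bu' : Bbar sp B \in unitmx by move: Bu; rewrite !unitmxE det_perm_bar.
  rewrite -[LHS]mulmx1.
  have <- : Bbar sp B *m (perm_mx p *m abar sigma B *m (perm_mx p)^T) = 1%:M.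
    rewrite BbarE -!mulmxA (mulmxA (perm_mx p)^T) PPT mul1mx.
    rewrite (mulmxA (Bbar sigma B)) mulmxV// mul1mx.
    exact: mulmx1C PPT.
  by rewrite mulmxA mulVmx// mul1mx.
by rewrite permT mxE.
Qed.

Let reindexp (F : 'I_m -> R) : \sum_i F (p i) = \sum_i F i.
Proof. by rewrite [RHS](reindex_inj (@perm_inj _ p)). Qed.

Let AbarE i : Abar sp B i = Abar sigma B (p i).
Proof.
rewrite /Abar -[RHS](reindexp (fun j => abar sigma B (p i) j)).
by apply: eq_bigr => j _; rewrite abarE.
Qed.

Let SbarE : Sbar sp B = Sbar sigma B.
Proof. by rewrite /Sbar -[RHS]reindexp; apply: eq_bigr => i _; exact: AbarE. Qed.

Let LbarE i : Lbar sp mu B i = Lbar sigma mu B (p i).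
Proof. by rewrite /Lbar SbarE AbarE. Qed.

Lemma main_term_perm x : main_term sp mu B x = main_term sigma mu B x.
Proof.
rewrite /main_term /Cconst det_perm_bar SbarE.
have -> : \prod_(i < m) `|Abar sp B i| = \prod_(i < m) `|Abar sigma B i|.
  rewrite [RHS](reindex_inj (@perm_inj _ p)).
  by apply: eq_bigr => i _; rewrite AbarE.
have -> : \sum_(i < m) \sum_(k < m) abar sp B i k * Lbar sp mu B i * Lbar sp mu B k =
    \sum_(i < m) \sum_(k < m) abar sigma B i k * Lbar sigma mu B i * Lbar sigma mu B k.
  rewrite -[RHS]reindexp; apply: eq_bigr => i _; rewrite -[RHS]reindexp.
  by apply: eq_bigr => k _; rewrite abarE !LbarE.
have -> : \sum_(i < m) Abar sp B i * Lbar sp mu B i =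
    \sum_(i < m) Abar sigma B i * Lbar sigma mu B i.
  by rewrite -[RHS]reindexp; apply: eq_bigr => k _; rewrite AbarE !LbarE.
by [].
Qed.

End permutation.

(** * Coordinates outside the support *)

Section tails.
Context {R : realType}.
Local Notation leb := (@lebesgue_measure R).

(** For [x >= m + r] one has [(x - m)^2 >= r^2 + (x - m - r)^2], so the density is at most the
    claimed factor times a normal density centred at [m + r], of total mass 1. *)
Lemma normal_tail (m s r : R) : 0 < s -> 0 <= r ->
  (normal_prob m s [set x | m + r <= x]%R <= (expR (- (r ^+ 2 / (2 * s ^+ 2)))%R)%:E)%E.
Proof.
move=> s0 r0; have s2 : 0 < s ^+ 2 by rewrite exprn_gt0.
have mA : measurable [set x : R | m + r <= x].
  exact: (@measurable_set_ge _ _ (measurableTypeR R) _ id (@measurable_id _ _ _)).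
have mg : measurable_fun [set: R] (fun x : R => (gpdf (s ^+ 2) (x + - (m + r)))%:E).
  apply/measurable_EFinP; apply: (measurableT_comp (measurable_gpdf _)).
  exact: measurable_funD.
have mg0 : measurable_fun [set: R] (fun x : R => (gpdf (s ^+ 2) x)%:E).
  by apply/measurable_EFinP; exact: measurable_gpdf.
have g0 (x : R) : (0 <= (gpdf (s ^+ 2) x)%:E)%E by rewrite lee_fin gpdf_ge0.
have mN : measurable_fun [set: R] (fun y : R => (normal_pdf m s y)%:E).
  by apply/measurable_EFinP; exact: measurable_normal_pdf.
have mP := (measurable_restrictT (fun y : measurableTypeR R => (normal_pdf m s y)%:E) mA).1
  (measurable_funTS mN).
rewrite /normal_prob integral_mkcond.
have step : ((\int[leb]_x (((fun y => (normal_pdf m s y)%:E) \_ [set x | (m + r <= x)%R]) x))%E <=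
    \int[leb]_x ((expR (- (r ^+ 2 / (2 * s ^+ 2)))%R)%:E *
      (gpdf (s ^+ 2) (x + - (m + r))%R)%:E))%E.
  apply: ge0_le_integral => //.
  - by move=> x _; rewrite erestrict_ge0// => y _; rewrite lee_fin normal_pdf_ge0.
  - by apply: emeasurable_funM.
  - move=> x _; rewrite patchE; case: ifPn => [|_]; last first.
      by rewrite -EFinM lee_fin mulr_ge0 ?expR_ge0 ?gpdf_ge0.
    rewrite inE/= => hx; rewrite -EFinM lee_fin normal_pdf_gpdf// /gpdf [leRHS]mulrCA.
    apply: ler_wpM2l; first by rewrite invr_ge0 sqrtr_ge0.
    rewrite -expRD ler_expR.
    have -> : - (r ^+ 2 / (2 * s ^+ 2)) + - (x + - (m + r)) ^+ 2 / (s ^+ 2 *+ 2) =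
      - ((r ^+ 2 + (x - m - r) ^+ 2) / (s ^+ 2 *+ 2)) by field; rewrite gt_eqF.
    rewrite mulNr lerN2 ler_pM2r ?invr_gt0 ?mulrn_wgt0//.
    by nra.
apply: (le_trans step).
rewrite (ge0_integralZl leb measurableT mg (fun x _ => g0 _)) ?lee_fin ?expR_ge0//.
by rewrite (ge0_integral_shift (- (m + r)) mg0 g0) integral_gpdf// mule1.
Qed.

(** The strict gap [th = a ^+ 2 / t - S] leaves [- th * L ^+ 2 / 2] in the exponent, which by
    completing the square absorbs every linear and logarithmic term. *)
Lemma gauss_dominated (a t k S b p D : R) : 0 < t -> 0 < a -> 0 < D -> S * t < a ^+ 2 ->
  exists K L0 : R, [/\ 0 <= K, 1 <= L0 & forall L, L0 <= L -> 0 <= a * L - k /\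
    expR (- ((a * L - k) ^+ 2 / (2 * t))) <=
    K / L * (D * L `^ (- p) * expR (L * b) * expR (- 2^-1 * S * L ^+ 2))].
Proof.
move=> t0 a0 D0 hS.
pose th := a ^+ 2 / t - S.
have th0 : 0 < th by rewrite subr_gt0 ltr_pdivlMr.
(* Total linear coefficient: [|1 + p|] pays for [L^(1 + p)] through [ln L <= L], the 1 standing for
   the gain [1 / L]. *)
pose b2 := a * k / t - b + `|1 + p|.
exists (expR (b2 ^+ 2 / (2 * th)) / D), (Num.max 1 (k / a)); split.
- by rewrite divr_ge0 ?expR_ge0// ltW.
- by rewrite le_max lexx.
move=> L; rewrite ge_max ler_pdivrMr// => /andP[L1 hk]; have L0 : 0 < L by lra.
split; first by lra.
have -> : expR (b2 ^+ 2 / (2 * th)) / D / L *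
    (D * L `^ (- p) * expR (L * b) * expR (- 2^-1 * S * L ^+ 2)) =
    expR (b2 ^+ 2 / (2 * th) - (1 + p) * ln L + L * b - 2^-1 * S * L ^+ 2).
  have -> : L `^ (- p) = expR (- p * ln L) by rewrite /powR gt_eqF.
  have -> : b2 ^+ 2 / (2 * th) - (1 + p) * ln L + L * b - 2^-1 * S * L ^+ 2 =
    b2 ^+ 2 / (2 * th) + (- ln L + (- p * ln L + (L * b + - 2^-1 * S * L ^+ 2))) by ring.
  rewrite !expRD (expRN (ln L)) lnK ?posrE//.
  by field; rewrite !gt_eqF.
rewrite ler_expR.
have l0 : 0 <= ln L by exact: ln_ge0.
have l1 : ln L <= L.
  by have := expR_ge1Dx (ln L); rewrite lnK ?posrE//; lra.
have h1 : (1 + p) * ln L <= `|1 + p| * L.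
  apply: (@le_trans _ _ (`|1 + p| * ln L)); first by rewrite ler_wpM2r ?ler_norm.
  by rewrite ler_wpM2l.
have h2 : b2 * L - 2^-1 * th * L ^+ 2 <= b2 ^+ 2 / (2 * th).
  rewrite -subr_ge0.
  have -> : b2 ^+ 2 / (2 * th) - (b2 * L - 2^-1 * th * L ^+ 2) = (th * L - b2) ^+ 2 / (2 * th).
    by field; rewrite gt_eqF.
  by rewrite divr_ge0 ?sqr_ge0// mulr_ge0// ltW.
have h3 : - ((a * L - k) ^+ 2 / (2 * t)) =
    - (2^-1 * (th + S) * L ^+ 2) + (b2 + b - `|1 + p|) * L - k ^+ 2 / (2 * t).
  by rewrite /th /b2; field; rewrite gt_eqF.
have h4 : 0 <= k ^+ 2 / (2 * t) by rewrite divr_ge0 ?sqr_ge0// mulr_ge0// ltW.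
rewrite h3; move: (k ^+ 2 / _) (b2 ^+ 2 / _) h2 h4 => x y h2 h4; lra.
Qed.

(** In the centred variables [v], the exponential constraint has normal [w] at its boundary point
    [v = 0] and lies on one side of the tangent hyperplane; a bound for a single linear combination
    of the [y i] follows. *)
Lemma exceed_lin m (w y : 'I_m.+1 -> R) (L : R) : 0 < w ord0 ->
  (forall i, i != ord0 -> w i < 0) -> \sum_i w i = 1 ->
  expR L <= \sum_i sign0 i * expR (y i) ->
  L + \sum_i w i * ln `|w i| <= \sum_i w i * y i.
Proof.
move=> w0 wneg w1 hL.
have wn0 i : w i != 0.
  by have [->|i0] := eqVneq i ord0; [rewrite gt_eqF|rewrite lt_eqF// wneg].
pose v i := y i - L - ln `|w i|.
have vE i : sign0 i * expR (y i) = expR L * (w i * expR (v i)).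
  have -> : y i = L + (ln `|w i| + v i) by rewrite /v; ring.
  rewrite !expRD lnK ?posrE ?normr_gt0//.
  rewrite /sign0; case: (eqVneq i ord0) => [->|/wneg wi].
    by rewrite (gtr0_norm w0); ring.
  by rewrite (ltr0_norm wi); ring.
have hv : 1 <= \sum_i w i * expR (v i).
  rewrite -(ler_pM2l (expR_gt0 L)) mulr1 mulr_sumr; apply: le_trans hL _.
  by apply/ler_sum => i _; rewrite vE.
(* The tangent line of exp at [v ord0] reduces the constraint to a linear one. *)
suff : 0 <= \sum_i w i * v i.
  have -> : \sum_i w i * v i = \sum_i w i * y i - L - \sum_i w i * ln `|w i|.
    rewrite -[X in _ - X - _]mul1r -w1 mulr_suml -!sumrB; apply: eq_bigr => i _.
    by rewrite /v; ring.
  lra.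
set a := v ord0.
have tan i : w i * expR (v i) <= expR a * (w i * (1 + (v i - a))).
  have -> : expR (v i) = expR a * expR (v i - a) by rewrite -expRD; congr expR; ring.
  rewrite mulrCA ler_pM2l ?expR_gt0//.
  have [->|i0] := eqVneq i ord0; first by rewrite -/a subrr expR0 addr0.
  by rewrite ler_nM2l ?wneg// expR_ge1Dx.
have : 1 <= expR a * (\sum_i w i * (1 + (v i - a))).
  by apply: le_trans hv _; rewrite mulr_sumr; apply: ler_sum => i _.
have -> : \sum_i w i * (1 + (v i - a)) = 1 - a + \sum_i w i * v i.
  rewrite -[X in X + _]mulr1 -[X in _ * X + _]w1 mulr_sumr -big_split/=.
  by apply: eq_bigr => i _; ring.
(* The hypothesis becomes [exp (- a) <= 1 - a + w . v], to be combined with [1 - a <= exp (- a)]. *)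
rewrite mulrC -ler_pdivrMr ?expR_gt0// div1r -expRN.
by have := expR_ge1Dx (- a); lra.
Qed.

End tails.

Section main_term_log.
Context {R : realType}.
Variables (n m : nat) (sigma : 'I_m -> 'I_n.+1) (mu : 'rV[R]_n.+1) (B : 'M[R]_n.+1).
Local Notation b := (\sum_(i < m) Abar sigma B i * Lbar sigma mu B i).
Local Notation S := (Sbar sigma B).

Lemma main_term_expR L : main_term sigma mu B (expR L) =
  Cconst sigma mu B / S * L `^ (- ((1 + m%:R) / 2)) * expR (L * b) *
  expR (- 2^-1 * S * L ^+ 2).
Proof.
rewrite /main_term expRK; congr (_ * _ * _).
by rewrite /powR gt_eqF ?expR_gt0// expRK mulrC.
Qed.

Lemma main_coef_gt0 : posdef (Bbar sigma B) -> 0 < S -> (forall i, Abar sigma B i != 0) ->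
  0 < Cconst sigma mu B / S.
Proof.
move=> pB S0 A0; rewrite divr_gt0// !mulr_gt0 ?expR_gt0//.
  by rewrite invr_gt0 sqrtr_gt0 mulr_gt0 ?posdef_det_gt0// mulrn_wgt0// pi_gt0.
by rewrite sqrtr_gt0 divr_gt0//; apply: prodr_gt0 => i _; rewrite normr_gt0.
Qed.

(** The shift changes [S * L ^+ 2 / 2] by [S * (2 * L^-1 + L^-4) / 2 = O(1 / L)]; a shift of order
    [1 / L] would already cost a constant factor. *)
Lemma main_term_shift : exists2 h : R -> R, near1 h & forall L, 1 <= L ->
  main_term sigma mu B (expR (L + L ^- 2)) = main_term sigma mu B (expR L) * h L.
Proof.
exists (fun L => \prod_(i < m.+1) Num.sqrt (L / (L + L ^- 2)) *
  expR (L ^- 2 * b - 2^-1 * S * (2 * L^-1 + L ^- 2 ^+ 2))).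
  apply: near1_mul.
    apply: near1_prod => _; apply: near1_sqrt; apply: (near1_perturb near1_cst).
    exists 1, 1 => L L1; have L0 : 0 < L by lra.
    have V0 : 0 < L ^- 2 by rewrite invr_gt0 exprn_gt0.
    have LV : 0 < L + L ^- 2 by rewrite addr_gt0.
    have V1 : L ^- 2 <= 1 by rewrite invf_le1 ?exprn_gt0// exprn_ege1.
    have -> : L / (L + L ^- 2) - 1 = - (L ^- 2 / (L + L ^- 2)).
      by move: (L ^- 2) V0 LV V1 => v v0 lv _; field; rewrite gt_eqF.
    rewrite normrN (ger0_norm (ltW (divr_gt0 V0 LV))).
    apply: ler_pM => //; first exact: ltW.
      by rewrite invr_ge0 ltW.
    by rewrite lef_pV2 ?posrE// lerDl ltW.
  apply: near1_exp; exists (`|b| + 2^-1 * `|S| * 3), 1 => L L1.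
  have L0 : 0 < L by lra.
  have Vi0 : 0 < L^-1 by rewrite invr_gt0.
  have Vi1 : L^-1 <= 1 by rewrite invf_le1.
  rewrite -exprVn; move: (L^-1) Vi0 Vi1 => u u0 u1.
  apply: le_trans (ler_normB _ _) _; rewrite [leRHS]mulrDl; apply: lerD.
    rewrite normrM mulrC ler_wpM2l// ger0_norm ?sqr_ge0//.
    by rewrite expr2 ler_piMl// ltW.
  rewrite !normrM (ger0_norm (_ : 0 <= 2^-1 :> R))// -[leRHS]mulrA.
  apply: ler_wpM2l; first by rewrite mulr_ge0.
  have u2 : 0 <= u ^+ 2 <= u by rewrite sqr_ge0/= expr2 ler_piMl// ltW.
  have u4 : 0 <= u ^+ 2 ^+ 2 <= u.
    by rewrite sqr_ge0/=; case/andP: u2 => h1 h2; nra.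
  rewrite ger0_norm; first by case/andP: u4; lra.
  by case/andP: u4; lra.
move=> L L1; have L0 : 0 < L by lra.
have V0 : 0 < L ^- 2 by rewrite invr_gt0 exprn_gt0.
have LV : 0 < L + L ^- 2 by rewrite addr_gt0.
rewrite !main_term_expR !powR_half_opp// prodr_const card_ord.
rewrite (sqrtrM _ (ltW L0)) sqrtrV ?ltW// expr_div_n.
have l1 : Num.sqrt L ^+ m.+1 != 0 by rewrite expf_neq0// gt_eqF// sqrtr_gt0.
have l2 : Num.sqrt (L + L ^- 2) ^+ m.+1 != 0 by rewrite expf_neq0// gt_eqF// sqrtr_gt0.
have -> : expR (L ^- 2 * b - 2^-1 * S * (2 * L^-1 + L ^- 2 ^+ 2)) =
  expR ((L + L ^- 2) * b) * expR (- 2^-1 * S * (L + L ^- 2) ^+ 2) /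
  (expR (L * b) * expR (- 2^-1 * S * L ^+ 2)).
  by rewrite -!expRD -expRN -expRD; congr expR; field; rewrite gt_eqF.
move: (Num.sqrt L ^+ _) (Num.sqrt (L + _) ^+ _) l1 l2 => l k l1 l2.
move: (Cconst _ _ _ / _) => D.
by field; rewrite l1 l2 !gt_eqF ?expR_gt0.
Qed.

End main_term_log.

(** * From the coordinates on the support to the full sum *)

Section sandwich.
Context {R : realType} d (T : measurableType d) (P : probability T R).
Variables (n m : nat) (Y : 'I_n.+1 -> {RV P >-> R}) (mu : 'rV[R]_n.+1) (B : 'M[R]_n.+1)
  (w : 'rV[R]_n.+1) (sigma : 'I_m.+1 -> 'I_n.+1).
Hypotheses (HY : gaussian_vector Y mu B) (pB : posdef B)
  (wmin : is_simplex_minimizer B w) (inj : injective sigma) (sigma0 : sigma ord0 = ord0)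
  (supp : forall k, w 0 k != 0 -> exists i, sigma i = k) (supp0 : forall i, w 0 (sigma i) != 0)
  (off : forall j, w 0 j = 0 -> qform B (delta_mx 0 j - w) w != 0).
Local Notation s := (qform B w w).

Let s0 : 0 < s. Proof. exact: minimizer_qform_gt0 pB wmin. Qed.

Let w0 : 0 < w 0 (sigma ord0).
Proof. by rewrite sigma0; have := simplex_head_ge1 wmin; lra. Qed.

Let wneg i : i != ord0 -> w 0 (sigma i) < 0.
Proof.
move=> i0; rewrite lt_neqAle supp0/=; case: wmin => -[_ [h _]] _; apply: h.
by rewrite -sigma0 (inj_eq inj).
Qed.

Let w1 : \sum_i w 0 (sigma i) = 1.
Proof. exact: sum_support wmin inj supp. Qed.

Let pBb : posdef (Bbar sigma B). Proof. exact: posdef_sub. Qed.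

Let S0 : 0 < Sbar sigma B.
Proof. by rewrite (Sbar_minimizer pB wmin inj supp supp0) invr_gt0. Qed.

Let AE i : Abar sigma B i = Sbar sigma B * w 0 (sigma i).
Proof.
by rewrite (Abar_minimizer pB wmin inj supp supp0) (Sbar_minimizer pB wmin inj supp supp0).
Qed.

Let D0 : 0 < Cconst sigma mu B / Sbar sigma B.
Proof. by apply: main_coef_gt0 => // i; rewrite AE mulf_neq0// gt_eqF. Qed.

Let main L := main_term sigma mu B (expR L).

Let main_gt0 L : 0 < L -> 0 < main L.
Proof.
move=> L0; rewrite /main main_term_expR; apply: mulr_gt0; last exact: expR_gt0.
apply: mulr_gt0; last exact: expR_gt0.
by apply: mulr_gt0; [exact: D0|exact: powR_gt0].
Qed.

Definition exceed L : set T :=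
  [set x | expR L <= \sum_i sign0 i * expR (Y (sigma i) x)].

(* Raising the level of [exceed] from [L] to [L + L ^- 2] leaves a margin of at
   least [expR L / L ^+ 2], shared evenly by the at most [n] discarded terms. *)
Definition crossing j L : set T :=
  exceed L `&` [set x | expR L <= n.+1%:R * L ^+ 2 * expR (Y j x)].

Let mexceed L : measurable (exceed L).
Proof.
apply: measurable_set_ge; apply: measurable_sum => i; apply: measurable_funM => //.
by apply: measurableT_comp => //; exact: measurable_funP.
Qed.

Let mcrossing j L : measurable (crossing j L).
Proof.
apply: measurableI; first exact: mexceed.
apply: measurable_set_ge; apply: measurable_funM => //.
by apply: measurableT_comp => //; exact: measurable_funP.
Qed.

Let exceed_asymp : exists2 f : R -> R, near1 f & exists L1 : R, forall L, L1 <= L ->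
  P (exceed L) = (main L * f L)%:E.
Proof.
have [f nf [L1 Hf]] := gprob_asymp mu pBb S0 AE w0 wneg w1.
exists f => //; exists L1 => L /Hf <-.
have := gaussian_subvector_law HY pBb (@measurable_exceed _ _ _ sigma mu L).
move=> <-; congr (P _); apply/seteqP; split => x /=.
  by rewrite /exceed/=; under [in X in _ -> X]eq_bigr do rewrite tnth_mktuple subrK.
by rewrite /exceed/=; under eq_bigr do rewrite tnth_mktuple subrK.
Qed.

(** On the event, [Y_j >= c * L] for large [L], so by [exceed_lin] the combination of [Y] with
    coefficients [w + eta *: e_j] is at least [(1 + eta * c) * L] up to a constant. [normal_tail]
    and [gauss_dominated] make this negligible. *)
Let crossing_small j : w 0 j = 0 -> exists K L0 : R, [/\ 0 <= K, 1 <= L0 &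
  forall L, L0 <= L -> (P (crossing j L) <= (K / L * main L)%:E)%E].
Proof.
move=> wj; have [sB pos] := pB.
set q := qform B (delta_mx 0 j) (delta_mx 0 j).
have q0 : 0 < q.
  apply: pos; apply/eqP => /rowP/(_ j); rewrite !mxE !eqxx/= => /eqP.
  by rewrite oner_eq0.
(* The optimality conditions only give [g <= s]; (A1) excludes equality. *)
set g := grad B w j; pose rho := s - g.
have rho0 : 0 < rho.
  rewrite subr_gt0 lt_neqAle (qform_grad pB wmin) (grad_le pB wmin) andbT.
  apply/eqP => gE; have /eqP := off wj; apply.
  rewrite -scaleN1r qformDl qformZl -/(grad B w j) -/g gE (qform_grad pB wmin).
  by rewrite mulN1r subrr.
(* [c < 1] lets [exp ((1 - c) * L)] outgrow the polynomial in [crossing], the second entry keeps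
   half of the gap [rho], and the entry 1/2 makes [c] positive. *)
pose c := Num.max 2^-1 (1 - rho / (2 * s)).
have c0 : 0 < c by rewrite lt_max invr_gt0 ltr0n.
have c1 : c < 1.
  rewrite gt_max; apply/andP; split; first by lra.
  by rewrite ltrBlDr ltrDl divr_gt0// mulr_gt0.
have cs : rho / 2 <= c * s - g.
  have : (1 - rho / (2 * s)) * s <= c * s by rewrite ler_pM2r// le_max lexx orbT.
  have -> : (1 - rho / (2 * s)) * s = s - rho / 2 by field; rewrite gt_eqF.
  by rewrite /rho; lra.
(* Chernoff bound along [w + eta *: e_j]: for small [eta > 0] the tail exponent
   [a ^+ 2 / qform B t t] strictly exceeds [Sbar], because [g < c * s]. *)
pose eta := rho / (2 * q).
have eta0 : 0 < eta by rewrite divr_gt0// mulr_gt0.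
have etaq : eta * q = rho / 2 by rewrite /eta; field; rewrite gt_eqF.
pose t := w + eta *: delta_mx 0 j.
pose a := 1 + eta * c.
have a0 : 0 < a by rewrite addr_gt0// mulr_gt0.
have tE : qform B t t = s + 2 * eta * g + eta ^+ 2 * q.
  by rewrite qform_expand// (qform_sym w _ sB).
have t0 : 0 < qform B t t.
  apply: pos; apply/eqP => /rowP/(_ ord0); rewrite !mxE eqxx/=.
  have := w0; rewrite sigma0 => w00.
  case: (eqVneq ord0 j) => [jE|_]; last by rewrite mulr0n mulr0; lra.
  by move: w00; rewrite jE wj ltxx.
have hS : Sbar sigma B * qform B t t < a ^+ 2.
  rewrite (Sbar_minimizer pB wmin inj supp supp0) mulrC ltr_pdivrMr// tE /a.
  have h1 : eta * (rho / 2) <= eta * (c * s - g) by rewrite ler_pM2l.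
  have h2 : 0 <= (eta * c) ^+ 2 * s by rewrite mulr_ge0 ?sqr_ge0 ?ltW.
  have h3 : eta ^+ 2 * q = eta * (rho / 2) by rewrite expr2 -mulrA etaq.
  have h4 : 0 < eta * (rho / 2) by rewrite mulr_gt0// divr_gt0.
  by rewrite h3; lra.
pose c2 := \sum_i w 0 (sigma i) * ln `|w 0 (sigma i)|.
pose mt := \sum_i t 0 i * mu 0 i.
have [K [L0 [K0 L01 HK]]] := gauss_dominated (mt - c2)
  (\sum_(i < m.+1) Abar sigma B i * Lbar sigma mu B i) ((1 + m.+1%:R) / 2) t0 a0 D0 hS.
(* The second threshold gives [n.+1 * L^2 <= exp ((1 - c) * L)], by [x^3 <= 6 exp x] at
   [x = (1 - c) * L]. *)
exists K, (Num.max L0 (6 * n.+1%:R / (1 - c) ^+ 3)); split=> //.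
  by rewrite le_max L01.
move=> L; rewrite ge_max => /andP[hL hL'].
have [r0 rbnd] := HK L hL; have Lgt0 : 0 < L by lra.
have c3 : 0 < (1 - c) ^+ 3 by rewrite exprn_gt0// subr_gt0.
have growth : n.+1%:R * L ^+ 2 <= expR ((1 - c) * L).
  have h : ((1 - c) * L) ^+ 3 <= 6 * expR ((1 - c) * L).
    apply: le_trans (expr_le_exp 3 _) _; last by rewrite !factS fact0.
    by rewrite mulr_ge0 ?subr_ge0 ?ltW.
  rewrite -(ler_pM2l (_ : 0 < 6))//; apply: le_trans h.
  have hL2 : 6 * n.+1%:R <= L * (1 - c) ^+ 3 by rewrite -ler_pdivrMr.
  have -> : 6 * (n.+1%:R * L ^+ 2) = 6 * n.+1%:R * L ^+ 2 by rewrite mulrA.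
  have -> : ((1 - c) * L) ^+ 3 = L * (1 - c) ^+ 3 * L ^+ 2 by ring.
  by apply: ler_wpM2r hL2; exact: sqr_ge0.
rewrite /main main_term_expR.
apply: (@le_trans _ _ (expR (- ((a * L - (mt - c2)) ^+ 2 / (2 * qform B t t))))%:E).
  rewrite -(sqr_sqrtr (ltW t0)).
  apply: le_trans (normal_tail mt _ r0); last by rewrite sqrtr_gt0.
  have [_ [_ /(_ t)[/(_ t0) law _]]] := HY.
  have mA : measurable [set x : R | mt + (a * L - (mt - c2)) <= x].
    exact: (@measurable_set_ge _ _ (measurableTypeR R) _ id (@measurable_id _ _ _)).
  rewrite -(law _ mA); apply: le_measure; rewrite ?inE.
  - exact: mcrossing.
  - rewrite -[X in measurable X]setTI.
    have ml : measurable_fun setT (lincomb t Y).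
      by apply: measurable_sum => i; apply: measurable_funM => //; exact: measurable_funP.
    exact: ml.
  - move=> x [/= hx hj].
    have lin := exceed_lin w0 wneg w1 hx.
    have Yj : c * L <= Y j x.
      have : expR L <= expR ((1 - c) * L) * expR (Y j x).
        by apply: le_trans hj _; rewrite ler_pM2r ?expR_gt0.
      by rewrite -expRD ler_expR; lra.
    have -> : lincomb t Y x = \sum_i w 0 (sigma i) * Y (sigma i) x + eta * Y j x.
      rewrite (@sum_inj _ _ _ sigma (fun k => w 0 k * Y k x))//; last first.
        by move=> k wk; apply: supp; apply: contraNneq wk => ->; rewrite mul0r.
      rewrite /lincomb /t; under eq_bigr do rewrite !mxE eqxx/= mulrDl.
      rewrite big_split/=; congr (_ + _).
      rewrite (bigD1 j)//= eqxx mulr1 big1 ?addr0// => k /negbTE kj.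
      by rewrite kj mulr0 mul0r.
    have := ler_wpM2l (ltW eta0) Yj; rewrite -/c2 in lin.
    by rewrite /a; lra.
by rewrite lee_fin.
Qed.

Let sign_sigma i : sign0 (sigma i) = sign0 i :> R.
Proof. by rewrite /sign0 -{1}sigma0 (inj_eq inj). Qed.

Let X1E x : X1 Y x = \sum_i sign0 i * expR (Y (sigma i) x) -
  \sum_(k | w 0 k == 0) expR (Y k x).
Proof.
pose F k : R := if w 0 k == 0 then 0 else sign0 k * expR (Y k x).
have -> : \sum_i sign0 i * expR (Y (sigma i) x) = \sum_k F k.
  rewrite -(@sum_inj _ _ _ sigma F)//.
    by apply: eq_bigr => i _; rewrite /F (negbTE (supp0 i)) sign_sigma.
  by move=> k; rewrite /F; case: (eqVneq (w 0 k) 0) => [_|wk _]; [rewrite eqxx|exact: supp].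
have -> : X1 Y x = \sum_k sign0 k * expR (Y k x).
  rewrite /X1 [RHS](bigD1 ord0)//= {1}/sign0 eqxx mul1r -sumrN; congr (_ + _).
  by apply: eq_bigr => k /negbTE k0; rewrite /sign0 k0 mulN1r.
rewrite [X in _ - X]big_mkcond -sumrB; apply: eq_bigr => k _; rewrite /F.
case: (eqVneq (w 0 k) 0) => [wk|_]; last by rewrite subr0.
have k0 : k != ord0.
  by apply/eqP => k0; move: w0; rewrite sigma0 -k0 wk ltxx.
by rewrite /sign0 (negbTE k0) mulN1r sub0r.
Qed.

Let mX1 L : measurable [set x | expR L <= X1 Y x].
Proof.
apply: measurable_set_ge; rewrite /X1; apply: measurable_funB.
  by apply: measurableT_comp => //; exact: measurable_funP.
under eq_fun do rewrite big_mkcond/=.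
apply: measurable_sum => k; case: (k != ord0) => //.
by apply: measurableT_comp => //; exact: measurable_funP.
Qed.

Let X1_le L : [set x | expR L <= X1 Y x] `<=` exceed L.
Proof.
move=> x /=; rewrite /exceed/= X1E => h; apply: le_trans h _.
by rewrite gerBl; apply: sumr_ge0 => k _; exact: expR_ge0.
Qed.

Let X1_ge L : 1 <= L -> exceed (L + L ^- 2) `<=`
  [set x | expR L <= X1 Y x] `|` \big[setU/set0]_(k | w 0 k == 0) crossing k L.
Proof.
move=> L1 x hx; have L0 : 0 < L by lra.
have [|no] := pselect ((\big[setU/set0]_(k | w 0 k == 0) crossing k L) x); first by right.
left; rewrite /= X1E.
have V0 : 0 < L ^- 2 by rewrite invr_gt0 exprn_gt0.
have hxL : exceed L x.
  by move: hx; rewrite /exceed/=; apply: le_trans; rewrite ler_expR lerDl ltW.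
have small k : w 0 k == 0 -> expR (Y k x) <= expR L * (n.+1%:R^-1 * L ^- 2).
  move=> wk; rewrite leNgt; apply/negP => lt.
  apply: no; rewrite (bigD1 k)//=; left; split=> //=.
  rewrite -(ler_pM2r (_ : 0 < n.+1%:R^-1 * L ^- 2)); last first.
    by rewrite mulr_gt0// invr_gt0.
  apply: le_trans (ltW lt) _.
  have -> : n.+1%:R * L ^+ 2 * expR (Y k x) * (n.+1%:R^-1 * L ^- 2) =
    expR (Y k x) * (n.+1%:R / n.+1%:R) * (L ^+ 2 / L ^+ 2) by ring.
  by rewrite !divff ?mulr1// ?pnatr_eq0// gt_eqF// exprn_gt0.
have sum_small : \sum_(k | w 0 k == 0) expR (Y k x) <= expR L * L ^- 2.
  apply: (@le_trans _ _ (\sum_(k < n.+1) expR L * (n.+1%:R^-1 * L ^- 2))).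
    rewrite big_mkcond; apply: ler_sum => k _; case: ifPn => [/small//|_].
    by rewrite mulr_ge0 ?expR_ge0// mulr_ge0 ?invr_ge0 ?sqr_ge0.
  rewrite sumr_const card_ord -[leLHS]mulr_natl.
  have -> : n.+1%:R * (expR L * (n.+1%:R^-1 * L ^- 2)) = expR L * L ^- 2 *
    (n.+1%:R / n.+1%:R) by ring.
  by rewrite divff ?mulr1// pnatr_eq0.
move: hx; rewrite /exceed/= => hx.
have : expR L * (1 + L ^- 2) <= expR (L + L ^- 2).
  by rewrite expRD ler_pM2l ?expR_gt0// expR_ge1Dx.
by lra.
Qed.

Let union_bound (A : set T) (C : 'I_n.+1 -> set T) (r : seq 'I_n.+1) (Q : pred 'I_n.+1) :
  measurable A -> (forall k, measurable (C k)) ->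
  (P (A `|` \big[setU/set0]_(k <- r | Q k) C k) <= P A + \sum_(k <- r | Q k) P (C k))%E.
Proof.
move=> mA mC; elim: r => [|k r IH]; first by rewrite !big_nil setU0 adde0.
rewrite !big_cons; case: (Q k) => //.
rewrite setUCA addeCA; apply: le_trans (measureU2 _ _ _) _ => //.
  by apply: measurableU => //; exact: bigsetU_measurable.
by rewrite leeD2l.
Qed.

(** Squeeze: [exceed L] bounds the probability from above, and [exceed (L + L ^- 2)] minus the
    crossings from below; divided by the main term, both bounds are [1 + O(1 / L)]. *)
Theorem X1_asymp : exists2 f : R -> R, near1 f & exists L1 : R, forall L, L1 <= L ->
  P [set x | expR L <= X1 Y x] = (main L * f L)%:E.
Proof.
have [f nf [L1 Hf]] := exceed_asymp.
have [h nh Hh] := main_term_shift sigma mu B.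
have /choice[Kf] : forall j, exists K, exists L0 : R, w 0 j == 0 -> [/\ 0 <= K, 1 <= L0 &
    forall L, L0 <= L -> (P (crossing j L) <= (K / L * main L)%:E)%E].
  move=> j; case: (eqVneq (w 0 j) 0) => [/crossing_small[K [L0 H]]|]; first by exists K, L0.
  by exists 0, 0.
move=> /choice[Lf HKL].
pose K := \sum_(k | w 0 k == 0) Kf k.
pose p L := fine (P [set x | expR L <= X1 Y x]).
have nhf : near1 (fun L => h L * f (L + L ^- 2)).
  apply: near1_mul => //; case: nf => K' [L0 [K0 L01 H]]; exists K', L0; split=> // L hL.
  have L0' : 0 < L by lra.
  have V0 : 0 < L ^- 2 by rewrite invr_gt0 exprn_gt0.
  apply: le_trans (H _ _) _; first by lra.
  by rewrite ler_wpM2l// lef_pV2 ?posrE ?addr_gt0// lerDl ltW.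
have bnd : exists L2 : R, forall L, L2 <= L ->
    [/\ P [set x | expR L <= X1 Y x] = (p L)%:E, p L / main L <= f L &
      h L * f (L + L ^- 2) - K / L <= p L / main L].
  exists (1 + `|L1| + \sum_k `|Lf k|) => L hL.
  have s0' : 0 <= \sum_k `|Lf k| by apply: sumr_ge0.
  have l1 := ler_norm L1; have l2 := normr_ge0 L1.
  have L0 : 0 < L by lra.
  have V0 : 0 < L ^- 2 by rewrite invr_gt0 exprn_gt0.
  have M0 := main_gt0 L0.
  have pE : P [set x | expR L <= X1 Y x] = (p L)%:E.
    by rewrite fineK// fin_num_measure.
  split=> //.
    rewrite ler_pdivrMr// mulrC -lee_fin -pE -Hf; last by lra.
    by apply: le_measure (@X1_le L); rewrite inE; [exact: mX1|exact: mexceed].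
  rewrite ler_pdivlMr//.
  have : (P (exceed (L + L ^- 2)) <= (p L)%:E + (K / L * main L)%:E)%E.
    apply: (@le_trans _ _ (P ([set x | expR L <= X1 Y x] `|`
        \big[setU/set0]_(k | w 0 k == 0) crossing k L))).
      apply: le_measure (@X1_ge L _); rewrite ?inE; last by lra.
        exact: mexceed.
      by apply: measurableU => //; apply: bigsetU_measurable => k _; exact: mcrossing.
    apply: le_trans (union_bound _ _ (mX1 L) (fun k => mcrossing k L)) _.
    rewrite pE leeD2l// /K !mulr_suml -sumEFin; apply: lee_sum => k wk.
    have [_ _ H] := HKL k wk; apply: H; apply: le_trans hL.
    rewrite (bigD1 k)//=; have := ler_norm (Lf k).
    have : 0 <= \sum_(i < n.+1 | i != k) `|Lf i| by apply: sumr_ge0.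
    by lra.
  rewrite Hf; last by lra.
  rewrite /main Hh; last by lra.
  rewrite -EFinD lee_fin -/(main L) => H.
  have -> : (h L * f (L + L ^- 2) - K / L) * main L =
    main L * h L * f (L + L ^- 2) - K / L * main L by ring.
  lra.
exists (fun L => p L / main L).
  case: nf => Ka [La [Ka0 La1 Ha]]; case: nhf => Kb [Lb' [Kb0 Lb1 Hb]]; case: bnd => L2 H2.
  have K0 : 0 <= K by apply: sumr_ge0 => k /HKL[].
  exists (Ka + Kb + K), (Num.max La (Num.max Lb' L2)); split.
  - by rewrite !addr_ge0.
  - by rewrite le_max La1.
  move=> L; rewrite !ge_max => /and3P[hL /Hb hb /H2[_ u l]].
  have LV : 0 <= L^-1 by rewrite invr_ge0; lra.
  have ka := mulr_ge0 Ka0 LV; have kb := mulr_ge0 Kb0 LV; have kk := mulr_ge0 K0 LV.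
  have ha := Ha _ hL.
  move: ha hb; rewrite !ler_norml !mulrDl => /andP[a1 a2] /andP[b1 b2].
  by apply/andP; split; lra.
case: bnd => L2 H2; exists (Num.max 1 L2) => L; rewrite ge_max => /andP[h1 /H2[-> _ _]].
by rewrite mulrC divfK// gt_eqF// main_gt0//; lra.
Qed.

End sandwich.

Theorem theorem2 (R : realType) (d : measure_display) (T : measurableType d)
  (P : probability T R) (n : nat) (Y : 'I_n.+1 -> {RV P >-> R})
  (mu : 'rV[R]_n.+1) (B : 'M[R]_n.+1)
  (HY : gaussian_vector Y mu B) (HdetB : 0 < \det B)
  (wbar : 'rV[R]_n.+1) (Hwbar : is_simplex_minimizer B wbar)
  (nbar : nat) (sigma : 'I_nbar -> 'I_n.+1) (Hsigma_inj : injective sigma)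
  (Hsigma_supp : forall k : 'I_n.+1, (wbar 0 k != 0) <-> (exists i, sigma i = k))
  (HA1 : forall i : 'I_n.+1, wbar 0 i = 0 ->
           qform B (delta_mx 0 i - wbar) wbar != 0) :
  exists (K x0 : R), forall x : R, x0 < x ->
    exists r : R,
      P [set w | x <= X1 Y w] = (main_term sigma mu B x * (1 + r))%:E /\
      `|r| <= K / ln x.
Proof.
(* [gaussian_vector] supplies a semidefinite form; the determinant makes it definite. *)
have pB : posdef B by case: HY => sB [psd _]; exact: psd_posdef.
have w00 : wbar 0 ord0 != 0 by rewrite gt_eqF//; have := simplex_head_ge1 Hwbar; lra.
have [i0 si0] := (Hsigma_supp ord0).1 w00.
case: nbar sigma Hsigma_inj Hsigma_supp i0 si0 => [|m] sigma inj supp i0 si0.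
  by case: i0 {si0}.
(* The head index 0 occurs in the support at some position [i0], which also rules out an empty
   enumeration; swapping it to the front meets the hypothesis [sigma0] of [X1_asymp], and
   [main_term_perm] undoes the swap. *)
pose p := tperm ord0 i0; pose sp := sigma \o p.
have spinj : injective sp by apply: inj_comp => //; exact: perm_inj.
have sp0 : sp ord0 = ord0 by rewrite /sp/= tpermL.
have sps k : wbar 0 k != 0 -> exists i, sp i = k.
  by move=> /supp[i <-]; exists (p i); rewrite /sp/= tpermK.
have spn i : wbar 0 (sp i) != 0 by apply/supp; exists (p i).
have [f [K [L0 [K0 L01 Hf]]] [L1 HP]] := X1_asymp HY pB Hwbar spinj sp0 sps spn HA1.
exists K, (expR (Num.max L0 L1)) => x hx.
have x0 : 0 < x by apply: lt_trans hx; exact: expR_gt0.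
have hL : Num.max L0 L1 <= ln x by rewrite -ler_expR lnK ?posrE// ltW.
have /andP[h0 h1] : (L0 <= ln x) && (L1 <= ln x) by rewrite -ge_max.
exists (f (ln x) - 1); split; last exact: Hf.
have := HP _ h1; rewrite lnK ?posrE// => ->.
rewrite main_term_perm; last by apply: posdef_unit; exact: posdef_sub.
by rewrite addrC subrK.
Qed.
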